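(* Let $G=SO(2n+1)$ with $n\ge 1$ or $G=SO(2n)$ with $n\ge 2$, and let $\lambda\in\mathfrak t^*$ be a point in the interior of the positive Weyl chamber (i.e. a regular point). Let $\mathcal O_\lambda\subset\mathfrak g^*$ be the coadjoint orbit of $G$ through $\lambda$, with its Kostant–Kirillov symplectic form. Then the Gromov width of $\mathcal O_\lambda$ is at least $$\min\{\,|\langle \alpha^\vee,\lambda\rangle|\ ;\ \alpha^\vee \text{ a coroot of } G\,\}.$$
   Context: Notation. $R(\alpha)=\begin{pmatrix}\cos\alpha&-\sin\alpha\\ \sin\alpha&\cos\alpha\end{pmatrix}$, $L(a)=\begin{pmatrix}0&-a\\ a&0\end{pmatrix}$. The Lie algebra $\mathfrak g$ consists of skew-symmetric real matrices, and $\mathfrak g^*$ is identified with $\mathfrak g$ by the invariant pairing $(A,B)=-\tfrac12\operatorname{trace}(AB)$; the coadjoint action is conjugation. The maximal torus $T$ consists of block diagonal matrices $\operatorname{diag}(R(\alpha_1),\dots,R(\alpha_n),1)$ for $SO(2n+1)$ and $\operatorname{diag}(R(\alpha_1),\dots,R(\alpha_n))$ for $SO(2n)$. Correspondingly $\mathfrak t^*$ consists of the matrices $\operatorname{diag}(L(a_1),\dots,L(a_n),0)$, respectively $\operatorname{diag}(L(a_1),\dots,L(a_n))$, and is identified with $\mathbb R^n$ via $(a_1,\dots,a_n)$; the pairing becomes the standard scalar product. The positive Weyl chamber is $a_1\ge a_2\ge\dots\ge a_n\ge 0$ for $SO(2n+1)$ and $a_1\ge\dots\ge a_{n-1}\ge|a_n|$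 for $SO(2n)$. A point of $\mathfrak g^*$ and its orbit are regular if the stabilizer of the point is a maximal torus; regular orbits correspond to interior points $\lambda=(\lambda_1,\dots,\lambda_n)$ of the chamber. Roots: for $SO(2n+1)$, $\pm e_j$ and $\pm(e_j\pm e_k)$, $j\ne k$; for $SO(2n)$, $\pm(e_j\pm e_k)$, $j\neq k$. The coroot $\alpha^\vee$ of a root $\alpha$ satisfies $\langle\alpha^\vee,x\rangle=2\langle\alpha,x\rangle/\langle\alpha,\alpha\rangle$; thus $\langle(e_j\pm e_k)^\vee,\lambda\rangle=\lambda_j\pm\lambda_k$ and $\langle e_j^\vee,\lambda\rangle=2\lambda_j$. Symplectic form normalization: the circle is $S^1\cong\mathbb R/\mathbb Z$, with exponential map $L(a)\mapsto R(2\pi a)$, and the symplectic form on $\mathcal O_\lambda$ is the Kostant–Kirillov form for which the inclusion $\Phi:\mathcal O_\lambda\hookrightarrow\mathfrak g^*$ satisfies $\iota(\xi_M)\omega=d\langle\Phi,\xi\rangle$ for this exponential map. Explicitly, $\omega_x([X,x],[Y,x])=\tfrac1{2\pi}(x,[X,Y])$ for $x\in\mathcal O_\lambda$, $X,Y\in\mathfrak g$. The Gromov width of a $2N$-dimensional symplectic manifold $(M,\omega)$ is the supremum of the $a>0$ such that the ball $B^{2N}_a=\{z\in\mathbb C^N : \pi\sum_{i=1}^N|z_i|^2<a\}$, with the form $\sum dx_j\wedge dy_j$, embeds symplectically in $(M,\omega)$. *)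

(* Defs.v *)
From HB Require Import structures.
From mathcomp Require Import all_boot all_order all_algebra.
From mathcomp Require Import all_classical all_reals all_analysis.

Set Implicit Arguments.
Unset Strict Implicit.
Unset Printing Implicit Defensive.

Import Order.TTheory GRing.Theory Num.Theory.
Import numFieldNormedType.Exports.

Local Open Scope classical_set_scope.
Local Open Scope ring_scope.

Section Smooth.
Context {R : realType} {V W : normedModType R}.

(* C^k on an open set U: one asks for all iterated directional derivatives to
   exist and be continuous; the values of f outside U are irrelevant. *)
Fixpoint Ck_on (k : nat) (U : set V) (f : V -> W) : Prop :=
  match k with
  | 0 => forall z, U z -> {for z, continuous f}
  | k'.+1 => (forall z, U z -> differentiable f z) /\
             (forall v, Ck_on k' U (fun z => 'D_v f z))
  end.

Definition smooth_on (U : set V) (f : V -> W) : Prop :=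
  forall k, Ck_on k U f.

End Smooth.

Section GromovWidth.
Context {R : realType}.

(* C^N is written as R^N x R^N, the point x + iy being (x, y). *)
Definition std_ball (N : nat) (a : R) : set ('rV[R]_N * 'rV[R]_N) :=
  [set z : 'rV[R]_N * 'rV[R]_N | pi * (\sum_(i < N) (z.1 0 i ^+ 2 + z.2 0 i ^+ 2)) < a].
Arguments std_ball : clear implicits.

Definition std_form (N : nat) (u v : 'rV[R]_N * 'rV[R]_N) : R :=
  \sum_(i < N) (u.1 0 i * v.2 0 i - v.1 0 i * u.2 0 i).

(* M is an embedded submanifold of the normed space W, and omega x is a form on
   the tangent space of M at x, viewed inside W.  As M is embedded, a map into M
   is smooth iff it is smooth as a map into W, and its differential takes values
   in the tangent spaces of M.  The differential of a map pulling omega back to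
   std_form is automatically injective. *)
Definition symplectic_ball_embedding (W : normedModType R)
    (M : set W) (omega : W -> W -> W -> R) (N : nat) (a : R)
    (f : 'rV[R]_N * 'rV[R]_N -> W) : Prop :=
  [/\ smooth_on (std_ball N a) f,
      f @` std_ball N a `<=` M,
      exists g : W -> 'rV[R]_N * 'rV[R]_N,
        {within f @` std_ball N a, continuous g} /\
        (forall z, std_ball N a z -> g (f z) = z) &
      forall z, std_ball N a z -> forall u v,
        omega (f z) ('d f z u) ('d f z v) = std_form u v].

Definition gromov_width (W : normedModType R)
    (M : set W) (omega : W -> W -> W -> R) (N : nat) : \bar R :=
  ereal_sup [set a%:E | a in [set a : R | 0 < a /\
    exists f : 'rV[R]_N * 'rV[R]_N -> W,
      symplectic_ball_embedding M omega a f]].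

End GromovWidth.

Section CoadjointOrbits.
Context {R : realType} {m : nat}.
Implicit Types A B X Y x v g : 'M[R]_m.

Definition so : {vspace 'M[R]_m} := lker (linfun (fun X => X + X^T)).

Lemma soE X : (X \in so) = (X^T == - X).
Proof.
have linF : linear (fun X : 'M[R]_m => X + X^T).
  by move=> a A B; rewrite linearD linearZ /= scalerDr addrACA.
pose F : {linear 'M[R]_m -> 'M[R]_m} :=
  HB.pack (fun X : 'M[R]_m => X + X^T)
    (GRing.isLinear.Build _ _ _ _ (fun X : 'M[R]_m => X + X^T) linF).
by rewrite memv_ker (lfunE F) /= addrC addr_eq0.
Qed.

Definition SO : set 'M[R]_m := [set g | g *m g^T = 1%:M /\ \det g = 1].

Definition lie A B : 'M[R]_m := A *m B - B *m A.

Definition pairing A B : R := - (2^-1 * \tr (A *m B)).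

(* g^* is identified with g by the pairing, so that Ad^* is conjugation. *)
Definition coadjoint_orbit x : set 'M[R]_m :=
  [set g *m x *m invmx g | g in SO].

Definition orbit_tangent x : {vspace 'M[R]_m} :=
  (linfun (fun X => lie X x) @: so)%VS.

Lemma orbit_tangentP x v :
  reflect (exists2 X, X \in so & v = lie X x) (v \in orbit_tangent x).
Proof.
have linF : linear (fun X : 'M[R]_m => lie X x).
  move=> a A B; rewrite /lie mulmxDl mulmxDr -scalemxAl -scalemxAr.
  by rewrite scalerBr opprD addrACA.
pose F : {linear 'M[R]_m -> 'M[R]_m} :=
  HB.pack (fun X : 'M[R]_m => lie X x)
    (GRing.isLinear.Build _ _ _ _ (fun X : 'M[R]_m => lie X x) linF).
by apply: (iffP memv_imgP) => -[X Xso ->]; exists X; rewrite ?(lfunE F).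
Qed.

Definition orbit_dim x : nat := \dim (orbit_tangent x).

(* Some X in so(m) with [X, x] = v, and 0 if v is not tangent to the orbit. *)
Definition generator x v : 'M[R]_m :=
  xget 0 [set X | X \in so /\ lie X x = v].

Definition kk_form x v w : R :=
  (2 * pi)^-1 * pairing x (lie (generator x v) (generator x w)).

Lemma pairing_lie x A B : pairing x (lie A B) = - pairing (lie A x) B.
Proof.
rewrite /pairing /lie mulmxBr mulmxBl !linearB /= opprK -mulrN opprB.
by congr (_ * (_ - _)); rewrite mulmxA// mxtrace_mulC mulmxA.
Qed.

Lemma pairing_lieC x A B : pairing x (lie A B) = - pairing x (lie B A).
Proof. by rewrite /pairing /lie -opprB mulmxN linearN /= mulrN opprK. Qed.

Lemma kk_formE x X Y : X \in so -> Y \in so ->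
  kk_form x (lie X x) (lie Y x) = (2 * pi)^-1 * pairing x (lie X Y).
Proof.
have gen Z : Z \in so -> lie (generator x (lie Z x)) x = lie Z x.
  by move=> Zso; rewrite /generator; case: xgetP => [? _ []|/(_ Z)[]].
move=> Xso Yso; rewrite /kk_form; congr (_ * _).
by rewrite pairing_lie gen// -pairing_lie pairing_lieC pairing_lie gen//
  -pairing_lie -pairing_lieC.
Qed.

Definition orbit_gromov_width x : \bar R :=
  gromov_width (coadjoint_orbit x) kk_form (orbit_dim x)./2.

End CoadjointOrbits.

Section Torus.
Context {R : realType}.

(* diag(L(l_1), ..., L(l_n)) for m = 2n, diag(L(l_1), ..., L(l_n), 0) for
   m = 2n + 1. *)
Definition torus_mx (n m : nat) (l : 'rV[R]_n) : 'M[R]_m :=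
  \matrix_(i, j) \sum_(k < n) l 0 k *
    (((i == k.*2.+1 :> nat) && (j == k.*2 :> nat))%:R
     - ((i == k.*2 :> nat) && (j == k.*2.+1 :> nat))%:R).

Definition chamberB (n : nat) : set 'rV[R]_n :=
  [set a | (forall i j : 'I_n, j = i.+1 :> nat -> a 0 j <= a 0 i) /\
           (forall i : 'I_n, i.+1 = n -> 0 <= a 0 i)].

Definition chamberD (n : nat) : set 'rV[R]_n :=
  [set a | (forall i j : 'I_n, j = i.+1 :> nat -> (j.+1 < n)%N ->
              a 0 j <= a 0 i) /\
           (forall i j : 'I_n, j = i.+1 :> nat -> j.+1 = n ->
              `|a 0 j| <= a 0 i)].

Definition dot (n : nat) (u v : 'rV[R]_n) : R := \sum_(i < n) u 0 i * v 0 i.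

Definition short_pos (n : nat) : seq 'rV[R]_n :=
  [seq delta_mx 0 j | j <- enum 'I_n].

Definition long_pos (n : nat) : seq 'rV[R]_n :=
  [seq delta_mx 0 p.1 + delta_mx 0 p.2 |
     p <- enum {: 'I_n * 'I_n} & p.1 != p.2] ++
  [seq delta_mx 0 p.1 - delta_mx 0 p.2 |
     p <- enum {: 'I_n * 'I_n} & p.1 != p.2].

Definition with_opp (n : nat) (s : seq 'rV[R]_n) : seq 'rV[R]_n :=
  s ++ [seq - a | a <- s].

Definition rootsB (n : nat) : seq 'rV[R]_n :=
  with_opp (short_pos n ++ long_pos n).

Definition rootsD (n : nat) : seq 'rV[R]_n := with_opp (long_pos n).

Definition coroot (n : nat) (a : 'rV[R]_n) : 'rV[R]_n := (2 / dot a a) *: a.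

(* The default value +oo is only reached for an empty list of roots. *)
Definition min_coroot (n : nat) (roots : seq 'rV[R]_n) (l : 'rV[R]_n)
    : \bar R :=
  \big[Order.min/+oo%E]_(a <- roots) `|dot (coroot a) l|%:E.

End Torus.

Arguments chamberB R n : clear implicits.
Arguments chamberD R n : clear implicits.

(* Main.v *)
(* A ball of capacity a < min |<alpha^vee, l>| is embedded explicitly, by
   inverting Gelfand-Tsetlin coordinates.  Write m for the size of the matrices
   and let w_(j,i), j < m, i < j./2, be the complex coordinates of the ball.
   Put mu_(m,i) = l_i and mu_(j+1,i) - mu_(j,i) = pi |w_(j,i)|^2; on the ball
   these numbers form a Gelfand-Tsetlin pattern.  The matrix F_m with this
   pattern is built corner by corner: F_j = g_j T_j g_j^T, where T_j is the torus
   element with entries mu_(j,.) and g_(j+1) = g_j h_j.  The orthogonal matrix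
   h_j conjugates T_(j+1) to the bordered matrix S_j whose corner is T_j and whose
   border has components w_(j,i) p_(j,i) with p_(j,i) > 0 determined by the
   pattern.  After rotating every coordinate plane by the argument of w_(j,i),
   h_j consists of two orthogonal Cauchy matrices, whence all its properties when
   no w_(j,i) vanishes; since h_j is smooth on the whole ball (the boundaries
   w = 0 included), they extend by density.

   Reflection symmetry reduces tr (T_m g^T dg) to the contribution of the
   rotations, 2 pi sum (x dy - y dx), and differentiating this one-form gives the
   Kostant-Kirillov form.  Injectivity: F_m determines its corners F_j, their
   spectra determine mu_(j,i)^2, and the borders then determine the w_(j,i) and
   the signs, by upward induction on j.  The inverse is continuous because F_m
   is injective on a compact larger ball. *)

From HB Require Import structures.
Require Import Defs.
From mathcomp Require Import all_boot all_order all_algebra.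
From mathcomp Require Import all_classical all_reals all_analysis.
From mathcomp Require Import ring lra zify.
Import Order.TTheory GRing.Theory Num.Theory.
Import numFieldNormedType.Exports.
Local Open Scope classical_set_scope.
Local Open Scope ring_scope.

Set Implicit Arguments.
Unset Strict Implicit.
Unset Printing Implicit Defensive.

(** * Calculus in normed modules *)

(** Gelfand-Tsetlin coordinates degenerate precisely at the centre of the ball: w = 0 is the vertex
    of the pattern polytope where every row repeats the entries of l. There the angles are undefined
    and the Cauchy entries with equal indices become 0/0. Two facts remove the singularity. Since
    lam_i^2 - mu_i^2 = pi |w_i|^2 (lam_i + mu_i), the factor |w_i|^2 cancels from the diagonal
    quotients. And what remains can be taken equal for both Cauchy matrices: it is then a scalar on
    each coordinate plane, commutes with the rotations and needs no angle, while the other terms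
    contain the w_i as plain factors.

    The two Cauchy matrices C and N hold the left and right singular vectors of one bordered matrix
    M = C diag(lam) N^T.

    The bound on the capacity keeps the pattern strict. Entries with different i, i' involve
    disjoint coordinates, so their joint loss stays below a, hence below l_i - l_i' and l_i + l_i'.
    The short coroot 2 l_i enters only in the last step for odd m, where an entry of the even corner
    of size m - 1 may change sign; some square roots are therefore taken with a sign. *)

Section SmoothFunctions.
Context {R : realType} {V : normedModType R}.
Implicit Types (U : set V) (f g : V -> R) (z v : V).

(** The difference g - f vanishes near z, so it is o(id) with differential 0; [diff_unique]
    identifies this differential, and g = f + (g - f). *)
Lemma near_eq_differentiable (W : normedModType R) (f g : V -> W) z :
  {near z, f =1 g} -> differentiable f z -> differentiable g z.
Proof.
move=> fg df.
have -> : g = f + (g - f) by rewrite addrC subrK.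
apply: differentiableD => //.
have d0 : continuous (0 : V -> W) /\
    (g - f) \o shift z = cst ((g - f) z) + 0 +o_ 0 id.
  split; first exact: cst_continuous.
  have -> : (g - f) z = 0.
    by rewrite /= !fctE (nbhs_singleton fg) subrr.
  rewrite addr0; apply/eqaddoP => /= e e0.
  have : \forall x \near 0, f (x + z) = g (x + z).
    have /nbhs0P := fg; apply: filterS => x; by rewrite addrC.
  apply: filterS => x fgx; rewrite !fctE /= fgx !subrr normr0.
  by rewrite mulr_ge0// ltW.
apply/diff_locallyP; rewrite (diff_unique d0.1 d0.2); exact: d0.
Qed.

Lemma Ck_onW (W : normedModType R) k U (f : V -> W) :
  Ck_on k.+1 U f -> Ck_on k U f.
Proof.
elim: k f => [|k IH] f [df Df] /=.
  by move=> z Uz; apply: differentiable_continuous; apply: df.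
by split=> // v; apply: IH; apply: Df.
Qed.

(** The rules of differentiation give a derivative only at the points of U, so the closure
    properties of [Ck_on] below rely on this locality. *)
Lemma Ck_on_eq (W : normedModType R) k U (f g : V -> W) : open U ->
  (forall z, U z -> f z = g z) -> Ck_on k U f -> Ck_on k U g.
Proof.
move=> oU; elim: k f g => [|k IH] f g fg.
  move=> cf z Uz; have fgz : {near z, f =1 g} by apply: filterS (open_nbhs_nbhs (conj oU Uz)).
  rewrite /prop_for /continuous_at -(fg _ Uz).
  apply: cvg_trans (cf z Uz); apply: near_eq_cvg.
  by apply: filterS fgz => x ->.
case=> df Df; split=> [z Uz|v].
  apply: near_eq_differentiable (df z Uz).
  by apply: filterS (open_nbhs_nbhs (conj oU Uz)).
apply: IH (Df v) => z Uz; apply: near_eq_derive.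
by apply: filterS (open_nbhs_nbhs (conj oU Uz)).
Qed.

Lemma Ck_on_cst (W : normedModType R) k U (c : W) : Ck_on k U (fun=> c).
Proof.
elim: k c => [|k IH] c; first by move=> z Uz; exact: cst_continuous.
split=> [z Uz|v]; first exact: differentiable_cst.
rewrite (_ : 'D_v _ = (fun=> 0)); first exact: IH.
by apply/funext => z; exact: derive_cst.
Qed.

Lemma Ck_on_const k U (c : R) : Ck_on k U (fun=> c).
Proof. exact: Ck_on_cst. Qed.

Lemma Ck_on_derivable (W : normedModType R) k U (f : V -> W) z v :
  Ck_on k.+1 U f -> U z -> derivable f z v.
Proof. by case=> df _ Uz; apply: diff_derivable; apply: df. Qed.

Lemma Ck_onD (W : normedModType R) k U (f g : V -> W) : open U ->
  Ck_on k U f -> Ck_on k U g -> Ck_on k U (fun z => f z + g z).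
Proof.
move=> oU; elim: k f g => [|k IH] f g.
  by move=> cf cg z Uz; apply: continuousD; [apply: cf|apply: cg].
move=> Cf Cg; split=> [z Uz|v].
  by apply: differentiableD; [apply: Cf.1|apply: Cg.1].
apply: Ck_on_eq (IH _ _ (Cf.2 v) (Cg.2 v)) => // z Uz.
by rewrite -deriveD//; [exact: Ck_on_derivable Cf _|exact: Ck_on_derivable Cg _].
Qed.

Lemma Ck_onM k U f g : open U ->
  Ck_on k U f -> Ck_on k U g -> Ck_on k U (fun z => f z * g z).
Proof.
move=> oU; elim: k f g => [|k IH] f g.
  by move=> cf cg z Uz; apply: continuousM; [apply: cf|apply: cg].
move=> Cf Cg; split=> [z Uz|v].
  by apply: differentiableM; [apply: Cf.1|apply: Cg.1].
apply: Ck_on_eq (Ck_onD oU (IH _ _ (Ck_onW Cf) (Cg.2 v))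
                           (IH _ _ (Ck_onW Cg) (Cf.2 v))) => // z Uz.
by rewrite -(deriveM (f := f) (g := g))//;
  [exact: Ck_on_derivable Cf _|exact: Ck_on_derivable Cg _].
Qed.

Lemma Ck_onN k U f : open U -> Ck_on k U f -> Ck_on k U (fun z => - f z).
Proof.
move=> oU Cf; have := Ck_onM oU (Ck_on_const k U (-1)) Cf.
by apply: Ck_on_eq => // z _; rewrite mulN1r.
Qed.

Lemma Ck_onV k U f : open U -> (forall z, U z -> f z != 0) ->
  Ck_on k U f -> Ck_on k U (fun z => (f z)^-1).
Proof.
move=> oU f0; elim: k => [|k IH] Cf.
  by move=> z Uz; apply: continuousV; [apply: f0|apply: Cf].
split=> [z Uz|v].
  by apply: differentiableV; [apply: Cf.1|apply: f0].
have CV := IH (Ck_onW Cf).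
apply: Ck_on_eq (Ck_onN oU (Ck_onM oU (Ck_onM oU CV CV) (Cf.2 v))) => // z Uz.
rewrite (deriveV (f := f)) ?f0//; last exact: Ck_on_derivable Cf _.
by rewrite -expr2 exprVn scaleNr.
Qed.

Lemma Ck_on_sqrt k U f : open U -> (forall z, U z -> 0 < f z) ->
  Ck_on k U f -> Ck_on k U (fun z => Num.sqrt (f z)).
Proof.
move=> oU f0.
have dsqrt z : U z -> differentiable f z ->
    differentiable (fun z => Num.sqrt (f z)) z.
  move=> Uz df; apply: (differentiable_comp (g := Num.sqrt)) => //.
  by apply/derivable1_diffP; case: (is_derive1_sqrt (f0 _ Uz)).
elim: k => [|k IH] Cf.
  by move=> z Uz; apply: continuous_comp; [apply: Cf|exact: sqrt_continuous].
split=> [z Uz|v]; first by apply: dsqrt => //; apply: Cf.1.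
have s0 z : U z -> 2 * Num.sqrt (f z) != 0.
  by move=> Uz; rewrite mulf_neq0 ?pnatr_eq0// gt_eqF// sqrtr_gt0 f0.
have Cs := Ck_onM oU (Ck_on_const k U 2) (IH (Ck_onW Cf)).
apply: Ck_on_eq (Ck_onM oU (Ck_onV oU s0 Cs) (Cf.2 v)) => // z Uz.
set s := fun z => Num.sqrt (f z).
have ds : derivable s z v by apply: diff_derivable; apply: dsqrt => //; apply: Cf.1.
(* The derivative of the root s is obtained by solving the product rule for s * s = f. *)
have -> : 'D_v f z = 'D_v (s * s) z.
  apply: near_eq_derive; apply: filterS (open_nbhs_nbhs (conj oU Uz)) => y Uy.
  by rewrite !fctE -expr2 sqr_sqrtr// ltW// f0.
rewrite deriveM// -scalerDl -mulr2n -[s z *+ 2]mulr_natl.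
by rewrite -[X in _ * X]/(2 * s z * 'D_v s z) mulKf// s0.
Qed.

Lemma Ck_on_linear k U (f : {linear V -> R}) : continuous f -> Ck_on k U f.
Proof.
move=> cf; case: k => [|k]; first by move=> z Uz; exact: cf.
split=> [z Uz|v]; first exact: linear_differentiable.
rewrite (_ : 'D_v _ = (fun=> f v)); first exact: Ck_on_cst.
apply/funext => z; rewrite deriveE; last exact: linear_differentiable.
by rewrite diff_lin.
Qed.

Lemma Ck_on_sum (W : normedModType R) k U I (r : seq I) (P : pred I)
    (f : I -> V -> W) : open U ->
  (forall i, P i -> Ck_on k U (f i)) ->
  Ck_on k U (fun z => \sum_(i <- r | P i) f i z).
Proof.
move=> oU Cf; elim: r => [|i r IH].
  by apply: (Ck_on_eq oU) (Ck_on_cst k U 0) => z _; rewrite big_nil.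
case: (boolP (P i)) => Pi.
  by apply: Ck_on_eq (Ck_onD oU (Cf i Pi) IH) => // z _; rewrite big_cons Pi.
by apply: Ck_on_eq IH => // z _; rewrite big_cons (negPf Pi).
Qed.

Lemma Ck_on_prod k U I (r : seq I) (P : pred I) (f : I -> V -> R) : open U ->
  (forall i, P i -> Ck_on k U (f i)) ->
  Ck_on k U (fun z => \prod_(i <- r | P i) f i z).
Proof.
move=> oU Cf; elim: r => [|i r IH].
  by apply: (Ck_on_eq oU) (Ck_on_const k U 1) => z _; rewrite big_nil.
case: (boolP (P i)) => Pi.
  by apply: Ck_on_eq (Ck_onM oU (Cf i Pi) IH) => // z _; rewrite big_cons Pi.
by apply: Ck_on_eq IH => // z _; rewrite big_cons (negPf Pi).
Qed.

Lemma line_is_derive (W : normedModType R) (f : V -> W) z v (s : R) :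
  derivable f (z + s *: v) v ->
  is_derive s 1 (fun t => f (z + t *: v)) ('D_v f (z + s *: v)).
Proof.
have E : (fun h => h^-1 *: (((fun t => f (z + t *: v)) \o shift s) (h *: 1) -
      f (z + s *: v))) =
    (fun h : R => h^-1 *: ((f \o shift (z + s *: v)) (h *: v) - f (z + s *: v))).
  apply/funext => h /=; congr (_ *: (f _ - _)).
  by rewrite [h *: 1]mulr1 scalerDl addrCA.
by move=> df; apply: DeriveDef; rewrite /derivable /derive E.
Qed.

(** The mean value theorem is applied twice: along u to the increment of f in the direction v, then
    along v to the derivative of f in the direction u. *)
Lemma second_difference f U z u v (h : R) : 0 < h ->
  (forall s t : R, 0 <= s <= h -> 0 <= t <= h -> U (z + s *: u + t *: v)) ->
  Ck_on 2 U f ->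
  exists s t : R, [/\ 0 <= s <= h, 0 <= t <= h &
    f (z + h *: u + h *: v) - f (z + h *: u) - (f (z + h *: v) - f z) =
    'D_v ('D_u f) (z + s *: u + t *: v) * h * h].
Proof.
move=> h0 Ush Cf.
have hh : 0 <= h <= h by rewrite lexx ltW.
have h00 : 0 <= (0 : R) <= h by rewrite lexx ltW.
pose phi (s : R) := f (z + h *: v + s *: u) - f (z + s *: u).
have dphi (s : R) : 0 <= s <= h -> is_derive s 1 phi
    ('D_u f (z + h *: v + s *: u) - 'D_u f (z + s *: u)).
  move=> sh; apply: is_deriveB; apply: line_is_derive; apply: Ck_on_derivable Cf _.
    by rewrite addrAC; apply: Ush.
  by have := Ush _ _ sh h00; rewrite scale0r addr0.
have [||s sh ps] := MVT (f := phi) (df := fun s =>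
    'D_u f (z + h *: v + s *: u) - 'D_u f (z + s *: u)) h0.
- by move=> x /itvP xh; apply: dphi; rewrite !xh.
- apply: derivable_within_continuous => x /itvP xh.
  by case: (dphi x); rewrite ?xh.
have {}sh : 0 <= s <= h by rewrite !(itvP sh).
pose psi (t : R) := 'D_u f (z + s *: u + t *: v).
have dpsi (t : R) : 0 <= t <= h ->
    is_derive t 1 psi ('D_v ('D_u f) (z + s *: u + t *: v)).
  move=> th; apply: line_is_derive; exact: (@Ck_on_derivable _ 0 U _ _ _ (Cf.2 u) (Ush _ _ sh th)).
have [||t th pt] := MVT (f := psi) (df := fun t =>
    'D_v ('D_u f) (z + s *: u + t *: v)) h0.
- by move=> x /itvP xh; apply: dpsi; rewrite !xh.
- apply: derivable_within_continuous => x /itvP xh.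
  by case: (dpsi x); rewrite ?xh.
exists s, t; split=> //; first by rewrite !(itvP th).
rewrite subr0 in pt; rewrite -pt /psi scale0r addr0.
have := ps; rewrite subr0 /phi !scale0r !addr0 [z + h *: v + h *: u]addrAC => ->.
by rewrite [z + h *: v + s *: u]addrAC.
Qed.

(** The second difference is symmetric in u and v. Hence the two mixed derivatives agree at two
    points arbitrarily close to z, and continuity carries the equality to z. *)
Lemma Schwarz f U z u v : open U -> U z -> Ck_on 2 U f ->
  'D_u ('D_v f) z = 'D_v ('D_u f) z.
Proof.
move=> oU Uz Cf; apply/eqP; rewrite -subr_eq0 -normr_le0.
apply/ler_addgt0Pl => e e0; rewrite addr0.
have cA : {for z, continuous ('D_u ('D_v f))} by exact: ((Cf.2 v).2 u) z Uz.
have cB : {for z, continuous ('D_v ('D_u f))} by exact: ((Cf.2 u).2 v) z Uz.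
have e2 : 0 < e / 2 by rewrite divr_gt0.
have nz : \forall y \near z, [/\ U y, `|'D_u ('D_v f) z - 'D_u ('D_v f) y| <= e / 2 &
    `|'D_v ('D_u f) z - 'D_v ('D_u f) y| <= e / 2].
  have nA : \forall y \near z, `|'D_u ('D_v f) z - 'D_u ('D_v f) y| <= e / 2.
    by move/cvgrPdist_le : cA => /(_ _ e2).
  have nB : \forall y \near z, `|'D_v ('D_u f) z - 'D_v ('D_u f) y| <= e / 2.
    by move/cvgrPdist_le : cB => /(_ _ e2).
  by apply: filterS3 (open_nbhs_nbhs (conj oU Uz)) nA nB => y.
have [d /= d0 Hd] := (nbhs_ballP _ _).1 nz.
pose c := `|u| + `|v| + 1.
have c0 : 0 < c by rewrite ltr_wpDl// addr_ge0.
(* With this h the parallelogram spanned by h *: u and h *: v stays within d / 2 of z. *)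
pose h := d / 2 / c.
have h0 : 0 < h by rewrite !divr_gt0.
have small (s t : R) : 0 <= s <= h -> 0 <= t <= h -> ball z d (z + s *: u + t *: v).
  move=> /andP[s0 sh] /andP[t0 th].
  rewrite -ball_normE /= -addrA opprD addrA subrr add0r normrN.
  apply: (le_lt_trans (ler_normD _ _)); rewrite !normrZ !ger0_norm//.
  apply: (@le_lt_trans _ _ (h * c)); last first.
    by rewrite /h divfK ?gt_eqF// ltr_pdivrMr// ltr_pMr// ltr1n.
  rewrite /c !mulrDr mulr1 -[leLHS]addr0; apply: lerD; last exact: ltW.
  by apply: lerD; apply: ler_wpM2r.
have Us (s t : R) : 0 <= s <= h -> 0 <= t <= h -> U (z + s *: u + t *: v).
  by move=> sh th; have [] := Hd _ (small _ _ sh th).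
have [s [t [sh th E1]]] := second_difference h0 Us Cf.
have Us' (s' t' : R) : 0 <= s' <= h -> 0 <= t' <= h -> U (z + s' *: v + t' *: u).
  by move=> sh' th'; rewrite addrAC; apply: Us.
have [s' [t' [sh' th' E2]]] := second_difference h0 Us' Cf.
have EE : 'D_v ('D_u f) (z + s *: u + t *: v) = 'D_u ('D_v f) (z + t' *: u + s' *: v).
  apply: (mulIf (lt0r_neq0 h0)); apply: (mulIf (lt0r_neq0 h0)).
  rewrite (addrAC z (t' *: u)); apply: etrans (esym E1) (etrans _ E2).
  by rewrite (addrAC z (h *: v)) !opprB; ring.
have [_ _ B1] := Hd _ (small _ _ sh th).
have [_ A1 _] := Hd _ (small _ _ th' sh').
rewrite EE in B1; move: A1 B1.
generalize ('D_u ('D_v f) z) ('D_v ('D_u f) z)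
  ('D_u ('D_v f) (z + t' *: u + s' *: v)) => A B C AC BC.
rewrite distrC in BC; rewrite (splitr e).
exact: le_trans (ler_distD C A B) (lerD AC BC).
Qed.

End SmoothFunctions.

(** * Matrix-valued maps *)

Section SmoothMatrices.
Context {R : realType} {V : normedModType R}.
Implicit Types (U : set V) (z v : V).

Lemma Ck_on_scalel (W : normedModType R) k U (f : V -> R) (w : W) : open U ->
  Ck_on k U f -> Ck_on k U (fun z => f z *: w).
Proof.
move=> oU; elim: k f => [|k IH] f Cf.
  by move=> z Uz; apply: cvgZr_tmp; apply: Cf.
have df z : U z -> differentiable f z by exact: Cf.1.
split=> [z Uz|v]; first by apply: differentiableZl; apply: df.
apply: Ck_on_eq (IH _ (Cf.2 v)) => // z Uz.
rewrite !deriveE; first by rewrite diffZl//; apply: df.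
  by apply: differentiableZl; apply: df.
exact: df.
Qed.

Lemma Ck_on_mx p q k U (f : V -> 'M[R]_(p, q)) : open U ->
  (forall i j, Ck_on k U (fun z => f z i j)) -> Ck_on k U f.
Proof.
move=> oU Cf.
have : Ck_on k U (fun z => \sum_i \sum_j f z i j *: delta_mx i j : 'M[R]_(p, q)).
  apply: Ck_on_sum => // i _; apply: Ck_on_sum => // j _.
  exact: Ck_on_scalel.
by apply: Ck_on_eq => // z _; rewrite -matrix_sum_delta.
Qed.

Lemma derive_entry p q (f : V -> 'M[R]_(p, q)) z v i j : derivable f z v ->
  'D_v (fun z => f z i j) z = ('D_v f z) i j.
Proof. by move=> df; rewrite derive_mx// mxE. Qed.

Lemma Ck_on_entry p q k U (f : V -> 'M[R]_(p, q)) i j : open U ->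
  Ck_on k U f -> Ck_on k U (fun z => f z i j).
Proof.
move=> oU; elim: k f => [|k IH] f Cf.
  move=> z Uz; apply: (@continuous_comp _ _ _ f (fun M : 'M[R]_(p, q) => M i j)).
    exact: Cf.
  exact: coord_continuous.
split=> [z Uz|v].
  apply: (differentiable_comp (g := fun M : 'M[R]_(p, q) => M i j)).
    exact: Cf.1.
  exact: differentiable_coord.
apply: Ck_on_eq (IH _ (Cf.2 v)) => // z Uz.
by rewrite derive_entry//; exact: Ck_on_derivable Cf _.
Qed.

Lemma Ck_on_mulmx p q r k U (f : V -> 'M[R]_(p, q)) (g : V -> 'M[R]_(q, r)) :
  open U -> Ck_on k U f -> Ck_on k U g -> Ck_on k U (fun z => f z *m g z).
Proof.
move=> oU Cf Cg; apply: Ck_on_mx => // i j.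
have : Ck_on k U (fun z => \sum_l f z i l * g z l j).
  by apply: Ck_on_sum => // l _; apply: Ck_onM => //; apply: Ck_on_entry.
by apply: Ck_on_eq => // z _; rewrite mxE.
Qed.

Lemma Ck_on_trmx p q k U (f : V -> 'M[R]_(p, q)) : open U ->
  Ck_on k U f -> Ck_on k U (fun z => (f z)^T).
Proof.
move=> oU Cf; apply: Ck_on_mx => // i j.
by apply: Ck_on_eq (Ck_on_entry j i oU Cf) => // z _; rewrite mxE.
Qed.

Lemma derivable_mulmx p q r (f : V -> 'M[R]_(p, q)) (g : V -> 'M[R]_(q, r)) z v :
  derivable f z v -> derivable g z v -> derivable (fun z => f z *m g z) z v.
Proof.
move=> /derivable_mxP df /derivable_mxP dg; apply/derivable_mxP => i j.
rewrite (_ : (fun x => _) = \sum_l (fun x => f x i l) * (fun x => g x l j)).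
  by apply: derivable_sum => l; apply: derivableM.
by apply/funext => x; rewrite mxE fct_sumE.
Qed.

Lemma derive_mulmx p q r (f : V -> 'M[R]_(p, q)) (g : V -> 'M[R]_(q, r)) z v :
  derivable f z v -> derivable g z v ->
  'D_v (fun z => f z *m g z) z = 'D_v f z *m g z + f z *m 'D_v g z.
Proof.
move=> df dg; rewrite derive_mx; last exact: derivable_mulmx.
have /derivable_mxP df' := df; have /derivable_mxP dg' := dg.
apply/matrixP => i j; rewrite !mxE.
rewrite (_ : (fun x => _) = \sum_l (fun x => f x i l) * (fun x => g x l j)).
  rewrite derive_sum; last by move=> l; apply: derivableM.
  rewrite -big_split /=; apply: eq_bigr => l _.
  by rewrite deriveM// !derive_entry// /GRing.scale /= addrC [_ * g z l j]mulrC.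
by apply/funext => x; rewrite mxE fct_sumE.
Qed.

Lemma derivable_trmx p q (f : V -> 'M[R]_(p, q)) z v :
  derivable f z v -> derivable (fun z => (f z)^T) z v.
Proof.
move=> /derivable_mxP df; apply/derivable_mxP => i j.
by rewrite (_ : (fun x => _) = (fun x => f x j i))//; apply/funext => x; rewrite mxE.
Qed.

Lemma derive_trmx p q (f : V -> 'M[R]_(p, q)) z v : derivable f z v ->
  'D_v (fun z => (f z)^T) z = ('D_v f z)^T.
Proof.
move=> df; rewrite derive_mx; last exact: derivable_trmx.
apply/matrixP => i j; rewrite [LHS]mxE [RHS]mxE.
apply: etrans (derive_entry j i df).
by congr ('D_v _ z); apply/funext => x; rewrite mxE.
Qed.

Lemma Schwarz_mx p q (f : V -> 'M[R]_(p, q)) U z u v : open U -> U z ->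
  Ck_on 2 U f -> 'D_u ('D_v f) z = 'D_v ('D_u f) z.
Proof.
move=> oU Uz Cf; apply/matrixP => i j.
have D w w' : 'D_w ('D_w' f) z i j = 'D_w ('D_w' (fun z => f z i j)) z.
  rewrite -derive_entry; last exact: (@Ck_on_derivable _ _ _ 0 U _ _ _ (Cf.2 w') Uz).
  apply: near_eq_derive; apply: filterS (open_nbhs_nbhs (conj oU Uz)) => y Uy.
  have dfy : derivable f y w' := @Ck_on_derivable _ _ _ 1 U f y w' Cf Uy.
  by rewrite derive_entry.
apply: etrans (D u v) (etrans _ (esym (D v u))).
exact: (Schwarz u v oU Uz (Ck_on_entry i j oU Cf)).
Qed.

End SmoothMatrices.

(** * Bordered diagonal matrices and Cauchy matrices *)

Section CauchyMatrices.
Context {F : fieldType}.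

Lemma size_prod_XsubC_in (I : finType) (A : {pred I}) (c : I -> F) :
  size (\prod_(i in A) ('X - (c i)%:P)) = #|A|.+1.
Proof. by rewrite -big_enum/= size_prod_XsubC -cardE. Qed.

(** Partial fractions for a quotient of two monic polynomials of equal degree, with simple poles at
    the c i. All Cauchy identities below are instances. *)
Lemma lagrange_ratio (I J : finType) (A : {pred I}) (B : {pred J})
    (c : I -> F) (b : J -> F) (y : F) :
  {in A &, injective c} -> #|A| = #|B| -> {in A, forall i, y != c i} ->
  \prod_(l in B) (y - b l) / \prod_(i in A) (y - c i) =
  1 + \sum_(i in A) \prod_(l in B) (c i - b l) /
        \prod_(k in A | k != i) (c i - c k) / (y - c i).
Proof.
move=> cI AB yc.
pose Q := \prod_(i in A) ('X - (c i)%:P).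
pose P := \prod_(l in B) ('X - (b l)%:P).
pose Qi i := \prod_(k in A | k != i) ('X - (c k)%:P).
have QiE i : i \in A -> Q = ('X - (c i)%:P) * Qi i by move=> iA; rewrite /Q (bigD1 i).
pose w i := \prod_(l in B) (c i - b l) / \prod_(k in A | k != i) (c i - c k).
have hP x : P.[x] = \prod_(l in B) (x - b l).
  by rewrite horner_prod; apply: eq_bigr => l _; rewrite hornerXsubC.
have hQ x : Q.[x] = \prod_(l in A) (x - c l).
  by rewrite horner_prod; apply: eq_bigr => l _; rewrite hornerXsubC.
have hQi i x : (Qi i).[x] = \prod_(k in A | k != i) (x - c k).
  by rewrite horner_prod; apply: eq_bigr => l _; rewrite hornerXsubC.
have Qi0 i : i \in A -> (Qi i).[c i] != 0.
  move=> iA; rewrite hQi; apply/prodf_neq0 => k /andP[kA ki].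
  by rewrite subr_eq0; apply: contra ki => /eqP /cI ->.
(* The difference of both sides has degree less than #|A|, since the leading terms of P and Q
   cancel, and it vanishes at the #|A| distinct points c i. *)
have PQ : P = Q + \sum_(i in A) w i *: Qi i.
  apply/eqP; rewrite -subr_eq0; apply/eqP.
  apply: (@roots_geq_poly_eq0 _ _ [seq c i | i <- enum A]).
  - apply/allP => x /mapP[i]; rewrite mem_enum => iA ->; rewrite rootE.
    rewrite hornerD hornerN hornerD horner_sum (bigD1 i iA)/= big1; last first.
      move=> k /andP[kA ki]; rewrite hornerZ hQi (bigD1 i)/=.
        by rewrite subrr mul0r mulr0.
      by rewrite iA eq_sym.
    rewrite hQ (bigD1 i iA)/= subrr mul0r add0r addr0 hornerZ /w -hQi.
    by rewrite divfK ?Qi0// hP subrr.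
  - rewrite map_inj_in_uniq ?enum_uniq// => i j; rewrite !mem_enum; exact: cI.
  - rewrite size_map -cardE opprD addrA (leq_trans (size_polyD _ _))// geq_max.
    apply/andP; split.
      apply/leq_sizeP => j; rewrite leq_eqVlt => /orP[/eqP <-|Aj].
        have mP : P \is monic by apply: monic_prod_XsubC.
        have mQ : Q \is monic by apply: monic_prod_XsubC.
        rewrite coefB; move/monicP: mP; move/monicP: mQ.
        by rewrite !lead_coefE !size_prod_XsubC_in -AB /= => -> ->; rewrite subrr.
      by rewrite coefB !nth_default ?subrr// size_prod_XsubC_in -?AB.
    rewrite size_polyN; apply: (leq_trans (size_sum _ _ _)).
    apply/bigmax_leqP => i iA; apply: leq_trans (size_scale_leq _ _) _.
    have Qi_neq0 : Qi i != 0.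
      by apply: contraNneq (Qi0 i iA) => ->; rewrite horner0.
    have := size_prod_XsubC_in A c; rewrite -/Q (QiE i)//.
    by rewrite size_mul ?polyXsubC_eq0// size_XsubC add2n /= => -[->].
have yA i : i \in A -> y - c i != 0 by move=> iA; rewrite subr_eq0 yc.
have Qy : Q.[y] != 0 by rewrite hQ; apply/prodf_neq0.
rewrite -hP -hQ PQ hornerD mulrDl divff//; congr (_ + _).
rewrite horner_sum mulr_suml; apply: eq_bigr => i iA.
have Qiy : (Qi i).[y] != 0.
  by move: Qy; rewrite (QiE i iA) hornerM mulf_eq0 => /norP[].
rewrite hornerZ (QiE i iA) hornerM hornerXsubC -/(w i) -mulrA; congr (_ * _).
by rewrite invfM mulrCA divff// mulr1.
Qed.

(** * Singular vectors of the bordered matrix *)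

Variables (r : nat) (lam mu bet gam : 'I_r.+1 -> F).
Let a j := lam j ^+ 2.
Let c i := mu i ^+ 2.
Let P0 := (\prod_(l | l != ord0) lam l) / (\prod_(i | i != ord0) mu i).

Hypothesis mu0 : mu ord0 = 0.
Hypothesis mu_neq0 : forall i, i != ord0 -> mu i != 0.
Hypothesis lam_neq0 : forall i, i != ord0 -> lam i != 0.
Hypothesis lamV : forall i j, i != ord0 -> lam j ^+ 2 != mu i ^+ 2.
Hypothesis mu_inj : forall i k, i != ord0 -> k != ord0 -> i != k ->
  mu i ^+ 2 != mu k ^+ 2.
Hypothesis lam_inj : forall i k, i != k -> lam i ^+ 2 != lam k ^+ 2.
Hypothesis betE : forall i, i != ord0 -> (mu i * bet i) ^+ 2 =
  - \prod_l (mu i ^+ 2 - lam l ^+ 2) /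
    \prod_(k | (k != ord0) && (k != i)) (mu i ^+ 2 - mu k ^+ 2).
Hypothesis gamE : forall j, gam j ^+ 2 =
  \prod_(i | i != ord0) (lam j ^+ 2 - mu i ^+ 2) /
  \prod_(l | l != j) (lam j ^+ 2 - lam l ^+ 2).
Hypothesis bet0 : bet ord0 = lam ord0 * P0.

(** With M = [bordered], the matrix M^T M is diagonal with entries mu_i^2 except for row and column
    0, which carry mu_i bet_i. Column j is its eigenvector for lam_j^2, normalised by gam_j. *)
Definition cauchyN : 'M[F]_r.+1 := \matrix_(i, j)
  if i == ord0 then gam j
  else mu i * bet i * gam j / (lam j ^+ 2 - mu i ^+ 2).

(** Here M M^T = diag(mu_i^2) + bet bet^T, with mu_0 = 0, and column j is its eigenvector for
    lam_j^2. The entry (0, 0) is bet_0 gam_0 / lam_0 with lam_0 cancelled, so that lam_0 = 0 is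
    allowed. *)
Definition cauchyC : 'M[F]_r.+1 := \matrix_(i, j)
  if i == ord0 then
    if j == ord0 then
      (\prod_(l | l != ord0) lam l) / (\prod_(i | i != ord0) mu i) * gam j
    else bet ord0 * gam j / lam j
  else bet i * lam j * gam j / (lam j ^+ 2 - mu i ^+ 2).

Definition bordered : 'M[F]_r.+1 :=
  \matrix_(i, j) if j == ord0 then bet i else mu i *+ (i == j).

Lemma cauchyN_orth : cauchyN^T *m cauchyN = 1%:M.
Proof.
(* Partial fractions with poles mu_i^2 and numerator roots lam_l^2, l != j, evaluated at lam_k^2:
   the right side vanishes for k != j and equals gam_j^-2 for k = j. *)
have W j k : (\sum_(i | i != ord0) (mu i * bet i) ^+ 2 /
     (lam j ^+ 2 - mu i ^+ 2) / (lam k ^+ 2 - mu i ^+ 2)) + 1 =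
   \prod_(l | l != j) (lam k ^+ 2 - lam l ^+ 2) /
   \prod_(i | i != ord0) (lam k ^+ 2 - mu i ^+ 2).
  have := @lagrange_ratio _ _ (predC1 (ord0 : 'I_r.+1)) (predC1 j)
    (fun i => mu i ^+ 2) (fun l => lam l ^+ 2) (lam k ^+ 2).
  move=> -> //.
  - rewrite addrC; congr (_ + _); apply: eq_bigr => i i0; congr (_ / _).
    rewrite betE// (bigD1 j)//= -mulNr opprB.
    have h0 : lam j ^+ 2 - mu i ^+ 2 != 0 by rewrite subr_eq0 lamV.
    rewrite -mulrA -mulrA mulrC -mulrA -mulrA; congr (_ * _).
    by rewrite mulVf// mulr1.
  - move=> i k' /= i0 k0 E; apply/eqP/negPn/negP => ik.
    by have := mu_inj i0 k0 ik; rewrite E eqxx.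
  - by rewrite !cardC1.
  - by move=> i i0; rewrite lamV.
apply/matrixP => j k; rewrite !mxE (bigD1 ord0)//= !mxE eqxx.
rewrite (eq_bigr (fun i => gam j * gam k * ((mu i * bet i) ^+ 2 /
    (lam j ^+ 2 - mu i ^+ 2) / (lam k ^+ 2 - mu i ^+ 2)))); last first.
  by move=> i i0; rewrite !mxE (negPf i0); ring.
rewrite -mulr_sumr -{1}[gam j * gam k]mulr1 -mulrDr [1 + _]addrC W.
have [<-|jk] := eqVneq j k; last first.
  by rewrite (bigD1 k) 1?eq_sym//= subrr !mul0r mulr0.
rewrite -expr2 gamE mulrA divfK ?divff//.
  apply/prodf_neq0 => i i0; by rewrite subr_eq0 lamV.
by apply/prodf_neq0 => i i0; rewrite subr_eq0 lam_inj// eq_sym.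
Qed.

Let D := diag_mx (\row_j lam j).

(** Half of the singular value decomposition M = C D N^T; the next lemma is the transposed half. *)
Lemma bordered_cauchyN : bordered *m cauchyN = cauchyC *m D.
Proof.
apply/matrixP => i j; rewrite mul_mx_diag !mxE (bigD1 ord0)//= !mxE eqxx.
have [->|i0] := eqVneq i ord0.
  rewrite big1 => [|k k0]; last by rewrite !mxE (negPf k0) mu0 mul0rn mul0r.
  have [->|j0] := eqVneq j ord0; first by rewrite bet0 /P0; ring.
  by rewrite divfK ?lam_neq0// addr0.
rewrite (bigD1 i)//= big1 => [|k /andP[k0 ki]]; last first.
  by rewrite !mxE (negPf k0) [i == k]eq_sym (negPf ki) mul0r.
rewrite !mxE (negPf i0) eqxx /= addr0.
have h : lam j ^+ 2 - mu i ^+ 2 != 0 by rewrite subr_eq0 lamV.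
by field.
Qed.

(** Rows i != 0 hold entry by entry. Row 0 is the secular equation of the rank one perturbation
    diag(mu_i^2) + bet bet^T, which partial fractions provide. *)
Lemma bordered_cauchyC : bordered^T *m cauchyC = cauchyN *m D.
Proof.
apply/matrixP => i j; rewrite mul_mx_diag !mxE.
have [->|i0] := eqVneq i ord0; last first.
  rewrite (bigD1 i)//= big1 => [|k ki]; last first.
    by rewrite !mxE (negPf i0) (negPf ki) mul0r.
  by rewrite !mxE (negPf i0) eqxx /= addr0; ring.
rewrite (eq_bigr (fun k => bet k * cauchyC k j)); last by move=> k _; rewrite !mxE eqxx.
have [lj0|lj0] := eqVneq (lam j) 0.
  have j0 : j = ord0 by apply/eqP/negPn/negP => /lam_neq0; rewrite lj0 eqxx.
  rewrite lj0 mulr0 big1// => k _; rewrite mxE.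
  have [->|k0] := eqVneq k ord0; first by rewrite bet0 -j0 lj0 !mul0r.
  by rewrite lj0 mulr0 !mul0r mulr0.
rewrite (bigD1 ord0)//= !mxE eqxx.
have -> : (if j == ord0 then
      (\prod_(l | l != ord0) lam l) / (\prod_(i | i != ord0) mu i) * gam j
    else bet ord0 * gam j / lam j) = bet ord0 * gam j / lam j.
  have [j0|//] := eqVneq j ord0.
  by rewrite -/P0 bet0 j0 -(mulrA (lam _)) [RHS]mulrC mulKf -?j0.
have dE : bet ord0 ^+ 2 = \prod_l lam l ^+ 2 / \prod_(i | i != ord0) mu i ^+ 2.
  by rewrite !prodrXl [in RHS](bigD1 ord0)//= bet0 /P0 !exprMn exprVn mulrA.
have := @lagrange_ratio _ _ predT predT
    (fun i : 'I_r.+1 => mu i ^+ 2) (fun l : 'I_r.+1 => lam l ^+ 2) (lam j ^+ 2).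
clear i.
have mui i k : i != k -> mu i ^+ 2 != mu k ^+ 2.
  have [->|i0] := eqVneq i ord0.
    by rewrite eq_sym mu0 expr0n/= => k0; rewrite eq_sym sqrf_eq0 mu_neq0.
  have [->|k0] := eqVneq k ord0; last exact: mu_inj.
  by rewrite mu0 expr0n/= sqrf_eq0 mu_neq0.
have lamV' i : lam j ^+ 2 != mu i ^+ 2.
  have [->|i0] := eqVneq i ord0; last exact: lamV.
  by rewrite mu0 expr0n/= sqrf_eq0.
move=> L; have {L} := L _ erefl (fun i _ => lamV' i).
have inj2 : {in predT &, injective (fun i : 'I_r.+1 => mu i ^+ 2)}.
  by move=> i k _ _ E; apply/eqP/negPn/negP => /mui; rewrite E eqxx.
move=> /(_ inj2); rewrite [in LHS](bigD1 j)//= subrr !mul0r (bigD1 ord0)//= => E.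
(* The secular equation: the numerator vanishes at lam_j^2, and the residues at mu_0^2 = 0 and at
   mu_i^2 are -bet_0^2 and -bet_i^2. *)
have {E} E : 1 = bet ord0 ^+ 2 / lam j ^+ 2 +
    \sum_(i | i != ord0) bet i ^+ 2 / (lam j ^+ 2 - mu i ^+ 2).
  apply/eqP; rewrite -subr_eq0; apply/eqP; rewrite [RHS]E opprD; congr (_ + _).
  rewrite -sumrN; congr (_ + _).
    rewrite mu0 expr0n /= subr0 -mulNr dE; congr (_ / _).
    have mN (P : pred 'I_r.+1) (f : 'I_r.+1 -> F) :
        \prod_(i | P i) (0 - f i ^+ 2) = (-1) ^+ #|P| * \prod_(i | P i) f i ^+ 2.
      rewrite (eq_bigr (fun i => -1 * f i ^+ 2)) => [|i _]; last by rewrite sub0r mulN1r.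
      by rewrite big_split /= prodr_const.
    rewrite !mN cardC1 !card_ord /= exprS mulN1r mulNr mulNr; congr (- _).
    have s0 : (-1) ^+ r != 0 :> F by rewrite expf_neq0// oppr_eq0 oner_eq0.
    by rewrite -mulf_div divff// mul1r.
  apply: eq_bigr => i i0; rewrite -mulNr; congr (_ / _).
  rewrite [in X in _ / X](bigD1 ord0) 1?eq_sym//=.
  have mi : mu i ^+ 2 != 0 by rewrite sqrf_eq0 mu_neq0.
  have := betE i0; rewrite exprMn mu0 expr0n/= subr0 mulNr => Eb.
  apply: (mulfI mi); rewrite mulrN Eb opprK invfM mulrCA mulVKf//.
  by congr (_ / _); apply: eq_bigl => k; rewrite andbC.
rewrite -{2}[lam j]mul1r E mulrDl mulrDr; congr (_ + _); first by field.
rewrite mulr_suml mulr_sumr; apply: eq_bigr => k k0; rewrite !mxE (negPf k0).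
by ring.
Qed.

(** The two halves of the decomposition give D C^T C D = D D, which settles all entries with lam_j
    lam_k != 0. Only lam_0 can vanish, and then column 0 of C is supported in row 0 and is computed
    directly. *)
Lemma cauchyC_orth : cauchyC^T *m cauchyC = 1%:M.
Proof.
have DCD : D *m (cauchyC^T *m cauchyC) *m D = D *m D.
  have -> : D *m (cauchyC^T *m cauchyC) *m D = (cauchyC *m D)^T *m (cauchyC *m D).
    by rewrite trmx_mul tr_diag_mx !mulmxA.
  rewrite -{1}bordered_cauchyN trmx_mul -mulmxA (mulmxA bordered^T).
  by rewrite bordered_cauchyC !mulmxA cauchyN_orth mul1mx.
have E j k : lam j * (cauchyC^T *m cauchyC) j k * lam k = (lam j * lam k) *+ (j == k).
  have := congr1 (fun M : 'M[F]_r.+1 => M j k) DCD.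
  rewrite mul_mx_diag mxE mul_diag_mx mxE !mxE => ->.
  rewrite (bigD1 j)//= !mxE eqxx big1 => [|i ij]; last by rewrite !mxE eq_sym (negPf ij) mul0r.
  by rewrite addr0 /= mulr1n mulrnAr; case: eqP => [->|].
apply/matrixP => j k; rewrite [RHS]mxE.
have [lj|lj] := eqVneq (lam j) 0; last first.
  have [lk|lk] := eqVneq (lam k) 0; last first.
    apply: (mulfI lj); apply: (mulIf lk); rewrite E.
    by case: eqP; rewrite ?mulr1// mulr0 mul0r.
  have k0 : k = ord0 by apply/eqP/negPn/negP => /lam_neq0; rewrite lk eqxx.
  have jk : j == k = false by apply/negP => /eqP jk; rewrite jk lk eqxx in lj.
  rewrite jk mxE big1// => i _; rewrite !mxE.
  have [_|_] := eqVneq i ord0; last by rewrite lk mulr0 !mul0r mulr0.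
  by rewrite {1}k0 in jk; rewrite jk bet0 -k0 lk !mul0r.
have j0 : j = ord0 by apply/eqP/negPn/negP => /lam_neq0; rewrite lj eqxx.
rewrite mxE; have [<-|jk] := eqVneq j k; last first.
  rewrite big1// => i _; rewrite !mxE.
  have [_|_] := eqVneq i ord0; last by rewrite lj mulr0 !mul0r.
  have -> : (k == ord0) = false by rewrite -j0 eq_sym (negPf jk).
  have -> : bet ord0 = 0 by rewrite bet0 -j0 lj mul0r.
  by rewrite !mul0r mulr0.
rewrite (bigD1 ord0)//= big1 => [|i i0]; last first.
  by rewrite !mxE (negPf i0) lj mulr0 !mul0r.
have l0 : lam ord0 = 0 by rewrite -j0.
rewrite [cauchyC^T _ _]mxE addr0 mxE j0 eqxx -/P0 -expr2 exprMn gamE l0 expr0n /=.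
have mN (f : 'I_r.+1 -> F) : \prod_(i | i != ord0) (0 - f i ^+ 2) =
    (-1) ^+ r * (\prod_(i | i != ord0) f i) ^+ 2.
  rewrite -prodrXl (eq_bigr (fun i => -1 * f i ^+ 2)) => [|i _]; last by rewrite sub0r mulN1r.
  by rewrite big_split /= prodr_const cardC1 card_ord.
have pn0 (f : 'I_r.+1 -> F) : (forall i, i != ord0 -> f i != 0) ->
    \prod_(i | i != ord0) f i != 0 by move=> f0; apply/prodf_neq0.
have := pn0 _ mu_neq0; have := pn0 _ lam_neq0.
have : (-1) ^+ r != 0 :> F by rewrite expf_neq0// oppr_eq0 oner_eq0.
rewrite !mN /P0; move: ((-1) ^+ r) (\prod_(i | _) _) (\prod_(i | _) _) => s x y s0 x0 y0.
by field; rewrite s0 x0 y0.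
Qed.

End CauchyMatrices.

(** * Rotating a pair of orthonormal frames *)

Definition dg {R : pzSemiRingType} {n} (x : 'I_n -> R) : 'M[R]_n := diag_mx (\row_i x i).

Lemma dgE {R : pzSemiRingType} n (x : 'I_n -> R) i j : dg x i j = x i *+ (i == j).
Proof. by rewrite !mxE. Qed.

Lemma dgM {R : pzSemiRingType} n (a b : 'I_n -> R) :
  dg a *m dg b = dg (fun i => a i * b i).
Proof. by rewrite /dg mulmx_diag; congr diag_mx; apply/rowP => i; rewrite !mxE. Qed.

Lemma dgD {R : pzSemiRingType} n (a b : 'I_n -> R) :
  dg a + dg b = dg (fun i => a i + b i).
Proof. by apply/matrixP => i j; rewrite mxE !dgE mulrnDl. Qed.

Lemma dgN {R : pzRingType} n (a : 'I_n -> R) : - dg a = dg (fun i => - a i).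
Proof. by apply/matrixP => i j; rewrite mxE !dgE mulNrn. Qed.

Lemma eq_dg {R : pzSemiRingType} n (a b : 'I_n -> R) : a =1 b -> dg a = dg b.
Proof. by move=> ab; apply/matrixP => i j; rewrite !dgE ab. Qed.

Lemma mx_addE {R : nmodType} p q (A B : 'M[R]_(p, q)) i j : (A + B) i j = A i j + B i j.
Proof. by rewrite mxE. Qed.

Lemma mx_subE {R : zmodType} p q (A B : 'M[R]_(p, q)) i j : (A - B) i j = A i j - B i j.
Proof. by rewrite !mxE. Qed.

Section Frames.
Context {R : realFieldType} {m n : nat}.
Variables (U V : 'M[R]_(m, n)) (I : 'I_n -> R).
Implicit Types (x y a e t : 'I_n -> R) (A B C N : 'M[R]_n).

(* The columns of U and V span planes, and x i + 'i * y i rotates and scales the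
   i-th one.  One column of U may vanish; I is the indicator of the others. *)
Definition rotU x y : 'M[R]_(m, n) := \matrix_(b, i) (U b i * x i + V b i * y i).
Definition rotV x y : 'M[R]_(m, n) := \matrix_(b, i) (V b i * x i - U b i * y i).

Definition torus a := V *m dg a *m U^T - U *m dg a *m V^T.

(** The frames enter scaled by |w_i|, not normalised, so the expression is polynomial in x and y.
    The diagonal part that must not be scaled down at w_i = 0 is split off as [e], shared by both
    halves. The last summand is the projection onto the complement of the frames. *)
Definition stepmx C N e x y : 'M[R]_m :=
  rotU x y *m C *m (rotU x y)^T + rotV x y *m N *m (rotV x y)^T +
  (U *m dg e *m U^T + V *m dg e *m V^T) + (1%:M - U *m U^T - V *m V^T).

Lemma sandwichE p q (A : 'M[R]_(p, n)) (B : 'M[R]_(q, n)) e (a : 'I_p) (b : 'I_q) :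
  (A *m dg e *m B^T) a b = \sum_i A a i * e i * B b i.
Proof. by rewrite mxE; apply: eq_bigr => i _; rewrite mul_mx_diag !mxE. Qed.

Lemma mulmx_dgE p (A : 'M[R]_(p, n)) e : A *m dg e = \matrix_(a, i) (A a i * e i).
Proof. by apply/matrixP => a i; rewrite mul_mx_diag !mxE. Qed.

Lemma rotU_scale x y e : rotU x y *m dg e = rotU (fun i => e i * x i) (fun i => e i * y i).
Proof. by apply/matrixP => a i; rewrite mulmx_dgE !mxE; ring. Qed.

Lemma rotV_scale x y e : rotV x y *m dg e = rotV (fun i => e i * x i) (fun i => e i * y i).
Proof. by apply/matrixP => a i; rewrite mulmx_dgE !mxE; ring. Qed.

Lemma rotUD x y x' y' :
  rotU x y + rotU x' y' = rotU (fun i => x i + x' i) (fun i => y i + y' i).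
Proof. by apply/matrixP => a i; rewrite !mxE; ring. Qed.

Lemma rotVD x y x' y' :
  rotV x y + rotV x' y' = rotV (fun i => x i + x' i) (fun i => y i + y' i).
Proof. by apply/matrixP => a i; rewrite !mxE; ring. Qed.

Lemma tr_dg e : (dg e)^T = dg e.
Proof. exact: tr_diag_mx. Qed.

Lemma tr_torus a : (torus a)^T = - torus a.
Proof.
by rewrite /torus linearB /= !trmx_mul !tr_dg !trmxK !mulmxA opprB.
Qed.

Section UnitRotation.
Variables x y : 'I_n -> R.
Hypothesis xy1 : forall i, x i ^+ 2 + y i ^+ 2 = 1.

(** A scalar on each plane commutes with rotations of that plane. This is what lets the term [e] of
    [stepmx] be written in the fixed frames. *)
Lemma rot_even e : rotU x y *m dg e *m (rotU x y)^T +
    rotV x y *m dg e *m (rotV x y)^T = U *m dg e *m U^T + V *m dg e *m V^T.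
Proof.
apply/matrixP => a b; rewrite !mx_addE !sandwichE -!big_split /=.
apply: eq_bigr => i _; rewrite !mxE.
rewrite -[RHS]mul1r -(xy1 i); ring.
Qed.

Lemma rot_torus e : rotV x y *m dg e *m (rotU x y)^T -
    rotU x y *m dg e *m (rotV x y)^T = torus e.
Proof.
apply/matrixP => a b; rewrite /torus !mx_subE !sandwichE -!sumrB; apply: eq_bigr => i _; rewrite !mxE.
rewrite -[RHS]mul1r -(xy1 i); ring.
Qed.

Lemma rot_complement : rotU x y *m (rotU x y)^T + rotV x y *m (rotV x y)^T =
  U *m U^T + V *m V^T.
Proof.
have d1 : dg (fun=> 1) = 1%:M :> 'M[R]_n.
  by apply/matrixP => i j; rewrite dgE mxE.
by have := rot_even (fun=> 1); rewrite d1 !mulmx1.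
Qed.

End UnitRotation.

Hypothesis UU : U^T *m U = dg I.
Hypothesis VV : V^T *m V = 1%:M.
Hypothesis UV : U^T *m V = 0.
Hypothesis UI : U *m dg I = U.

Lemma VU : V^T *m U = 0.
Proof. by rewrite -[V^T *m U]trmxK trmx_mul trmxK UV trmx0. Qed.

Lemma dg1 : dg (fun=> 1) = 1%:M :> 'M[R]_n.
Proof. by apply/matrixP => i j; rewrite dgE mxE. Qed.

Variable rest : 'M[R]_m.
Hypothesis restE : rest = 1%:M - U *m U^T - V *m V^T.

Lemma restU : rest *m U = 0.
Proof.
rewrite restE !mulmxBl mul1mx -!mulmxA UU VU mulmx0 subr0.
by rewrite UI subrr.
Qed.

Lemma restV : rest *m V = 0.
Proof. by rewrite restE !mulmxBl mul1mx -!mulmxA UV VV mulmx0 mulmx1 subr0 subrr. Qed.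

Lemma rotUE x y : rotU x y = U *m dg x + V *m dg y.
Proof. by apply/matrixP => a i; rewrite mx_addE !mulmx_dgE !mxE. Qed.

Lemma rotVE x y : rotV x y = V *m dg x - U *m dg y.
Proof. by apply/matrixP => a i; rewrite mx_subE !mulmx_dgE !mxE. Qed.

Lemma rest_rotU x y : rest *m rotU x y = 0.
Proof. by rewrite rotUE mulmxDr !mulmxA restU restV !mul0mx addr0. Qed.

Lemma rest_rotV x y : rest *m rotV x y = 0.
Proof. by rewrite rotVE mulmxBr !mulmxA restU restV !mul0mx subr0. Qed.

Lemma tr_rest : rest^T = rest.
Proof. by rewrite restE !linearB /= trmx1 !trmx_mul !trmxK. Qed.

Lemma rest_idem : rest *m rest = rest.
Proof.
by rewrite {2}restE !mulmxBr mulmx1 !mulmxA restU restV !mul0mx !subr0.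
Qed.

Lemma torus_rotU t x y : (forall i, t i * I i = t i) ->
  torus t *m rotU x y = rotU (fun i => - (t i * y i)) (fun i => t i * x i).
Proof.
move=> tI; rewrite /torus rotUE mulmxBl !mulmxDr -!mulmxA.
rewrite !(mulmxA U^T) !(mulmxA V^T) UU UV VU VV !mul0mx !mulmx0 addr0 add0r mul1mx.
rewrite rotUE !dgM addrC -mulmxN dgN; congr (_ + _ *m _).
by apply: eq_dg => i; rewrite mulrA tI.
Qed.

Lemma torus_rotV t x y : (forall i, t i * I i = t i) ->
  torus t *m rotV x y = rotV (fun i => - (t i * y i)) (fun i => t i * x i).
Proof.
move=> tI; rewrite /torus rotVE mulmxBl !mulmxBr -!mulmxA.
rewrite !(mulmxA U^T) !(mulmxA V^T) UU UV VU VV !mul0mx !mulmx0 subr0 sub0r mul1mx.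
rewrite rotVE !dgM -(mulmxN V) dgN; congr (_ - _); congr (_ *m _).
by apply: eq_dg => i; rewrite mulrA tI.
Qed.

Section Generic.
Variables (x y rho : 'I_n -> R).
Hypothesis xy1 : forall i, x i ^+ 2 + y i ^+ 2 = 1.
Hypothesis yI : forall i, y i * I i = y i.
Let u := rotU x y.
Let v := rotV x y.

Let trU : u^T = dg x *m U^T + dg y *m V^T.
Proof. by rewrite /u rotUE raddfD /= !trmx_mul !tr_dg. Qed.

Let trV : v^T = dg x *m V^T - dg y *m U^T.
Proof. by rewrite /v rotVE raddfB /= !trmx_mul !tr_dg. Qed.

Lemma rotUU : u^T *m u = dg I.
Proof.
rewrite trU /u rotUE mulmxDl !mulmxDr -!mulmxA.
rewrite !(mulmxA U^T) !(mulmxA V^T) UU UV VU VV !mul0mx !mulmx0 addr0 add0r mul1mx.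
rewrite !dgM dgD; apply: eq_dg => i.
by rewrite -[RHS]mul1r -(xy1 i) -{1}(yI i); ring.
Qed.

Lemma rotVV : v^T *m v = 1%:M.
Proof.
rewrite trV /v rotVE mulmxBl !mulmxBr -!mulmxA.
rewrite !(mulmxA U^T) !(mulmxA V^T) UU UV VU VV !mul0mx !mulmx0 subr0 sub0r mul1mx.
rewrite opprK !dgM dgD -dg1; apply: eq_dg => i.
by rewrite [I i * _]mulrC yI -!expr2 xy1.
Qed.

Lemma rotUV : u^T *m v = 0.
Proof.
rewrite trU /v rotVE mulmxDl !mulmxBr -!mulmxA.
rewrite !(mulmxA U^T) !(mulmxA V^T) UU UV VU VV !mul0mx !mulmx0 subr0 sub0r mul1mx.
rewrite !dgM dgN dgD; apply/matrixP => i j; rewrite dgE mxE.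
by rewrite [I i * _]mulrC yI mulrC addNr mul0rn.
Qed.

Lemma rotUI : u *m dg I = u.
Proof.
rewrite /u rotUE mulmxDl -!mulmxA !dgM; congr (_ + _); last first.
  by congr (_ *m _); exact: eq_dg.
rewrite (eq_dg (b := fun i => I i * x i)) => [|i]; last by rewrite mulrC.
by rewrite -dgM mulmxA UI.
Qed.

Variables (C N : 'M[R]_n) (e : 'I_n -> R).
Let xr i := rho i * x i.
Let yr i := rho i * y i.
Variables Ch Nh : 'M[R]_n.
Hypothesis ChE : Ch = dg rho *m C *m dg rho + dg e.
Hypothesis NhE : Nh = dg rho *m N *m dg rho + dg e.
Let h := stepmx C N e xr yr.

(** Away from w = 0 the scaling rho moves from the frames to the coefficients, and [e] joins both
    diagonals. In the normalised rotated frames h is block diagonal with blocks Ch and Nh, and the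
    identity elsewhere. *)
Lemma stepmx_generic : h = u *m Ch *m u^T + v *m Nh *m v^T + rest.
Proof.
rewrite /h /stepmx -restE -(rotU_scale x y rho) -(rotV_scale x y rho).
rewrite -(rot_even xy1) -/u -/v !trmx_mul !tr_dg ChE NhE.
rewrite !mulmxDr !mulmxDl !mulmxA; congr (_ + _).
by rewrite -!addrA; congr (_ + _); rewrite addrCA.
Qed.

Let vu : v^T *m u = 0.
Proof. by rewrite -[v^T *m u]trmxK trmx_mul trmxK rotUV trmx0. Qed.
Let urest : u^T *m rest = 0.
Proof. by rewrite -tr_rest -trmx_mul rest_rotU trmx0. Qed.
Let vrest : v^T *m rest = 0.
Proof. by rewrite -tr_rest -trmx_mul rest_rotV trmx0. Qed.
Let uuvv : u *m u^T + v *m v^T + rest = 1%:M.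
Proof. by rewrite rot_complement// restE addrC -[1%:M - _ - _]addrA -opprD subrK. Qed.

Hypothesis CI : Ch *m dg I = dg I *m Ch.

Let uI : u *m dg I = u := rotUI.
Let Iu : dg I *m u^T = u^T.
Proof. by rewrite -[dg I]tr_dg -trmx_mul uI. Qed.

Let hu : h *m u = u *m Ch.
Proof.
rewrite stepmx_generic !mulmxDl -!mulmxA rotUU vu rest_rotU !mulmx0 !addr0.
by rewrite CI mulmxA uI.
Qed.

Let hv : h *m v = v *m Nh.
Proof.
rewrite stepmx_generic !mulmxDl -!mulmxA rotUV rotVV rest_rotV !mulmx0 add0r addr0.
by rewrite mulmx1.
Qed.

Let uh : u^T *m h = Ch *m u^T.
Proof.
rewrite stepmx_generic !mulmxDr !mulmxA rotUU rotUV urest !mul0mx !addr0.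
by rewrite -CI -mulmxA Iu.
Qed.

Let vh : v^T *m h = Nh *m v^T.
Proof.
by rewrite stepmx_generic !mulmxDr !mulmxA rotVV vu vrest !mul0mx add0r addr0 mul1mx.
Qed.

Lemma stepmx_orth : Ch^T *m Ch = 1%:M -> Nh^T *m Nh = 1%:M -> h^T *m h = 1%:M.
Proof.
move=> CC NN.
have hT : h^T = u *m Ch^T *m u^T + v *m Nh^T *m v^T + rest.
  by rewrite stepmx_generic !raddfD /= tr_rest !trmx_mul !trmxK !mulmxA.
have resth : rest *m h = rest.
  by rewrite stepmx_generic !mulmxDr !mulmxA rest_rotU rest_rotV !mul0mx !add0r rest_idem.
rewrite hT !mulmxDl -!mulmxA uh vh resth.
by rewrite !(mulmxA _^T) CC NN !mul1mx uuvv.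
Qed.

(** h preserves the spans of u and v, while both skew matrices exchange them. The relation therefore
    splits into the two halves of M = Ch diag(lam) Nh^T. *)
Lemma stepmx_intertwine (lam : 'I_n -> R) (M : 'M[R]_n) :
  M *m Nh = Ch *m dg lam -> M^T *m Ch = Nh *m dg lam ->
  h *m torus lam = (v *m M^T *m u^T - u *m M *m v^T) *m h.
Proof.
move=> MN MC; rewrite -(rot_torus xy1) -/u -/v mulmxBr !mulmxA hu hv.
by rewrite mulmxBl -!mulmxA uh vh !(mulmxA M) !(mulmxA M^T) MN MC !mulmxA.
Qed.

Variable sg : 'M[R]_m.
Hypothesis sgE : sg = u *m u^T - v *m v^T + rest.

Let sgu : sg *m u = u.
Proof. by rewrite sgE mulmxDl mulmxBl -!mulmxA rotUU vu rest_rotU mulmx0 addr0 subr0. Qed.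

Let sgv : sg *m v = - v.
Proof.
by rewrite sgE mulmxDl mulmxBl -!mulmxA rotUV rotVV rest_rotV mulmx0 addr0 sub0r mulmx1.
Qed.

Let sgrest : sg *m rest = rest.
Proof.
by rewrite sgE mulmxDl mulmxBl -!mulmxA urest vrest !mulmx0 subr0 add0r rest_idem.
Qed.

Let trsg : sg^T = sg.
Proof. by rewrite sgE raddfD raddfB /= tr_rest !trmx_mul !trmxK. Qed.

Let usg : u^T *m sg = u^T.
Proof. by rewrite -trsg -trmx_mul sgu. Qed.
Let vsg : v^T *m sg = - v^T.
Proof. by rewrite -trsg -trmx_mul sgv raddfN. Qed.
Let restsg : rest *m sg = rest.
Proof. by rewrite -trsg -[in LHS]tr_rest -trmx_mul sgrest tr_rest. Qed.

Let sgsg : sg *m sg = 1%:M.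
Proof.
rewrite {2}sgE mulmxDr mulmxBr !mulmxA sgu sgv sgrest.
by rewrite mulNmx opprK uuvv.
Qed.

Let sg_even A B D : D *m sg = D -> sg *m D = D ->
  sg *m (u *m A *m u^T + v *m B *m v^T + D) *m sg =
  u *m A *m u^T + v *m B *m v^T + D.
Proof.
move=> Dsg sgD; rewrite !mulmxDr !mulmxDl !mulmxA sgu sgv sgD Dsg.
by rewrite -!mulmxA usg vsg !(mulmxN, mulNmx) opprK.
Qed.

(* The reflection sg fixes the columns of u and negates those of v; it commutes
   with h and anticommutes with the torus. *)
Lemma trace_even_part (lam : 'I_n -> R) (A B : 'M[R]_n) :
  \tr (torus lam *m h^T *m (u *m A *m u^T + v *m B *m v^T)) = 0.
Proof.
set G := (X in _ *m X).
have sgG : sg *m G *m sg = G by have := @sg_even A B 0; rewrite mul0mx mulmx0 addr0; apply.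
have sgh : sg *m h^T *m sg = h^T.
  rewrite -[in RHS](_ : sg *m h *m sg = h); first by rewrite !trmx_mul trsg mulmxA.
  by rewrite stepmx_generic; exact: sg_even restsg sgrest.
have sgT : sg *m torus lam *m sg = - torus lam.
  rewrite -(rot_torus xy1) -/u -/v !mulmxBr !mulmxBl !mulmxA sgu sgv.
  by rewrite -!mulmxA usg vsg !(mulmxN, mulNmx) !mulmxA opprB opprK addrC.
have : \tr (sg *m torus lam *m sg *m (sg *m h^T *m sg) *m (sg *m G *m sg)) =
    \tr (torus lam *m h^T *m G).
  rewrite -!mulmxA !(mulmxA sg sg) sgsg !mul1mx mxtrace_mulC -!mulmxA sgsg.
  by rewrite mulmx1 !mulmxA.
rewrite sgT sgh sgG !mulNmx raddfN /= => /eqP.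
by rewrite eq_sym -addr_eq0 -mulr2n mulrn_eq0 /= => /eqP.
Qed.

End Generic.

Section Variation.
Variables (x y rho : 'I_n -> R).
Hypothesis xy1 : forall i, x i ^+ 2 + y i ^+ 2 = 1.
Hypothesis yI : forall i, y i * I i = y i.
Variables (C N dC dN : 'M[R]_n) (e de rd t : 'I_n -> R).
Hypothesis tI : forall i, t i * I i = t i.
Let xr i := rho i * x i.
Let yr i := rho i * y i.
Let dx i := rd i * xr i - t i * yr i.
Let dy i := rd i * yr i + t i * xr i.
Let h := stepmx C N e xr yr.
Let u := rotU xr yr.
Let v := rotV xr yr.
Let du := rotU dx dy.
Let dv := rotV dx dy.

(** The product rule applied to [stepmx], the velocity of w_i being split into a radial rate rd i
    and an angular velocity t i: dw_i = (rd_i + 'i t_i) w_i. *)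
Definition step_variation : 'M[R]_m :=
  du *m C *m u^T + u *m dC *m u^T + u *m C *m du^T +
  (dv *m N *m v^T + v *m dN *m v^T + v *m N *m dv^T) +
  (U *m dg de *m U^T + V *m dg de *m V^T).

(** The variation of h is an even part plus the commutator of h with the infinitesimal rotation xi =
    [torus t]. The even part has trace 0 by reflection. The commutator contributes tr (h T h^T xi) -
    tr (T xi), and h T h^T = S. *)
Lemma trace_step_variation (lam : 'I_n -> R) (S : 'M[R]_m) :
  h^T *m h = 1%:M -> h *m torus lam = S *m h ->
  \tr (torus lam *m h^T *m step_variation) =
  \tr (S *m torus t) - \tr (torus lam *m torus t).
Proof.
move=> hh hS; have hh' : h *m h^T = 1%:M by apply: mulmx1C.
pose xi := torus t.
pose K := dg rd *m C + dC + C *m dg rd; pose L := dg rd *m N + dN + N *m dg rd.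
have duE : du = u *m dg rd + xi *m u.
  rewrite /xi torus_rotU// rotU_scale rotUD; apply/matrixP => b i; rewrite !mxE /dx /dy; ring.
have dvE : dv = v *m dg rd + xi *m v.
  rewrite /xi torus_rotV// rotV_scale rotVD; apply/matrixP => b i; rewrite !mxE /dx /dy; ring.
have xiU : xi *m U = V *m dg t.
  rewrite /xi /torus mulmxBl -!mulmxA UU VU !mulmx0 subr0 dgM.
  by congr (_ *m _); apply: eq_dg.
have xiV : xi *m V = - (U *m dg t).
  by rewrite /xi /torus mulmxBl -!mulmxA UV VV !mulmx0 mulmx1 sub0r.
have trxi : xi^T = - xi by exact: tr_torus.
have Uxi : U^T *m xi = - (dg t *m V^T).
  by apply: trmx_inj; rewrite trmx_mul trxi mulNmx trmxK xiU linearN /= trmx_mul trmxK tr_dg.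
have Vxi : V^T *m xi = dg t *m U^T.
  by apply: trmx_inj; rewrite trmx_mul trxi mulNmx trmxK xiV opprK trmx_mul trmxK tr_dg.
have uxi : u^T *m xi = - (xi *m u)^T.
  by rewrite trmx_mul trxi mulmxN opprK.
have vxi : v^T *m xi = - (xi *m v)^T.
  by rewrite trmx_mul trxi mulmxN opprK.
set G := u *m K *m u^T + v *m L *m v^T + (U *m dg de *m U^T + V *m dg de *m V^T).
have restxi : (1%:M - U *m U^T - V *m V^T) *m xi = 0.
  by rewrite -restE /xi /torus mulmxBr !mulmxA restU restV !mul0mx subr0.
have xirest : xi *m (1%:M - U *m U^T - V *m V^T) = 0.
  apply: trmx_inj; rewrite trmx_mul trxi -restE tr_rest mulmxN restE restxi.
  by rewrite oppr0 trmx0.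
have ecomm : (U *m dg e *m U^T + V *m dg e *m V^T) *m xi =
    xi *m (U *m dg e *m U^T + V *m dg e *m V^T).
  rewrite mulmxDl mulmxDr -!mulmxA Uxi Vxi !mulmxA xiU xiV.
  rewrite !(mulmxN, mulNmx) !mulmxA -!(mulmxA _ (dg _) (dg _)) !dgM addrC.
  by have -> : dg (fun i => e i * t i) = dg (fun i => t i * e i) by apply: eq_dg => i; rewrite mulrC.
(* Inserting dw = w rd + z w separates the radial terms, again of the form w A w^T, from a
   commutator with z. *)
have part (z : 'M[R]_m) (w dw : 'M[R]_(m, n)) (A dA : 'M[R]_n) :
    z^T = - z -> dw = w *m dg rd + z *m w ->
    dw *m A *m w^T + w *m dA *m w^T + w *m A *m dw^T =
    w *m (dg rd *m A + dA + A *m dg rd) *m w^T +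
    (z *m (w *m A *m w^T) - w *m A *m w^T *m z).
  move=> trz ->; rewrite !(raddfD, mulmxDl, mulmxDr) /= !(trmx_mul, tr_dg) trz.
  rewrite !mulmxN !mulmxA -!addrA; congr (_ + _).
  by rewrite addrCA; congr (_ + _); rewrite addrCA.
pose H0 := u *m C *m u^T + v *m N *m v^T.
(* The part of h that is scalar on each plane commutes with xi, and the complementary projection is
   annihilated by xi on both sides. *)
have comm : xi *m h - h *m xi = xi *m H0 - H0 *m xi.
  rewrite /h /stepmx -/u -/v -/H0 [xi *m (_ + (_ - _))]mulmxDr mulmxDl restxi xirest !addr0.
  by rewrite [xi *m _]mulmxDr [(_ + _) *m xi]mulmxDl ecomm opprD addrACA subrr addr0.
have dhE : step_variation = G + (xi *m h - h *m xi).
  rewrite comm /step_variation (part _ _ _ _ _ trxi duE) (part _ _ _ _ _ trxi dvE) -/K -/L /G /H0.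
  rewrite (addrACA (u *m _ *m _)) [RHS]addrAC; congr (_ + _ + _).
  by rewrite mulmxDr mulmxDl opprD addrACA.
have G0 : \tr (torus lam *m h^T *m G) = 0.
  have GE (A B : 'M[R]_n) :
      u *m A *m u^T + v *m B *m v^T + (U *m dg de *m U^T + V *m dg de *m V^T) =
      rotU x y *m (dg rho *m A *m dg rho + dg de) *m (rotU x y)^T +
      rotV x y *m (dg rho *m B *m dg rho + dg de) *m (rotV x y)^T.
    rewrite /u /v -(rotU_scale x y rho) -(rotV_scale x y rho) -(rot_even xy1).
    by rewrite !trmx_mul !tr_dg !mulmxDr !mulmxDl !mulmxA addrACA.
  rewrite /G GE.
  exact: (trace_even_part xy1 yI erefl erefl erefl).
rewrite dhE mulmxDr mxtraceD G0 add0r mulmxBr raddfB /=; congr (_ - _).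
  rewrite -!mulmxA mxtrace_mulC -!mulmxA [S in RHS](_ : S = h *m torus lam *m h^T).
    by rewrite mxtrace_mulC -!mulmxA mxtrace_mulC !mulmxA.
  by rewrite hS -mulmxA hh' mulmx1.
by rewrite -!mulmxA (mulmxA h^T) hh mul1mx.
Qed.

End Variation.

End Frames.

(** * Coefficients of one Gelfand-Tsetlin step *)

(** Used with k = pi, t = |w_i| and L = lam_i + mu_i, where k t^2 L = lam_i^2 - mu_i^2: the 0/0 on
    the diagonal is resolved. In [cancel_scale_C] the extra term comes from lam_i = mu_i + pi
    |w_i|^2. *)
Lemma cancel_scale_N {F : fieldType} (a p q k t L : F) : L != 0 -> t != 0 -> k != 0 ->
  a * p * q / (k * L) = a * (t * p) * (t * q) / (k * t ^+ 2 * L).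
Proof. by move=> L0 t0 k0; field; rewrite L0 t0 k0. Qed.

Lemma cancel_scale_C {F : fieldType} (c a p q k t L : F) : L != 0 -> t != 0 -> k != 0 ->
  c = a + k * t ^+ 2 ->
  t * (p * q / L) * t + a * p * q / (k * L) = t * p * c * (t * q) / (k * t ^+ 2 * L).
Proof. by move=> L0 t0 k0 ->; field; rewrite L0 t0 k0. Qed.

Section Coefficients.
Context {R : realType} {r : nat}.
Variables (b : bool) (lam mu : 'I_r.+1 -> R).

Let Plam := \prod_(l | l != ord0) lam l.
Let Pmu := \prod_(l | l != ord0) mu l.

(* Up to the factor |w_i|^2, pco i ^+ 2 is the residue which gives the bordered
   matrix with diagonal mu the spectrum lam; the qco j normalise its
   eigenvectors. *)
Definition pco (i : 'I_r.+1) : R :=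
  if i == ord0 then (if b then lam ord0 * (Plam / Pmu) else 0) else
  Num.sqrt (pi * (lam i + mu i) *
    (if b then (mu i ^+ 2 - lam ord0 ^+ 2) / mu i ^+ 2 else 1) *
    \prod_(l | (l != ord0) && (l != i))
      ((mu i ^+ 2 - lam l ^+ 2) / (mu i ^+ 2 - mu l ^+ 2))).

(** For a corner of even size the entry at index 0 is the signed root Pmu / Plam. It stays smooth
    when an entry of mu passes through 0, where the root of its square would not. *)
Definition qco (j : 'I_r.+1) : R :=
  if j == ord0 then
    (if b then Num.sqrt (\prod_(i | i != ord0)
       ((lam ord0 ^+ 2 - mu i ^+ 2) / (lam ord0 ^+ 2 - lam i ^+ 2)))
     else Pmu / Plam) else
  Num.sqrt (pi * (lam j + mu j) / (lam j ^+ 2 - lam ord0 ^+ 2) *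
    \prod_(l | (l != ord0) && (l != j))
      ((lam j ^+ 2 - mu l ^+ 2) / (lam j ^+ 2 - lam l ^+ 2))).

(** The diagonal Cauchy entry of N after cancelling |w_i|^2. The corresponding entry of C exceeds it
    by a multiple of |w_i|^2, so this one term serves both matrices. *)
Definition eco (i : 'I_r.+1) : R :=
  if i == ord0 then 0 else mu i * pco i * qco i / (pi * (lam i + mu i)).

(** [cauchyC] without the factors |w_i| and without [eco]. The diagonal entry for i != 0 comes from
    lam_i - mu_i = pi |w_i|^2. The value 1 at (0, 0) is (Plam / Pmu) (Pmu / Plam), so that no
    division by mu remains. *)
Definition Cco : 'M[R]_r.+1 := \matrix_(i, j)
  if i == ord0 then
    if j == ord0 then (if b then Plam / Pmu * qco j else 1)
    else pco i * qco j / lam j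
  else if j == ord0 then
    (if b then pco i * lam j * qco j / (lam j ^+ 2 - mu i ^+ 2) else 0)
  else if i == j then pco i * qco i / (lam i + mu i)
  else pco i * lam j * qco j / (lam j ^+ 2 - mu i ^+ 2).

(** [cauchyN] without the factors |w_i| and without [eco], which is the whole diagonal for i != 0.
    In column 0 of the even case lam_0 = 0, and one factor mu_i of Pmu cancels against mu_i /
    mu_i^2. *)
Definition Nco : 'M[R]_r.+1 := \matrix_(i, j)
  if i == ord0 then qco j
  else if j == ord0 then
    (if b then mu i * pco i * qco j / (lam j ^+ 2 - mu i ^+ 2)
     else - (pco i * \prod_(l | (l != ord0) && (l != i)) mu l / Plam))
  else if i == j then 0
  else mu i * pco i * qco j / (lam j ^+ 2 - mu i ^+ 2).

(* The interlacing inequalities between the spectra lam of a skew matrix and mu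
   of a corner; b tells whether the corner has odd size.  Index 0 carries the
   last, possibly negative, entry of lam when b holds, and is 0 otherwise. *)
Record interlacing : Prop := Interlacing {
  il_lam0 : ~~ b -> lam ord0 = 0;
  il_mu0 : mu ord0 = 0;
  il_pos : forall i, i != ord0 -> 0 < lam i;
  il_le : forall i, i != ord0 -> mu i <= lam i;
  il_gt : forall i, i != ord0 -> - lam i < mu i;
  il_lt : forall i l : 'I_r.+1, i != ord0 -> (i < l)%N -> lam l < mu i;
  il_last : b -> forall i, i != ord0 -> `|lam ord0| < mu i }.

Hypothesis IL : interlacing.

Let sqr_ltr (u v : R) : `|u| < v -> u ^+ 2 < v ^+ 2.
Proof.
move=> uv; rewrite -real_normK ?num_real// ltr_pXn2r// nnegrE ?normr_ge0//.
exact: le_trans (normr_ge0 _) (ltW uv).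
Qed.

Let sqr_ler (u v : R) : `|u| <= v -> u ^+ 2 <= v ^+ 2.
Proof.
move=> uv; rewrite -real_normK ?num_real// ler_pXn2r// nnegrE ?normr_ge0//.
exact: le_trans (normr_ge0 _) uv.
Qed.

Lemma il_sum i : i != ord0 -> 0 < lam i + mu i.
Proof. by move=> i0; rewrite -ltrBlDl sub0r il_gt. Qed.

Lemma il_sq i : i != ord0 -> mu i ^+ 2 <= lam i ^+ 2.
Proof. by move=> i0; apply: sqr_ler; rewrite ler_norml il_le// ltW ?il_gt. Qed.

Lemma il_sqlt (i l : 'I_r.+1) : i != ord0 -> (i < l)%N -> lam l ^+ 2 < mu i ^+ 2.
Proof.
move=> i0 il; have l0 : l != ord0 by rewrite -lt0n (leq_ltn_trans _ il).
by apply: sqr_ltr; rewrite gtr0_norm ?il_pos// il_lt.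
Qed.

Lemma il_mu_gt0 i : b -> i != ord0 -> 0 < mu i.
Proof. by move=> bT i0; apply: le_lt_trans (il_last IL bT i0). Qed.

Lemma il_sq0_mu i : b -> i != ord0 -> lam ord0 ^+ 2 < mu i ^+ 2.
Proof. by move=> bT i0; apply/sqr_ltr/il_last. Qed.

Lemma il_sq0 i : i != ord0 -> lam ord0 ^+ 2 < lam i ^+ 2.
Proof.
move=> i0; case: (boolP b) => [bT|bF]; first exact: lt_le_trans (il_sq0_mu bT i0) (il_sq i0).
by rewrite (il_lam0 IL bF) expr0n /= exprn_gt0// il_pos.
Qed.

(** Both differences are negative for l < i and positive for l > i, since mu_i^2 <= lam_i^2 < mu_l^2
    <= lam_l^2 in the first case and symmetrically in the second. *)
Lemma il_ratio_mu i l : i != ord0 -> l != ord0 -> l != i ->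
  0 < (mu i ^+ 2 - lam l ^+ 2) / (mu i ^+ 2 - mu l ^+ 2).
Proof.
move=> i0 l0; rewrite neq_ltn => /orP[li|il].
  rewrite -mulrNN -invrN !opprB divr_gt0// subr_gt0.
    apply: le_lt_trans (il_sq i0) _; apply: lt_le_trans (il_sqlt l0 li) (il_sq l0).
  exact: le_lt_trans (il_sq i0) (il_sqlt l0 li).
rewrite divr_gt0// subr_gt0 ?il_sqlt//.
exact: le_lt_trans (il_sq l0) (il_sqlt i0 il).
Qed.

Lemma il_ratio_lam i l : i != ord0 -> l != ord0 -> l != i ->
  0 < (lam i ^+ 2 - mu l ^+ 2) / (lam i ^+ 2 - lam l ^+ 2).
Proof.
move=> i0 l0; rewrite neq_ltn => /orP[li|il].
  rewrite -mulrNN -invrN !opprB divr_gt0// subr_gt0 ?il_sqlt//.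
  exact: lt_le_trans (il_sqlt l0 li) (il_sq l0).
rewrite divr_gt0// subr_gt0.
  apply: le_lt_trans (il_sq l0) _; exact: lt_le_trans (il_sqlt i0 il) (il_sq i0).
exact: lt_le_trans (il_sqlt i0 il) (il_sq i0).
Qed.

Lemma pco_arg_gt0 i : i != ord0 -> 0 < pi * (lam i + mu i) *
    (if b then (mu i ^+ 2 - lam ord0 ^+ 2) / mu i ^+ 2 else 1) *
    \prod_(l | (l != ord0) && (l != i))
      ((mu i ^+ 2 - lam l ^+ 2) / (mu i ^+ 2 - mu l ^+ 2)).
Proof.
move=> i0; apply: mulr_gt0; last by apply: prodr_gt0 => l /andP[l0 li]; exact: il_ratio_mu.
apply: mulr_gt0; first by rewrite mulr_gt0 ?pi_gt0 ?il_sum.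
case: ifP => // bT; rewrite divr_gt0 ?subr_gt0 ?il_sq0_mu//.
by rewrite exprn_gt0// il_mu_gt0.
Qed.

Lemma pco_gt0 i : i != ord0 -> 0 < pco i.
Proof. by move=> i0; rewrite /pco (negPf i0) sqrtr_gt0 pco_arg_gt0. Qed.

Lemma qco_arg_gt0 j : j != ord0 ->
  0 < pi * (lam j + mu j) / (lam j ^+ 2 - lam ord0 ^+ 2) *
    \prod_(l | (l != ord0) && (l != j))
      ((lam j ^+ 2 - mu l ^+ 2) / (lam j ^+ 2 - lam l ^+ 2)).
Proof.
move=> j0; apply: mulr_gt0; last by apply: prodr_gt0 => l /andP[l0 li]; exact: il_ratio_lam.
by rewrite divr_gt0 ?subr_gt0 ?il_sq0// mulr_gt0 ?pi_gt0 ?il_sum.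
Qed.

Lemma qco0_arg_gt0 : b -> 0 < \prod_(i | i != ord0)
  ((lam ord0 ^+ 2 - mu i ^+ 2) / (lam ord0 ^+ 2 - lam i ^+ 2)).
Proof.
move=> bT; apply: prodr_gt0 => i i0.
by rewrite -mulrNN -invrN !opprB divr_gt0// subr_gt0 ?il_sq0_mu// il_sq0.
Qed.

Section Generic.
Variables (s : 'I_r.+1 -> R).
Hypothesis s_gt0 : forall i, i != ord0 -> 0 < s i.
Hypothesis lam_mu : forall i, i != ord0 -> lam i - mu i = pi * s i.
Hypothesis mu_neq0 : forall i, i != ord0 -> mu i != 0.

Let rho i : R := if i == ord0 then 1 else Num.sqrt (s i).
Let bet i := rho i * pco i.
Let gam j := rho j * qco j.

Let lam_neq0 i : i != ord0 -> lam i != 0.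
Proof. by move=> i0; rewrite gt_eqF ?il_pos. Qed.

Let lamV i j : i != ord0 -> lam j ^+ 2 != mu i ^+ 2.
Proof.
move=> i0; have [->|j0] := eqVneq j ord0.
  case: (boolP b) => [bT|bF]; first by rewrite lt_eqF ?il_sq0_mu.
  by rewrite (il_lam0 IL bF) expr0n/= eq_sym sqrf_eq0 mu_neq0.
have [->|ji] := eqVneq j i.
  rewrite -subr_eq0 subr_sqr mulf_neq0//; last by rewrite gt_eqF ?il_sum.
  by rewrite lam_mu// mulf_neq0// gt_eqF ?pi_gt0 ?s_gt0.
have := il_ratio_lam j0 i0; rewrite eq_sym => /(_ ji).
by rewrite -subr_eq0; apply: contraTneq => ->; rewrite mul0r ltxx.
Qed.

Let mu_inj i k : i != ord0 -> k != ord0 -> i != k -> mu i ^+ 2 != mu k ^+ 2.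
Proof.
move=> i0 k0 ik; have := il_ratio_mu i0 k0; rewrite eq_sym => /(_ ik).
by rewrite -subr_eq0; apply: contraTneq => ->; rewrite invr0 mulr0 ltxx.
Qed.

Let lam_inj i k : i != k -> lam i ^+ 2 != lam k ^+ 2.
Proof.
have [->|i0] := eqVneq i ord0; first by rewrite eq_sym => k0; rewrite lt_eqF ?il_sq0.
have [->|k0] := eqVneq k ord0; first by move=> _; rewrite gt_eqF ?il_sq0.
move=> ik; have := il_ratio_lam i0 k0; rewrite eq_sym => /(_ ik).
by rewrite -subr_eq0; apply: contraTneq => ->; rewrite invr0 mulr0 ltxx.
Qed.

Let betE i : i != ord0 -> (mu i * bet i) ^+ 2 =
  - \prod_l (mu i ^+ 2 - lam l ^+ 2) /
    \prod_(k | (k != ord0) && (k != i)) (mu i ^+ 2 - mu k ^+ 2).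
Proof.
move=> i0; rewrite /bet /rho /pco (negPf i0) !exprMn !sqr_sqrtr ?ltW ?pco_arg_gt0 ?s_gt0//.
rewrite [in X in - X / _](bigD1 ord0)//= [in X in - (_ * X) / _](bigD1 i)//= prodf_div.
have -> : mu i ^+ 2 - lam i ^+ 2 = - (pi * s i * (lam i + mu i)).
  by rewrite -lam_mu// -subr_sqr opprB.
set cc := if b then _ else _.
have ccE : mu i ^+ 2 * cc = mu i ^+ 2 - lam ord0 ^+ 2.
  rewrite /cc; case: ifP => [bT|/negbT bF]; first by rewrite mulrC divfK// sqrf_eq0 mu_neq0.
  by rewrite (il_lam0 IL bF) expr0n /= mulr1 subr0.
by rewrite -ccE; ring.
Qed.

Let gamE j : gam j ^+ 2 = \prod_(i | i != ord0) (lam j ^+ 2 - mu i ^+ 2) /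
  \prod_(l | l != j) (lam j ^+ 2 - lam l ^+ 2).
Proof.
have [->|j0] := eqVneq j ord0.
  rewrite /gam /rho /qco eqxx mul1r; case: ifP => [bT|/negbT bF].
    by rewrite sqr_sqrtr; [exact: prodf_div|exact/ltW/qco0_arg_gt0].
  transitivity (\prod_(i | i != ord0) (mu i / lam i) ^+ 2).
    by rewrite prodrXl prodf_div.
  rewrite -prodf_div (il_lam0 IL bF) expr0n /=.
  by apply: eq_bigr => i i0; rewrite !sub0r invrN mulrNN exprMn exprVn.
rewrite /gam /rho /qco (negPf j0) exprMn !sqr_sqrtr ?ltW ?qco_arg_gt0 ?s_gt0//.
rewrite [in RHS](bigD1 j)//= [in X in _ = _ / X](bigD1 ord0) 1?eq_sym//= prodf_div.
have -> : lam j ^+ 2 - mu j ^+ 2 = pi * s j * (lam j + mu j).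
  by rewrite -lam_mu// -subr_sqr.
have -> : \prod_(i | (i != j) && (i != ord0)) (lam j ^+ 2 - lam i ^+ 2) =
    \prod_(i | (i != ord0) && (i != j)) (lam j ^+ 2 - lam i ^+ 2).
  by apply: eq_bigl => i; rewrite andbC.
by rewrite !invfM; ring.
Qed.

Let bet0 : bet ord0 = lam ord0 * (Plam / Pmu).
Proof.
rewrite /bet /rho /pco eqxx mul1r; case: ifP => // /negbT bF.
by rewrite (il_lam0 IL bF) mul0r.
Qed.

Let N := dg rho *m Nco *m dg rho + dg eco.
Let C := dg rho *m Cco *m dg rho + dg eco.

(** Restoring the factors |w_i| recovers the Cauchy matrix where no w_i and no mu_i vanishes.
    Elsewhere [Nco] and [Cco] serve as its smooth continuation. *)
Lemma NcoE : N = cauchyN lam mu bet gam.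
Proof.
apply/matrixP => i j; rewrite /N mxE mul_mx_diag mxE mul_diag_mx !mxE.
have [i0|i0] := eqVneq i ord0.
  by rewrite /rho i0 eqxx /gam /rho mul1r mulrC /eco eqxx mul0rn addr0.
have [j0|j0] := eqVneq j ord0.
  rewrite /rho (negPf i0) j0 eqxx mulr1 (negPf i0) addr0.
  rewrite /bet /gam /rho (negPf i0) eqxx mul1r.
  case: (boolP b) => [bT|bF]; first by ring.
  have PmuE : Pmu = mu i * \prod_(l | (l != ord0) && (l != i)) mu l.
    by rewrite /Pmu (bigD1 i).
  have -> : qco ord0 = Pmu / Plam by rewrite /qco eqxx (negPf bF).
  rewrite (il_lam0 IL bF) expr0n /= sub0r PmuE -/Plam.
  have mi := mu_neq0 i0.
  have li : Plam != 0 by apply/prodf_neq0 => l l0; exact: lam_neq0.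
  by field; rewrite mi li.
rewrite /rho (negPf i0) (negPf j0) /bet /gam /rho (negPf i0) (negPf j0).
have [<-|ij] := eqVneq i j; last by rewrite addr0; ring.
rewrite mulr0 mul0r add0r /= mulr1n /eco (negPf i0).
have -> : lam i ^+ 2 - mu i ^+ 2 = pi * Num.sqrt (s i) ^+ 2 * (lam i + mu i).
  by rewrite sqr_sqrtr ?ltW ?s_gt0// -lam_mu// -subr_sqr.
have h1 : lam i + mu i != 0 by rewrite gt_eqF ?il_sum.
have h2 : Num.sqrt (s i) != 0 by rewrite gt_eqF// sqrtr_gt0 s_gt0.
have h3 : pi != 0 :> R by rewrite gt_eqF ?pi_gt0.
exact: cancel_scale_N.
Qed.

Lemma CcoE : C = cauchyC lam mu bet gam.
Proof.
apply/matrixP => i j; rewrite /C mxE mul_mx_diag mxE mul_diag_mx !mxE.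
have [i0|i0] := eqVneq i ord0.
  rewrite /rho i0 eqxx mul1r /eco eqxx mul0rn addr0 /bet /gam /rho eqxx !mul1r.
  have [j0|j0] := eqVneq j ord0; last by ring.
  rewrite j0 mulr1; case: (boolP b) => [_|bF]; first by rewrite mul1r.
  rewrite /qco eqxx (negPf bF) mul1r -/Plam -/Pmu.
  have li : Plam != 0 by apply/prodf_neq0 => l l0; exact: lam_neq0.
  have mi : Pmu != 0 by apply/prodf_neq0 => l l0; exact: mu_neq0.
  by rewrite mulrA divfK// divff.
have [j0|j0] := eqVneq j ord0.
  rewrite /rho (negPf i0) j0 eqxx mulr1 (negPf i0) addr0.
  rewrite /bet /gam /rho (negPf i0) eqxx mul1r.
  case: (boolP b) => [bT|bF]; first by ring.
  by rewrite (il_lam0 IL bF) !mulr0 !mul0r.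
rewrite /rho (negPf i0) (negPf j0) /bet /gam /rho (negPf i0) (negPf j0).
have [<-|ij] := eqVneq i j; last by rewrite addr0; ring.
rewrite /= mulr1n /eco (negPf i0).
have E : lam i = mu i + pi * Num.sqrt (s i) ^+ 2.
  by rewrite sqr_sqrtr ?ltW ?s_gt0// -lam_mu// addrC subrK.
have h1 : lam i + mu i != 0 by rewrite gt_eqF ?il_sum.
have h2 : Num.sqrt (s i) != 0 by rewrite gt_eqF// sqrtr_gt0 s_gt0.
have h3 : pi != 0 :> R by rewrite gt_eqF ?pi_gt0.
have -> : lam i ^+ 2 - mu i ^+ 2 = pi * Num.sqrt (s i) ^+ 2 * (lam i + mu i).
  by rewrite sqr_sqrtr ?ltW ?s_gt0// -lam_mu// -subr_sqr.
exact: cancel_scale_C.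
Qed.

Lemma Cco_orth : C^T *m C = 1%:M.
Proof. by rewrite CcoE; exact: (cauchyC_orth (il_mu0 IL) mu_neq0 lam_neq0 lamV mu_inj lam_inj betE gamE bet0). Qed.

Lemma Nco_orth : N^T *m N = 1%:M.
Proof. by rewrite NcoE; exact: (cauchyN_orth lamV mu_inj lam_inj betE gamE). Qed.

Lemma bordered_Nco : bordered mu bet *m N = C *m dg lam.
Proof. by rewrite NcoE CcoE; exact: (bordered_cauchyN gam (il_mu0 IL) lam_neq0 lamV bet0). Qed.

Lemma bordered_Cco : (bordered mu bet)^T *m C = N *m dg lam.
Proof. by rewrite NcoE CcoE; exact: (bordered_cauchyC gam (il_mu0 IL) mu_neq0 lam_neq0 lamV mu_inj betE bet0). Qed.

End Generic.

End Coefficients.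

(** * Smoothness of the coefficients *)

Section SmoothCoefficients.
Context {R : realType} {V : normedModType R} {r : nat}.
Variables (k : nat) (Om : set V) (b : bool) (lam mu : V -> 'I_r.+1 -> R).
Hypothesis oO : open Om.
Hypothesis Clam : forall i, Ck_on k Om (lam^~ i).
Hypothesis Cmu : forall i, Ck_on k Om (mu^~ i).
Hypothesis IL : forall z, Om z -> interlacing b (lam z) (mu z).

Lemma Ck_onB (f g : V -> R) : Ck_on k Om f -> Ck_on k Om g ->
  Ck_on k Om (fun z => f z - g z).
Proof. by move=> Cf Cg; apply: Ck_onD => //; apply: Ck_onN. Qed.

Lemma Ck_on_sqr (f : V -> R) : Ck_on k Om f -> Ck_on k Om (fun z => f z ^+ 2).
Proof. by move=> Cf; apply: Ck_onM. Qed.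

Lemma Ck_on_div (f g : V -> R) : Ck_on k Om f -> Ck_on k Om g ->
  (forall z, Om z -> g z != 0) -> Ck_on k Om (fun z => f z / g z).
Proof. by move=> Cf Cg g0; apply: Ck_onM => //; apply: Ck_onV. Qed.

Lemma Ck_on_if (c : bool) (f g : V -> R) : (c -> Ck_on k Om f) ->
  (~~ c -> Ck_on k Om g) -> Ck_on k Om (fun z => if c then f z else g z).
Proof. by case: c => [Cf _|_ Cg]; [exact: Cf|exact: Cg]. Qed.

Let Cl2 i : Ck_on k Om (fun z => lam z i ^+ 2).
Proof. exact: Ck_on_sqr. Qed.
Let Cm2 i : Ck_on k Om (fun z => mu z i ^+ 2).
Proof. exact: Ck_on_sqr. Qed.

Lemma ratio_neq0 (x y : R) : 0 < x / y -> y != 0.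
Proof. by apply: contraTneq => ->; rewrite invr0 mulr0 ltxx. Qed.

Let CPlam : Ck_on k Om (fun z => \prod_(l | l != ord0) lam z l).
Proof. exact: Ck_on_prod. Qed.
Let CPmu : Ck_on k Om (fun z => \prod_(l | l != ord0) mu z l).
Proof. exact: Ck_on_prod. Qed.

Let Plam0 z : Om z -> \prod_(l | l != ord0) lam z l != 0.
Proof. by move=> Oz; apply/prodf_neq0 => l l0; rewrite gt_eqF ?(il_pos (IL Oz)). Qed.

Let Pmu0 z : b -> Om z -> \prod_(l | l != ord0) mu z l != 0.
Proof. by move=> bT Oz; apply/prodf_neq0 => l l0; rewrite gt_eqF ?(il_mu_gt0 (IL Oz)). Qed.

(** The denominators contain no factor lam_i - mu_i, so they are nonzero by the inequalities of
    [interlacing], which remain valid at w = 0. The same holds for the other coefficients below. *)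
Lemma Ck_on_pco i : Ck_on k Om (fun z => pco b (lam z) (mu z) i).
Proof.
rewrite /pco; have [i0|i0] := eqVneq i ord0.
  apply: Ck_on_if => [bT|_]; last exact: Ck_on_const.
  by apply: Ck_onM => //; apply: Ck_on_div => // z; exact: Pmu0.
apply: Ck_on_sqrt => //; first by move=> z Oz; exact: (pco_arg_gt0 (IL Oz)).
apply: Ck_onM => //.
  apply: Ck_onM => //.
    by apply: Ck_onM => //; [exact: Ck_on_const|apply: Ck_onD].
  apply: Ck_on_if => [bT|_]; last exact: Ck_on_const.
  apply: Ck_on_div => //; first exact: Ck_onB.
  by move=> z Oz; rewrite sqrf_eq0 gt_eqF ?(il_mu_gt0 (IL Oz)).
apply: Ck_on_prod => // l /andP[l0 li]; apply: Ck_on_div; try exact: Ck_onB.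
by move=> z Oz; apply: ratio_neq0 (il_ratio_mu (IL Oz) i0 l0 li).
Qed.

Lemma Ck_on_qco j : Ck_on k Om (fun z => qco b (lam z) (mu z) j).
Proof.
rewrite /qco; have [j0|j0] := eqVneq j ord0.
  apply: Ck_on_if => [bT|_]; last exact: Ck_on_div.
  apply: Ck_on_sqrt => //; first by move=> z Oz; exact: (qco0_arg_gt0 (IL Oz)).
  apply: Ck_on_prod => // i i0; apply: Ck_on_div; try exact: Ck_onB.
  by move=> z Oz; rewrite lt_eqF// subr_lt0 (il_sq0 (IL Oz)).
apply: Ck_on_sqrt => //; first by move=> z Oz; exact: (qco_arg_gt0 (IL Oz)).
apply: Ck_onM => //.
  apply: Ck_on_div; last by move=> z Oz; rewrite gt_eqF// subr_gt0 (il_sq0 (IL Oz)).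
    by apply: Ck_onM => //; [exact: Ck_on_const|apply: Ck_onD].
  exact: Ck_onB.
apply: Ck_on_prod => // l /andP[l0 li]; apply: Ck_on_div; try exact: Ck_onB.
by move=> z Oz; apply: ratio_neq0 (il_ratio_lam (IL Oz) j0 l0 li).
Qed.

Let sum_neq0 i z : i != ord0 -> Om z -> lam z i + mu z i != 0.
Proof. by move=> i0 Oz; rewrite gt_eqF ?(il_sum (IL Oz)). Qed.

Let diff_neq0 i j z : i != ord0 -> i != j -> (j == ord0 -> b) -> Om z ->
  lam z j ^+ 2 - mu z i ^+ 2 != 0.
Proof.
move=> i0 ij jb Oz; have [j0|j0] := eqVneq j ord0.
  by rewrite j0 lt_eqF// subr_lt0 (il_sq0_mu (IL Oz))// jb// j0.
have := il_ratio_lam (IL Oz) j0 i0 ij.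
by apply: contraTneq => ->; rewrite mul0r ltxx.
Qed.

Lemma Ck_on_eco i : Ck_on k Om (fun z => eco b (lam z) (mu z) i).
Proof.
rewrite /eco; have [i0|i0] := eqVneq i ord0; first exact: Ck_on_const.
apply: Ck_on_div.
- apply: Ck_onM => //; last exact: Ck_on_qco.
  by apply: Ck_onM => //; exact: Ck_on_pco.
- by apply: Ck_onM => //; [exact: Ck_on_const|apply: Ck_onD].
- by move=> z Oz; rewrite mulf_neq0 ?sum_neq0// gt_eqF ?pi_gt0.
Qed.

Lemma Ck_on_Cco : Ck_on k Om (fun z => Cco b (lam z) (mu z)).
Proof.
have Cp := Ck_on_pco; have Cq := Ck_on_qco.
apply: Ck_on_mx => // i j.
rewrite (_ : (fun z => _) = (fun z => if i == ord0 then
    if j == ord0 then (if b then (\prod_(l | l != ord0) lam z l) /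
      (\prod_(l | l != ord0) mu z l) * qco b (lam z) (mu z) j else 1)
    else pco b (lam z) (mu z) i * qco b (lam z) (mu z) j / lam z j
  else if j == ord0 then
    (if b then pco b (lam z) (mu z) i * lam z j * qco b (lam z) (mu z) j /
      (lam z j ^+ 2 - mu z i ^+ 2) else 0)
  else if i == j then pco b (lam z) (mu z) i * qco b (lam z) (mu z) i / (lam z i + mu z i)
  else pco b (lam z) (mu z) i * lam z j * qco b (lam z) (mu z) j /
      (lam z j ^+ 2 - mu z i ^+ 2))); last by apply/funext => z; rewrite mxE.
have Coff : i != ord0 -> i != j -> (j == ord0 -> b) ->
    Ck_on k Om (fun z => pco b (lam z) (mu z) i * lam z j * qco b (lam z) (mu z) j /
      (lam z j ^+ 2 - mu z i ^+ 2)).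
  move=> i0 ij jb; apply: Ck_on_div; last by move=> z; exact: diff_neq0.
    by apply: Ck_onM => //; apply: Ck_onM.
  exact: Ck_onB.
have [i0|i0] := eqVneq i ord0.
  have [j0|j0] := eqVneq j ord0.
    apply: Ck_on_if => [bT|_]; last exact: Ck_on_const.
    by apply: Ck_onM => //; apply: Ck_on_div => // z; exact: Pmu0.
  apply: Ck_on_div => //; first exact: Ck_onM.
  by move=> z Oz; rewrite gt_eqF ?(il_pos (IL Oz)).
have [j0|j0] := eqVneq j ord0.
  apply: Ck_on_if => [bT|_]; last exact: Ck_on_const.
  by apply: Coff => //; rewrite j0.
have [ij|ij] := eqVneq i j; last by apply: Coff => //; rewrite (negPf j0).
apply: Ck_on_div => //; [exact: Ck_onM|exact: Ck_onD|by move=> z; exact: sum_neq0].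
Qed.

Lemma Ck_on_Nco : Ck_on k Om (fun z => Nco b (lam z) (mu z)).
Proof.
have Cp := Ck_on_pco; have Cq := Ck_on_qco.
apply: Ck_on_mx => // i j.
rewrite (_ : (fun z => _) = (fun z => if i == ord0 then qco b (lam z) (mu z) j
  else if j == ord0 then
    (if b then mu z i * pco b (lam z) (mu z) i * qco b (lam z) (mu z) j /
      (lam z j ^+ 2 - mu z i ^+ 2)
     else - (pco b (lam z) (mu z) i * \prod_(l | (l != ord0) && (l != i)) mu z l /
       \prod_(l | l != ord0) lam z l))
  else if i == j then 0
  else mu z i * pco b (lam z) (mu z) i * qco b (lam z) (mu z) j /
      (lam z j ^+ 2 - mu z i ^+ 2))); last by apply/funext => z; rewrite mxE.
have Coff : i != ord0 -> i != j -> (j == ord0 -> b) ->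
    Ck_on k Om (fun z => mu z i * pco b (lam z) (mu z) i * qco b (lam z) (mu z) j /
      (lam z j ^+ 2 - mu z i ^+ 2)).
  move=> i0 ij jb; apply: Ck_on_div; last by move=> z; exact: diff_neq0.
    by apply: Ck_onM => //; apply: Ck_onM.
  exact: Ck_onB.
have [i0|i0] := eqVneq i ord0; first exact: Cq.
have [j0|j0] := eqVneq j ord0.
  apply: Ck_on_if => [bT|_]; first by apply: Coff => //; rewrite j0.
  apply: Ck_onN => //; apply: Ck_on_div => //; apply: Ck_onM => //.
  exact: Ck_on_prod.
have [ij|ij] := eqVneq i j; first exact: Ck_on_const.
by apply: Coff => //; rewrite (negPf j0).
Qed.

Variables (m : nat) (U W : 'M[R]_(m, r.+1)) (x y : V -> 'I_r.+1 -> R).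
Hypothesis Cx : forall i, Ck_on k Om (x^~ i).
Hypothesis Cy : forall i, Ck_on k Om (y^~ i).

Lemma Ck_on_rotU : Ck_on k Om (fun z => rotU U W (x z) (y z)).
Proof.
apply: Ck_on_mx => // a i.
have C : Ck_on k Om (fun z => U a i * x z i + W a i * y z i).
  by apply: Ck_onD => //; apply: Ck_onM => //; exact: Ck_on_const.
by apply: Ck_on_eq C => // z _; rewrite mxE.
Qed.

Lemma Ck_on_rotV : Ck_on k Om (fun z => rotV U W (x z) (y z)).
Proof.
apply: Ck_on_mx => // a i.
have C : Ck_on k Om (fun z => W a i * x z i - U a i * y z i).
  by apply: Ck_onB; apply: Ck_onM => //; exact: Ck_on_const.
by apply: Ck_on_eq C => // z _; rewrite mxE.
Qed.

Lemma Ck_on_dg (e : V -> 'I_r.+1 -> R) : (forall i, Ck_on k Om (e^~ i)) ->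
  Ck_on k Om (fun z => dg (e z)).
Proof.
move=> Ce; apply: Ck_on_mx => // i j.
have C : Ck_on k Om (fun z => e z i * (i == j)%:R).
  by apply: Ck_onM => //; exact: Ck_on_const.
by apply: Ck_on_eq C => // z _; rewrite dgE mulr_natr.
Qed.

Lemma Ck_on_stepmx : Ck_on k Om (fun z => stepmx U W (Cco b (lam z) (mu z))
  (Nco b (lam z) (mu z)) (eco b (lam z) (mu z)) (x z) (y z)).
Proof.
have CU := Ck_on_rotU; have CV := Ck_on_rotV.
have cst (M : 'M[R]_(m, r.+1)) : Ck_on k Om (fun=> M) by exact: Ck_on_cst.
have Ce := Ck_on_dg Ck_on_eco.
apply: Ck_onD => //; last exact: Ck_on_cst.
apply: Ck_onD => //; apply: Ck_onD => //.
- apply: Ck_on_mulmx => //; last exact: Ck_on_trmx.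
  by apply: Ck_on_mulmx => //; exact: Ck_on_Cco.
- apply: Ck_on_mulmx => //; last exact: Ck_on_trmx.
  by apply: Ck_on_mulmx => //; exact: Ck_on_Nco.
- by apply: Ck_on_mulmx => //; [exact: Ck_on_mulmx|exact: Ck_on_cst].
- by apply: Ck_on_mulmx => //; [exact: Ck_on_mulmx|exact: Ck_on_cst].
Qed.

End SmoothCoefficients.

(** * The step matrix at the centre of the ball *)

Section StepAtZero.
Context {R : realType} {r m : nat}.
Variables (b : bool) (lam mu : 'I_r.+1 -> R) (U V : 'M[R]_(m, r.+1)).
Hypothesis IL : interlacing b lam mu.
Hypothesis lammu : forall i, i != ord0 -> mu i = lam i.

Let Plam0 : \prod_(l | l != ord0) lam l != 0.
Proof. by apply/prodf_neq0 => l l0; rewrite gt_eqF ?(il_pos IL). Qed.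

Let PE : \prod_(l | l != ord0) mu l = \prod_(l | l != ord0) lam l.
Proof. exact: eq_bigr. Qed.

Lemma qco0_zero : qco b lam mu ord0 = 1.
Proof.
rewrite /qco eqxx; case: (boolP b) => [bT|_]; last by rewrite PE divff.
rewrite big1 ?sqrtr1// => i i0; rewrite lammu// divff//.
by rewrite lt_eqF// subr_lt0 (il_sq0 IL).
Qed.

Lemma eco_zero i : i != ord0 -> eco b lam mu i = 1.
Proof.
move=> i0; have li := il_pos IL i0.
(* For mu = lam all ratios over l are 1, and the factors with lam_0 cancel between the two squares,
   leaving (2 pi lam_i)^2 / lam_i^2. *)
have pq : pco b lam mu i * qco b lam mu i = 2 * pi.
  apply/eqP; rewrite -(@eqrXn2 _ 2)//; last 2 first.
  - rewrite mulr_ge0 ?ltW ?pco_gt0// /qco (negPf i0) sqrtr_gt0; exact: (qco_arg_gt0 IL).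
  - by rewrite mulr_ge0 ?pi_ge0.
  rewrite exprMn /pco /qco (negPf i0) !sqr_sqrtr; last 2 first.
  - exact/ltW/(qco_arg_gt0 IL).
  - exact/ltW/(pco_arg_gt0 IL).
  have l0 : lam i != 0 by rewrite gt_eqF.
  have sq0 : lam i ^+ 2 - lam ord0 ^+ 2 != 0 by rewrite gt_eqF// subr_gt0 (il_sq0 IL).
  rewrite big1 => [|l /andP[l0' li']]; last first.
    have := il_ratio_mu IL i0 l0' li'; rewrite !lammu// => /ratio_neq0; exact: divff.
  rewrite big1 => [|l /andP[l0' li']]; last first.
    have := il_ratio_lam IL i0 l0' li'; rewrite !lammu// => /ratio_neq0; exact: divff.
  rewrite lammu// !mulr1; case: (boolP b) => [bT|bF]; apply/eqP.
    by field; rewrite l0 sq0.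
  have := sq0; rewrite (il_lam0 IL bF) expr0n /= subr0 => ?.
  by field; rewrite l0.
rewrite /eco (negPf i0) -(mulrA (mu i)) pq lammu//.
have p0 : pi != 0 :> R by rewrite gt_eqF ?pi_gt0.
have l0 : lam i != 0 by rewrite gt_eqF.
have -> : lam i * (2 * pi) = pi * (lam i + lam i) by ring.
by rewrite divff// mulf_neq0// -mulr2n mulrn_eq0.
Qed.

Let E : 'I_r.+1 -> R := fun i => if i == ord0 then 1 else 0.

(** This fixes the value of the construction at the centre: determinant 1 spreads from there over
    the ball, and the orbit point reached there is the torus element itself. *)
Lemma stepmx_zero : (~~ b -> forall a, U a ord0 = 0) ->
  stepmx U V (Cco b lam mu) (Nco b lam mu) (eco b lam mu)
    (fun i => if i == ord0 then 1 else 0) (fun=> 0) = 1%:M.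
Proof.
move=> U0.
have colE (W W' : 'M[R]_(m, r.+1)) (A : 'M[R]_r.+1) : A ord0 ord0 = 1 \/ (forall a, W a ord0 = 0) ->
    rotU W W' E (fun=> 0) *m A *m (rotU W W' E (fun=> 0))^T + W *m dg (eco b lam mu) *m W^T = W *m W^T.
  move=> A00; apply/matrixP => a c; rewrite mxE sandwichE [RHS]mxE mxE.
  have WE d i : rotU W W' E (fun=> 0) d i = W d i *+ (i == ord0).
    by rewrite mxE mulr0 addr0 /E; case: eqP; rewrite ?mulr1// mulr0.
  rewrite (bigD1 ord0)//= big1 => [|i i0]; last first.
    by rewrite [_^T _ _]mxE WE (negPf i0) mulr0.
  rewrite [_^T _ _]mxE !WE !mxE (bigD1 ord0)//= big1 => [|i i0]; last first.
    by rewrite WE (negPf i0) mul0r.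
  rewrite WE !addr0 /= !mulr1n [in RHS](bigD1 ord0)//= [X in _ + X](bigD1 ord0)//=.
  have -> : eco b lam mu ord0 = 0 by rewrite /eco eqxx.
  rewrite mulr0 mul0r add0r mxE; congr (_ + _).
    by case: A00 => [->|W0]; [rewrite mulr1|rewrite !W0 !mul0r].
  by apply: eq_bigr => i i0; rewrite eco_zero// mulr1 mxE.
have rVE : rotV U V E (fun=> 0) = rotU V U E (fun=> 0).
  by apply/matrixP => a i; rewrite !mxE !mulr0 subr0 addr0.
have C00 : Cco b lam mu ord0 ord0 = 1 \/ forall a, U a ord0 = 0.
  case: (boolP b) U0 => [bT _|bF U0]; last by right; exact: U0.
  left; have := qco0_zero; rewrite bT => q0; rewrite mxE eqxx q0 mulr1 PE divff//.
have N00 : Nco b lam mu ord0 ord0 = 1 \/ forall a, V a ord0 = 0.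
  by left; rewrite mxE eqxx qco0_zero.
rewrite /stepmx -/E rVE (addrACA (rotU _ _ _ _ *m _ *m _)) colE// colE//.
by rewrite [LHS]addrC -[X in X + _]addrA -opprD; exact: subrK.
Qed.

End StepAtZero.

(** * Coordinates on the ball *)

(** Position at which the block of the j./2 coordinates of step j starts; [off m] is the complex
    dimension of the ball. *)
Definition off (k : nat) : nat := \sum_(0 <= j < k) j./2.

Lemma offS k : off k.+1 = (off k + k./2)%N.
Proof. by rewrite /off big_nat_recr. Qed.

Lemma sum_off {R : nmodType} (G : nat -> R) k :
  \sum_(0 <= q < off k) G q = \sum_(0 <= j < k) \sum_(0 <= i < j./2) G (off j + i)%N.
Proof.
elim: k => [|k IH]; first by rewrite /off !big_geq.
rewrite offS [RHS]big_nat_recr//= -IH (@big_cat_nat _ _ _ (off k)) ?leq_addr//=.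
congr (_ + _); rewrite -{1}[off k]add0n big_addn addKn.
by apply: eq_bigr => i _; rewrite addnC.
Qed.

Section Coordinates.
Context {R : realType} (m : nat) (l : nat -> R).

Definition param := ('rV[R]_(off m) * 'rV[R]_(off m))%type.
Implicit Types (z v : param).

(** Access by a natural number, with value 0 out of range, so that positions off j + i need no proof
    of membership. *)
Definition getv (v : 'rV[R]_(off m)) (p : nat) : R :=
  \sum_(q < off m) v 0 q *+ (q == p :> nat).

Lemma getvE (v : 'rV[R]_(off m)) (q : 'I_(off m)) : getv v q = v 0 q.
Proof.
rewrite /getv (bigD1 q)//= eqxx mulr1n big1 ?addr0// => i iq.
by rewrite (_ : (i == q :> nat) = false) ?mulr0n//; apply/negbTE.
Qed.

Lemma sum_getv (G : R -> R -> R) z :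
  \sum_(q < off m) G (z.1 0 q) (z.2 0 q) =
  \sum_(0 <= j < m) \sum_(0 <= i < j./2) G (getv z.1 (off j + i)) (getv z.2 (off j + i)).
Proof.
rewrite -(sum_off (fun p => G (getv z.1 p) (getv z.2 p))) big_mkord.
by apply: eq_bigr => q _; rewrite !getvE.
Qed.

(* The coordinates of the j-th step are w_(j,i) = cx j i + 'i * cy j i, i < j./2. *)
Definition cx (j i : nat) z : R := getv z.1 (off j + i).
Definition cy (j i : nat) z : R := getv z.2 (off j + i).
Definition ss (j i : nat) z : R := cx j i z ^+ 2 + cy j i z ^+ 2.

Lemma ss_ge0 j i z : 0 <= ss j i z.
Proof. by rewrite addr_ge0 ?sqr_ge0. Qed.

(* mu k lists the entries of the k-th row of the Gelfand-Tsetlin pattern. *)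
Definition mu (k i : nat) z : R :=
  l i - pi * \sum_(k <= j < m | (i < j./2)%N) ss j i z.

Lemma mu_top i z : mu m i z = l i.
Proof. by rewrite /mu big_geq// mulr0 subr0. Qed.

Lemma mu_step j i z : (j < m)%N -> (i < j./2)%N ->
  mu j.+1 i z - mu j i z = pi * ss j i z.
Proof.
move=> jm ij; rewrite /mu [in X in _ - X]big_ltn_cond// ij mulrDr; ring.
Qed.

Let tail (k i : nat) z : R := pi * \sum_(k <= j < m | (i < j./2)%N) ss j i z.

Let tail_ge0 k i z : 0 <= tail k i z.
Proof. by rewrite mulr_ge0 ?pi_ge0// sumr_ge0// => j _; exact: ss_ge0. Qed.

Let sum_le (r i i' : nat) (G : nat -> R) : (forall i, 0 <= G i) -> i != i' ->
  (if (i < r)%N then G i else 0) + (if (i' < r)%N then G i' else 0) <=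
  \sum_(0 <= k < r) G k.
Proof.
move=> G0 ii'; rewrite big_mkord.
pose P (k : 'I_r) := (k == i :> nat) || (k == i' :> nat).
rewrite [leRHS](bigID P)/= -[leLHS]addr0 lerD ?sumr_ge0//.
have one i0 : \sum_(k < r | k == i0 :> nat) G k = if (i0 < r)%N then G i0 else 0.
  case: ifP => [ir|ir].
    by rewrite (bigD1 (Ordinal ir))//= big1 ?addr0// => k /andP[/eqP ki]; rewrite -val_eqE /= ki eqxx.
  by rewrite big_pred0// => k; apply/negP => /eqP ki; rewrite -ki ltn_ord in ir.
rewrite (bigID (fun k : 'I_r => k == i :> nat))/= -!one lerD//.
  rewrite le_eqVlt; apply/orP; left; apply/eqP.
  by apply: eq_bigl => k; rewrite andb_idl// /P => ->.
rewrite le_eqVlt; apply/orP; left; apply/eqP.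
apply: eq_bigl => k; rewrite /P; case: (eqVneq (k : nat) i) => [->|ki] /=.
  by rewrite (negPf ii').
by rewrite andbT.
Qed.

(** Pattern entries with different i, i' involve disjoint sets of coordinates, so both losses
    together are bounded by pi times the squared norm, even when taken from different rows. *)
Let tail_lt (a : R) k k' i i' z : std_ball a z -> i != i' ->
  tail k i z + tail k' i' z < a.
Proof.
move=> zB ii'; apply: le_lt_trans zB.
rewrite (sum_getv (fun x y => x ^+ 2 + y ^+ 2)) -mulrDr ler_pM2l ?pi_gt0//.
have tl k0 i0 : \sum_(k0 <= j < m | (i0 < j./2)%N) ss j i0 z <=
    \sum_(0 <= j < m) if (i0 < j./2)%N then ss j i0 z else 0.
  rewrite big_mkcond /=; have [km|mk] := leqP k0 m; last first.
    rewrite big_geq ?(ltnW mk)// sumr_ge0// => j _; case: ifP => // _; exact: ss_ge0.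
  rewrite [leRHS](@big_cat_nat _ _ _ k0)//= lerDr sumr_ge0// => j _.
  by case: ifP => // _; exact: ss_ge0.
apply: le_trans (lerD (tl k i) (tl k' i')) _; rewrite -big_split /=.
apply: ler_sum => j _; exact: sum_le (fun i => ss_ge0 j i z) ii'.
Qed.

Variable a : R.
Hypothesis l_diff : forall i i', (i < i')%N -> (i' < m./2)%N -> a <= l i - l i'.
Hypothesis l_sum : forall i i', (i < i')%N -> (i' < m./2)%N -> a <= l i + l i'.
Hypothesis l_last : odd m -> forall i, (i < m./2)%N -> a <= 2 * l i.

Let tail1_lt k i z : std_ball a z -> tail k i z < a.
Proof.
move=> zB; apply: le_lt_trans (tail_lt k 0 zB (_ : i != i.+1)).
  by rewrite lerDl.
by rewrite neq_ltn ltnSn.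
Qed.

Let muE k i z : mu k i z = l i - tail k i z. Proof. by []. Qed.

Lemma mu_lt k k' i i' z : std_ball a z -> (i < i')%N -> (i' < m./2)%N ->
  `|mu k' i' z| < mu k i z.
Proof.
move=> zB ii' im; rewrite ltr_norml !muE.
have d := l_diff ii' im; have s := l_sum ii' im.
have ne : i != i' by rewrite neq_ltn ii'.
have t := tail_lt k k' zB ne; have t1 := tail1_lt k i zB.
have t0 := tail_ge0 k' i' z; apply/andP; split; lra.
Qed.

(** The last index i = m./2 - 1 carries a coordinate only for odd m, and then only in the step from
    m - 1 to m, where the upper row is l itself. *)
Let last_row j i z : (j < m)%N -> (i < j./2)%N -> ~~ (i.+1 < m./2)%N ->
  odd m /\ tail j.+1 i z = 0.
Proof.
rewrite -leqNgt => jm ij mi.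
have jE : j.+1 = m.
  apply/eqP; rewrite eqn_leq jm /= leqNgt; apply/negP => jm2.
  have h : (j.+2./2 <= m./2)%N by exact: half_leq.
  by have := leq_ltn_trans (leq_trans h mi) (leq_ltn_trans ij (ltnSn _)); rewrite ltnn.
split; last by rewrite /tail jE big_geq// mulr0.
rewrite -jE /=; apply/negP => oj; move: mi; rewrite -jE -[j.+1./2]/(uphalf j).
by rewrite uphalf_half oj add1n ltnS leqNgt ij.
Qed.

Let l_large j i : (j < m)%N -> (i < j./2)%N -> (i.+1 < m./2)%N -> a <= l i.
Proof.
move=> jm ij im; have := l_diff (ltnSn i) im; have := l_sum (ltnSn i) im; lra.
Qed.

Let half_lt j i : (j < m)%N -> (i < j./2)%N -> (i < m./2)%N.
Proof. by move=> jm ij; apply: leq_trans ij (half_leq (ltnW jm)). Qed.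

Lemma mu_gt0 j i z : 0 < a -> std_ball a z -> (j < m)%N -> (i < j./2)%N ->
  0 < mu j.+1 i z.
Proof.
move=> a0 zB jm ij; rewrite muE; have [im|im] := boolP (i.+1 < m./2)%N.
  have := l_large jm ij im; have := tail1_lt j.+1 i zB; lra.
have [om ->] := last_row z jm ij im.
have := l_last om (half_lt jm ij); lra.
Qed.

(** If i is not last, the average of l_i - l_(i+1) and l_i + l_(i+1) bounds l_i below by a. If it is
    last, the upper entry is l_i and the sum is 2 l_i minus a single loss; this is where the short
    coroot is used. *)
Lemma mu_sum_gt0 j i z : 0 < a -> std_ball a z -> (j < m)%N -> (i < j./2)%N ->
  0 < mu j.+1 i z + mu j i z.
Proof.
move=> a0 zB jm ij; rewrite !muE; have [im|im] := boolP (i.+1 < m./2)%N.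
  have := l_large jm ij im; have := tail1_lt j.+1 i zB; have := tail1_lt j i zB; lra.
have [om ->] := last_row z jm ij im.
have := l_last om (half_lt jm ij); have := tail1_lt j i zB; lra.
Qed.

Section Step.
Variable j : nat.

Definition lamf z (i : 'I_(j./2).+1) : R :=
  if (i : nat) is i'.+1 then mu j.+1 i' z else if odd j then mu j.+1 j./2 z else 0.
Definition muf z (i : 'I_(j./2).+1) : R :=
  if (i : nat) is i'.+1 then mu j i' z else 0.
(** Index 0 belongs to no coordinate. It gets the constant w_0 = 1, so its columns are neither
    rotated nor scaled; entry i of the pattern sits at index i.+1. *)
Definition xf z (i : 'I_(j./2).+1) : R := if (i : nat) is i'.+1 then cx j i' z else 1.
Definition yf z (i : 'I_(j./2).+1) : R := if (i : nat) is i'.+1 then cy j i' z else 0.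

Lemma interlacing_step z : 0 < a -> std_ball a z -> (j < m)%N ->
  interlacing (odd j) (lamf z) (muf z).
Proof.
move=> a0 zB jm; split.
- by rewrite /lamf /= => /negPf ->.
- by [].
- case=> -[|i] // ij _; rewrite /lamf /=; exact: mu_gt0.
- case=> -[|i] // ij _; rewrite /lamf /muf /= -subr_ge0 mu_step//.
  by rewrite mulr_ge0 ?pi_ge0 ?ss_ge0.
- by case=> -[|i] // ij _; rewrite /lamf /muf /= -subr_gt0 opprK addrC mu_sum_gt0.
- case=> -[|i] // ij [[|i'] //= i'j] _ ii'; rewrite /lamf /muf /=.
  by apply: le_lt_trans (ler_norm _) (mu_lt _ _ zB _ _) => //; exact: half_lt jm _.
- move=> oj; case=> -[|i] // ij _; rewrite /lamf /muf /= oj.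
  apply: mu_lt => //; apply: leq_trans (half_leq jm).
  by rewrite -[j.+1./2]/(uphalf j) uphalf_half oj.
Qed.

End Step.
End Coordinates.

(** * The coordinate frames of a step *)

Section CoordinateFrames.
Context {R : realType} (m j : nat).
Hypothesis jm : (j < m)%N.

(* Column i.+1 of UF and VF spans the plane of the i-th torus entry.  Column 0 of
   VF is the new basis vector of index j; for odd j column 0 of UF is its partner
   j.-1 in the last plane of the upper corner, and it vanishes for even j. *)
Definition UF : 'M[R]_(m, (j./2).+1) := \matrix_(a, i)
  if (i : nat) is i'.+1 then
    if odd j then (a == i'.*2 :> nat)%:R else - (a == i'.*2.+1 :> nat)%:R
  else if odd j then (a.+1 == j :> nat)%:R else 0.

Definition VF : 'M[R]_(m, (j./2).+1) := \matrix_(a, i)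
  if (i : nat) is i'.+1 then (a == (odd j + i'.*2)%N :> nat)%:R
  else (a == j :> nat)%:R.

Definition IF (i : 'I_(j./2).+1) : R := if (i : nat) is _.+1 then 1 else (odd j)%:R.

(** The torus element of the upper corner of size k, padded by zeros to size m. *)
Definition tmx (k : nat) (c : nat -> R) : 'M[R]_m := \matrix_(a, b)
  \sum_(0 <= i < k./2) c i *
    (((a == i.*2.+1 :> nat) && (b == i.*2 :> nat))%:R -
     ((a == i.*2 :> nat) && (b == i.*2.+1 :> nat))%:R).

Let sum_delta (p q : nat) : (p < m)%N ->
  \sum_(a < m) (a == p :> nat)%:R * (a == q :> nat)%:R = (p == q)%:R :> R.
Proof.
move=> pm; rewrite (bigD1 (Ordinal pm))//= eqxx mul1r big1 ?addr0// => a.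
by rewrite -val_eqE /= => /negPf ->; rewrite mul0r.
Qed.

Let vidx (i : 'I_(j./2).+1) : nat := if (i : nat) is i'.+1 then odd j + i'.*2 else j.
Let uidx (i : 'I_(j./2).+1) : nat :=
  if (i : nat) is i'.+1 then if odd j then i'.*2 else i'.*2.+1 else j.-1.
Let sgn (i : 'I_(j./2).+1) : R :=
  if odd j then 1 else if (i : nat) is _.+1 then -1 else 0.

Let vidx_lt i : (vidx i < m)%N.
Proof. by move: jm; case: i => -[|i] ij; rewrite /vidx /=; lia. Qed.
Let uidx_lt i : (uidx i < m)%N.
Proof. by move: jm; case: i => -[|i] ij; rewrite /uidx /=; try case: ifP => oj; lia. Qed.

Let VFE a i : VF a i = (a == vidx i :> nat)%:R.
Proof. by rewrite mxE /vidx; case: (i : nat). Qed.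

Let UFE a i : UF a i = sgn i * (a == uidx i :> nat)%:R.
Proof.
rewrite mxE /uidx /sgn; case: i => -[|i] ij /=; case: ifP => oj; rewrite ?mul0r ?mul1r ?mulN1r//.
by congr (_%:R); congr nat_of_bool; lia.
Qed.

Lemma VF_orth : VF^T *m VF = 1%:M.
Proof.
apply/matrixP => i k; rewrite !mxE.
under eq_bigr do rewrite mxE !VFE.
rewrite sum_delta//; congr (_%:R); congr nat_of_bool; rewrite -val_eqE.
by case: i k => -[|i] ij [[|k] kj]; rewrite /vidx /=; lia.
Qed.

Lemma UF_VF : UF^T *m VF = 0.
Proof.
apply/matrixP => i k; rewrite !mxE.
under eq_bigr do rewrite mxE VFE UFE -mulrA.
rewrite -mulr_sumr sum_delta// /sgn /uidx /vidx.
case: i k => -[|i] ij [[|k] kj] /=; case: ifP => oj; rewrite ?mul0r//;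
  rewrite (_ : (_ == _) = false) ?mulr0//; lia.
Qed.

Lemma UF_orth : UF^T *m UF = dg IF.
Proof.
apply/matrixP => i k; rewrite dgE mxE.
under eq_bigr do rewrite mxE !UFE mulrACA.
rewrite -mulr_sumr sum_delta// /sgn /uidx /IF -val_eqE.
case: i k => -[|i] ij [[|k] kj] /=; have [oj|oj] := boolP (odd j) => /=;
  rewrite ?(mul0r, mulr0, mul0rn, mulrNN, mul1r, mulr0n)//;
  do ?case: eqP => ? /=; rewrite ?mulr0n ?mulr1n//; exfalso; lia.
Qed.

Lemma UF_IF : UF *m dg IF = UF.
Proof.
apply/matrixP => a i; rewrite mulmx_dgE !mxE /IF; case: i => -[|i] ij /=; rewrite ?mulr1//.
by case: ifP => oj; rewrite ?mulr1// mulr0.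
Qed.

Lemma UF_row0 b i : (j < b)%N -> forall bm : (b < m)%N, UF (Ordinal bm) i = 0.
Proof.
move=> jb bm; rewrite UFE /= (_ : (_ == _) = false) ?mulr0//.
by case: i => -[|i] ij; rewrite /uidx /=; try case: ifP => oj; lia.
Qed.

Lemma VF_row0 b i : (j < b)%N -> forall bm : (b < m)%N, VF (Ordinal bm) i = 0.
Proof.
move=> jb bm; rewrite VFE /= (_ : (_ == _) = false)//.
by case: i => -[|i] ij; rewrite /vidx /=; lia.
Qed.

Lemma UF_col0 : ~~ odd j -> forall a, UF a ord0 = 0.
Proof. by move=> /negPf oj a; rewrite mxE /= oj. Qed.

Lemma torus_entry (c : 'I_(j./2).+1 -> R) a b : torus UF VF c a b =
  (VF a ord0 * c ord0 * UF b ord0 - UF a ord0 * c ord0 * VF b ord0) +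
  \sum_(i < j./2) c (lift ord0 i) *
    (((a == i.*2.+1 :> nat) && (b == i.*2 :> nat))%:R -
     ((a == i.*2 :> nat) && (b == i.*2.+1 :> nat))%:R).
Proof.
rewrite /torus mx_subE !sandwichE -sumrB big_ord_recl; congr (_ + _).
apply: eq_bigr => i _; rewrite !mxE /=; case: ifP => oj /=; rewrite ?add1n ?add0n;
  by do 4![case: eqP => ? /=]; ring.
Qed.

Lemma torus_lower (c : 'I_(j./2).+1 -> R) (d : nat -> R) : c ord0 = 0 ->
  (forall i, c (lift ord0 i) = d i) -> torus UF VF c = tmx j d.
Proof.
move=> c0 cd; apply/matrixP => a b; rewrite torus_entry c0 !mulr0 !mul0r subrr add0r.
by rewrite mxE big_mkord; apply: eq_bigr => i _; rewrite cd.
Qed.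

Lemma torus_upper (c : 'I_(j./2).+1 -> R) (d : nat -> R) :
  (odd j -> c ord0 = d j./2) ->
  (forall i, c (lift ord0 i) = d i) -> torus UF VF c = tmx j.+1 d.
Proof.
move=> c0 cd; apply/matrixP => a b; rewrite torus_entry [RHS]mxE.
rewrite (eq_bigr (fun i : 'I_(j./2) => d i *
    (((a == i.*2.+1 :> nat) && (b == i.*2 :> nat))%:R -
     ((a == i.*2 :> nat) && (b == i.*2.+1 :> nat))%:R))) => [|i _]; last by rewrite cd.
rewrite -[j.+1./2]/(uphalf j) uphalf_half; case: (boolP (odd j)) => oj; last first.
  rewrite add0n !UF_col0// mulr0 !mul0r subrr add0r.
  by rewrite [RHS]big_mkord.
rewrite add1n big_nat_recr//= addrC big_mkord; congr (_ + _).
rewrite c0// !mxE /= oj; have jE : j = (j./2).*2.+1 by lia.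
have E1 (x : 'I_m) : (x == j :> nat) = (x == (j./2).*2.+1 :> nat) by rewrite {1}jE.
have E2 (x : 'I_m) : (x.+1 == j) = (x == (j./2).*2 :> nat) by rewrite {1}jE.
rewrite !E1 !E2; by do 4![case: eqP => ? /=]; ring.
Qed.

End CoordinateFrames.

(** * Generic points of the ball *)

(** Splitting off the power of X at 0 leaves a factor that is nonzero at 0, hence nearby. *)
Lemma poly_near_neq0 {R : realType} (p : {poly R}) : p != 0 ->
  \forall t \near 0^', p.[t] != 0.
Proof.
move=> p0; have [k [q q0 ->]] := multiplicity_XsubC p 0.
rewrite p0 /= rootE in q0.
have cq : \forall t \near 0, q.[t] != 0.
  have := @continuous_horner R q 0 => /cvgr_neq0; apply; exact: q0.
near=> t; rewrite hornerM horner_exp hornerXsubC subr0 mulf_neq0//.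
  by near: t; apply: (@nbhs_dnbhs _ (0 : R)); exact: cq.
rewrite expf_neq0//; near: t; exact: nbhs_dnbhs_neq.
Unshelve. all: by end_near. Qed.

Section ParameterSpace.
Context {R : realType} (m : nat).
Notation Z := (@param R m).
Implicit Types (z v : Z).

Lemma derive_linear (W : normedModType R) (f : {linear Z -> W}) z v :
  continuous f -> 'D_v f z = f v.
Proof. by move=> cf; rewrite deriveE; [rewrite diff_lin|exact: linear_differentiable]. Qed.

Section Functional.
Variables (c d : 'rV[R]_(off m)).

Definition functional z : R := \sum_q (z.1 0 q * c 0 q + z.2 0 q * d 0 q).

Let functional_linear : linear functional.
Proof.
move=> k u v; rewrite /functional scaler_sumr -big_split; apply: eq_bigr => q _ /=.
by rewrite !mxE /GRing.scale /=; ring.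
Qed.

Definition functional_lin : {linear Z -> R} :=
  HB.pack functional (GRing.isLinear.Build R Z R _ functional functional_linear).

Lemma functional_continuous : continuous functional.
Proof.
have : Ck_on 0 setT functional.
  apply: Ck_on_sum => [|q _]; first exact: openT.
  move=> z _; apply: cvgD; apply: cvgMr_tmp.
    apply: (@continuous_comp Z _ _ fst (fun M : 'rV[R]_(off m) => M 0 q)); first exact: cvg_fst.
    exact: coord_continuous.
  apply: (@continuous_comp Z _ _ snd (fun M : 'rV[R]_(off m) => M 0 q)); first exact: cvg_snd.
  exact: coord_continuous.
by move=> cf z; exact: cf.
Qed.

Lemma Ck_on_functional k (U : set Z) : Ck_on k U functional.
Proof. by apply: (@Ck_on_linear _ _ k U functional_lin); exact: functional_continuous. Qed.

Lemma derive_functional z v : 'D_v functional z = functional v.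
Proof. by apply: (@derive_linear _ functional_lin); exact: functional_continuous. Qed.

End Functional.

Lemma cx_functional j i : cx j i =
  functional (\row_q (q == (off j + i)%N :> nat)%:R) 0.
Proof.
apply/funext => z; rewrite /cx /getv /functional; apply: eq_bigr => q _.
by rewrite !mxE mulr0 addr0 mulr_natr.
Qed.

Lemma cy_functional j i : cy j i =
  functional 0 (\row_q (q == (off j + i)%N :> nat)%:R).
Proof.
apply/funext => z; rewrite /cy /getv /functional; apply: eq_bigr => q _.
by rewrite !mxE mulr0 add0r mulr_natr.
Qed.

Lemma Ck_on_cx k (U : set Z) j i : Ck_on k U (cx j i).
Proof. rewrite cx_functional; exact: Ck_on_functional. Qed.

Lemma Ck_on_cy k (U : set Z) j i : Ck_on k U (cy j i).
Proof. rewrite cy_functional; exact: Ck_on_functional. Qed.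

Lemma derive_cx j i z v : 'D_v (cx j i) z = cx j i v.
Proof. rewrite cx_functional; exact: derive_functional. Qed.

Lemma derive_cy j i z v : 'D_v (cy j i) z = cy j i v.
Proof. rewrite cy_functional; exact: derive_functional. Qed.

Lemma std_ball_sum (a : R) z : std_ball a z =
  (pi * (\sum_(0 <= j < m) \sum_(0 <= i < j./2) ss j i z) < a) :> Prop.
Proof. by rewrite /std_ball /= (sum_getv (fun x y => x ^+ 2 + y ^+ 2)). Qed.

Lemma Ck_on_ss k (U : set Z) j i : open U -> Ck_on k U (ss j i).
Proof.
by move=> oU; apply: Ck_onD => //; apply: Ck_on_sqr => //; [exact: Ck_on_cx|exact: Ck_on_cy].
Qed.

Lemma open_std_ball (a : R) : open (@std_ball R (off m) a).
Proof.
pose q z := pi * (\sum_(0 <= j < m) \sum_(0 <= i < j./2) ss j i z).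
have -> : @std_ball R (off m) a = q @^-1` [set x | x < a].
  by apply/seteqP; split=> z /=; rewrite -std_ball_sum.
apply: open_comp; last exact: open_lt.
move=> z _; have oT : open (@setT Z) by exact: openT.
have : Ck_on 0 setT q.
  apply: Ck_onM => //; first exact: Ck_on_const.
  by apply: Ck_on_sum => // j _; apply: Ck_on_sum => // i _; exact: Ck_on_ss.
by apply.
Qed.

Lemma Ck_on_mu (l : nat -> R) k (U : set Z) n i : open U -> Ck_on k U (mu l n i).
Proof.
move=> oU; apply: Ck_onB => //; first exact: Ck_on_const.
apply: Ck_onM => //; first exact: Ck_on_const.
by apply: Ck_on_sum => // j _; exact: Ck_on_ss.
Qed.

(** Besides w_(j,i) != 0 the Cauchy form needs mu_(j,i) != 0, because it divides by mu_i. In the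
    last step for odd m this entry may vanish inside the ball. *)
Definition generic (l : nat -> R) j z : Prop :=
  forall i, (i < j./2)%N -> 0 < ss j i z /\ mu l j i z != 0.

Let e1 : Z := (const_mx 1, const_mx 1).

Let idx_lt j i : (j < m)%N -> (i < j./2)%N -> (off j + i < off m)%N.
Proof.
move=> jm ij; apply: leq_trans (_ : off j.+1 <= _)%N; first by rewrite offS ltn_add2l.
by rewrite /off [in X in (_ <= X)%N](@big_cat_nat _ _ _ j.+1)//= leq_addr.
Qed.

Let cxe j i z t : (j < m)%N -> (i < j./2)%N -> cx j i (z + t *: e1) = cx j i z + t.
Proof.
move=> jm ij; rewrite /cx -[(off j + i)%N]/(val (Ordinal (idx_lt jm ij))) !getvE.
by rewrite !mxE mulr1.
Qed.

Let cye j i z t : (j < m)%N -> (i < j./2)%N -> cy j i (z + t *: e1) = cy j i z + t.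
Proof.
move=> jm ij; rewrite /cy -[(off j + i)%N]/(val (Ordinal (idx_lt jm ij))) !getvE.
by rewrite !mxE mulr1.
Qed.

Let sspoly j i z : {poly R} := ('X + (cx j i z)%:P) ^+ 2 + ('X + (cy j i z)%:P) ^+ 2.

Let sspolyE j i z t : (j < m)%N -> (i < j./2)%N ->
  (sspoly j i z).[t] = ss j i (z + t *: e1).
Proof. by move=> jm ij; rewrite /ss cxe// cye// !hornerE ![t + _]addrC. Qed.

(** Along the diagonal line z + t e1 all quantities to avoid are polynomials in t. It suffices that
    none of them is identically zero, and for this one value of t is exhibited. *)
Lemma generic_near (l : nat -> R) j z : (j < m)%N ->
  \forall t \near 0^', generic l j (z + t *: e1).
Proof.
move=> jm.
suff : \forall t \near 0^', forall i : 'I_(j./2),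
    0 < ss j i (z + t *: e1) /\ mu l j i (z + t *: e1) != 0.
  by apply: filterS => t H i ij; exact: (H (Ordinal ij)).
apply: filter_forall => i; have ij := ltn_ord i.
pose q : {poly R} := (l i)%:P - pi *: \sum_(j <= k < m | (i < k./2)%N) sspoly k i z.
have qE t : q.[t] = mu l j i (z + t *: e1).
  rewrite /q /mu hornerD hornerN hornerZ hornerC horner_sum.
  congr (_ - _ * _); rewrite big_seq_cond [RHS]big_seq_cond; apply: eq_bigr => k.
  by rewrite mem_index_iota => /andP[/andP[_ km] ik]; rewrite sspolyE.
have s0 : sspoly j i z != 0.
  apply/eqP => /(congr1 (fun p => p.[1 - cx j i z])).
  rewrite sspolyE// horner0 /ss cxe// (addrC (cx j i z)) subrK expr1n => E.
  have : 0 < 1 + cy j i (z + (1 - cx j i z) *: e1) ^+ 2 by rewrite ltr_wpDr// sqr_ge0.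
  by rewrite E ltxx.
have q0 : q != 0.
  (* At this t the coordinate [cx j i] equals 1 + |l i|, so the subtracted sum exceeds |l i| and mu
     cannot be 0. *)
  pose t := 1 + `|l i| - cx j i z.
  apply/eqP => /(congr1 (fun p => p.[t])); rewrite qE horner0 /mu big_ltn_cond// ij => /eqP.
  rewrite subr_eq0 => /eqP E; have := ler_norm (l i); rewrite {1}E leNgt => /negP; apply.
  set w := z + t *: e1.
  apply: (@lt_le_trans _ _ (1 * (1 + `|l i|) ^+ 2)).
    rewrite mul1r sqrrD expr1n mul1r; have := normr_ge0 (l i); have := sqr_ge0 `|l i|; lra.
  apply: ler_pM => //.
    by apply: le_trans (pi_ge2 R); rewrite ler1n.
  rewrite -[leLHS]addr0 lerD// ?sumr_ge0// => [|k _]; last exact: ss_ge0.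
  by rewrite /ss cxe// /t (addrC (cx j i z)) subrK lerDl sqr_ge0.
have := poly_near_neq0 s0; have := poly_near_neq0 q0.
apply: filterS2 => t; rewrite qE sspolyE// => ? sN; split=> //.
by rewrite lt_neqAle eq_sym sN ss_ge0.
Qed.

Lemma generic_dense (l : nat -> R) j (W : normedModType R) (U : set Z) (f g : Z -> W) z :
  (j < m)%N -> open U -> U z ->
  {for z, continuous f} -> {for z, continuous g} ->
  (forall y, U y -> generic l j y -> f y = g y) -> f z = g z.
Proof.
move=> jm oU Uz cf cg fg.
have c0 : (fun t : R => z + t *: e1) t @[t --> 0] --> z.
  rewrite -[z in _ --> z]addr0 -(scale0r e1).
  by apply: cvgD; [exact: cvg_cst|apply: cvgZr_tmp; exact: cvg_id].
have c0' : (fun t : R => z + t *: e1) t @[t --> 0^'] --> z.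
  by move=> A /c0; exact: nbhs_dnbhs.
have cf0 : f (z + t *: e1) @[t --> 0^'] --> f z by apply: cvg_comp c0' cf.
have cg0 : g (z + t *: e1) @[t --> 0^'] --> g z by apply: cvg_comp c0' cg.
have E : \forall t \near 0^', g (z + t *: e1) = f (z + t *: e1).
  have nU : \forall t \near 0^', U (z + t *: e1).
    by apply: c0'; exact: open_nbhs_nbhs.
  apply: filterS2 nU (generic_near l z jm) => t Ut gt; by rewrite fg.
have cf1 : f (z + t *: e1) @[t --> 0^'] --> g z.
  by apply: cvg_trans cg0; apply: near_eq_cvg.
exact: cvg_unique cf0 cf1.
Qed.

End ParameterSpace.

(** * One step at a generic point *)

Section CornerStep.
Context {R : realType} {m r : nat}.
Variables (U V : 'M[R]_(m, r.+1)) (b : bool) (lam mu x y : 'I_r.+1 -> R).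
Variable I : 'I_r.+1 -> R.
Hypothesis I0 : I ord0 = b%:R.
Hypothesis I1 : forall i, i != ord0 -> I i = 1.
Hypothesis UU : U^T *m U = dg I.
Hypothesis VV : V^T *m V = 1%:M.
Hypothesis UV : U^T *m V = 0.
Hypothesis UI : U *m dg I = U.
Hypothesis x0 : x ord0 = 1.
Hypothesis y0 : y ord0 = 0.
Let s i := x i ^+ 2 + y i ^+ 2.

Definition corner_col : 'cV[R]_m := rotU U V x y *m \col_i pco b lam mu i.
Definition corner : 'M[R]_m :=
  torus U V mu + (col ord0 V *m corner_col^T - corner_col *m (col ord0 V)^T).
Definition corner_step : 'M[R]_m :=
  stepmx U V (Cco b lam mu) (Nco b lam mu) (eco b lam mu) x y.

Hypothesis IL : interlacing b lam mu.
Hypothesis s_gt0 : forall i, i != ord0 -> 0 < s i.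
Hypothesis lam_mu : forall i, i != ord0 -> lam i - mu i = pi * s i.
Hypothesis mu_neq0 : forall i, i != ord0 -> mu i != 0.

Let rho (i : 'I_r.+1) : R := if i == ord0 then 1 else Num.sqrt (s i).
Let xh i := x i / rho i.
Let yh i := y i / rho i.

Let rho_neq0 i : rho i != 0.
Proof.
rewrite /rho; case: (eqVneq i ord0) => [_|i0]; first exact: oner_neq0.
by rewrite gt_eqF// sqrtr_gt0 s_gt0.
Qed.

Let xE : x = fun i => rho i * xh i.
Proof. by apply/funext => i; rewrite /xh mulrC divfK ?rho_neq0. Qed.

Let yE : y = fun i => rho i * yh i.
Proof. by apply/funext => i; rewrite /yh mulrC divfK ?rho_neq0. Qed.

Let xy1 i : xh i ^+ 2 + yh i ^+ 2 = 1.
Proof.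
rewrite /xh /yh !expr_div_n -mulrDl /rho; case: eqVneq => [->|i0].
  by rewrite x0 y0 !expr1n expr0n addr0 divr1.
by rewrite sqr_sqrtr ?divff ?gt_eqF ?s_gt0// ltW// s_gt0.
Qed.

Let yI i : yh i * I i = yh i.
Proof. case: (eqVneq i ord0) => [->|i0]; last by rewrite I1// mulr1.
by rewrite /yh y0 !mul0r. Qed.

Let CI : (dg rho *m Cco b lam mu *m dg rho + dg (eco b lam mu)) *m dg I =
  dg I *m (dg rho *m Cco b lam mu *m dg rho + dg (eco b lam mu)).
Proof.
apply/matrixP => i j; rewrite mulmx_dgE !(mul_diag_mx, mul_mx_diag) !mxE /pco.
case: (eqVneq i j) => [->|ij]; first by rewrite mulrC.
rewrite !mulr0n !addr0; case: (eqVneq i ord0) => i0; case: (eqVneq j ord0) => j0.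
- by rewrite i0 j0 eqxx in ij.
- rewrite i0 I0 I1//; case: ifP => _; rewrite ?mulr1 ?mul1r// !(mul0r, mulr0)//.
- rewrite j0 I0 I1//; case: ifP => _; rewrite ?mulr1 ?mul1r// !(mul0r, mulr0)//.
- by rewrite !I1// mulr1 mul1r.
Qed.

Lemma corner_step_orth : corner_step^T *m corner_step = 1%:M.
Proof.
rewrite /corner_step xE yE.
apply: (stepmx_orth UU VV UV UI erefl xy1 yI erefl erefl CI).
  exact: (Cco_orth IL s_gt0 lam_mu mu_neq0).
exact: (Nco_orth IL s_gt0 lam_mu mu_neq0).
Qed.

(** Rotating the frames leaves [torus mu] unchanged and turns the border into rho_i p_i, so the
    corner becomes the skew matrix built from [bordered] in the normalised frames. *)
Let cornerE : corner =
  rotV U V xh yh *m (bordered mu (fun i => rho i * pco b lam mu i))^T *m (rotU U V xh yh)^T -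
  rotU U V xh yh *m bordered mu (fun i => rho i * pco b lam mu i) *m (rotV U V xh yh)^T.
Proof.
set p := fun i => rho i * pco b lam mu i.
have M : bordered mu p = dg mu + (\col_i p i) *m (delta_mx 0 ord0 : 'rV_r.+1).
  apply/matrixP => i j; rewrite mx_addE dgE [in RHS]mxE big_ord1 !mxE eqxx /=.
  case: (eqVneq j ord0) => [->|j0]; last by rewrite mulr0 addr0.
  rewrite mulr1; case: (eqVneq i ord0) => [->|i0]; last by rewrite mulr0n add0r.
  by rewrite (il_mu0 IL) mulr1n add0r.
have V0 : rotV U V xh yh *m (delta_mx 0 ord0 : 'rV_r.+1)^T = col ord0 V.
  rewrite trmx_delta -colE; apply/matrixP => a c; rewrite !mxE.
  by rewrite /xh /yh /rho eqxx x0 y0 mul0r mulr0 subr0 divr1 mulr1.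
have wE : rotU U V xh yh *m (\col_i p i) = corner_col.
  have -> : \col_i p i = dg rho *m \col_i pco b lam mu i.
    by apply/matrixP => i c; rewrite mul_diag_mx !mxE.
  by rewrite mulmxA rotU_scale /corner_col -xE -yE.
rewrite /corner -wE -V0 -(rot_torus U V xy1 mu) M linearD /= tr_dg !trmx_mul !trmxK.
by rewrite !(mulmxDr, mulmxDl) !mulmxA opprD addrACA.
Qed.

Lemma corner_step_intertwine : corner_step *m torus U V lam = corner *m corner_step.
Proof.
have := stepmx_intertwine UU VV UV UI erefl xy1 yI erefl erefl CI
  (bordered_Nco IL s_gt0 lam_mu mu_neq0) (bordered_Cco IL s_gt0 lam_mu mu_neq0).
by rewrite -xE -yE -cornerE.
Qed.

Variables (xd yd de : 'I_r.+1 -> R) (dC dN : 'M[R]_r.+1).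
Hypothesis xd0 : xd ord0 = 0.
Hypothesis yd0 : yd ord0 = 0.

Definition corner_variation : 'M[R]_m :=
  let C := Cco b lam mu in let N := Nco b lam mu in
  let u := rotU U V x y in let v := rotV U V x y in
  let du := rotU U V xd yd in let dv := rotV U V xd yd in
  du *m C *m u^T + u *m dC *m u^T + u *m C *m du^T +
  (dv *m N *m v^T + v *m dN *m v^T + v *m N *m dv^T) +
  (U *m dg de *m U^T + V *m dg de *m V^T).

Let trace_torus c d : \tr (torus U V c *m torus U V d) =
  - 2 * \sum_i c i * d i * I i.
Proof.
have VU : V^T *m U = 0 by rewrite -[U]trmxK -trmx_mul UV trmx0.
have tr2 (P Q : 'M[R]_(m, r.+1)) : P^T *m P = dg I -> Q^T *m Q = 1%:M ->
    \tr (Q *m dg c *m P^T *m (P *m dg d *m Q^T)) = \sum_i c i * d i * I i.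
  move=> PP QQ; rewrite -!mulmxA mxtrace_mulC !mulmxA -!mulmxA QQ mulmx1.
  rewrite (mulmxA P^T) PP !dgM mxtrace_diag.
  by apply: eq_bigr => i _; rewrite mxE; ring.
have tr2' (P Q : 'M[R]_(m, r.+1)) : P^T *m P = dg I -> Q^T *m Q = 1%:M ->
    \tr (P *m dg c *m Q^T *m (Q *m dg d *m P^T)) = \sum_i c i * d i * I i.
  move=> PP QQ; rewrite -!mulmxA mxtrace_mulC !mulmxA -!mulmxA PP.
  rewrite (mulmxA Q^T) QQ mul1mx !dgM mxtrace_diag.
  by apply: eq_bigr => i _; rewrite mxE; ring.
have z1 (P Q A B: 'M[R]_(m, r.+1)) : P^T *m Q = 0 -> 
    A *m dg c *m P^T *m (Q *m dg d *m B^T) = 0.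
  by move=> PQ; rewrite -!mulmxA (mulmxA P^T) PQ !(mul0mx, mulmx0).
rewrite /torus mulmxBl !mulmxBr (z1 U V V U UV) (z1 V U U V VU) sub0r subr0.
by rewrite raddfB raddfN /= tr2// tr2'//; ring.
Qed.

(** The trace reduces to 2 sum (lam_i - mu_i) t_i, where t_i = (x_i dy_i - y_i dx_i) / |w_i|^2 is
    the angular velocity. The choice lam_i - mu_i = pi |w_i|^2 cancels the denominator. *)
Lemma trace_corner_variation :
  \tr (torus U V lam *m corner_step^T *m corner_variation) =
  2 * pi * \sum_(i | i != ord0) (x i * yd i - y i * xd i).
Proof.
pose t i := if i == ord0 then 0 else (x i * yd i - y i * xd i) / s i.
pose rd i := if i == ord0 then 0 else (x i * xd i + y i * yd i) / s i.
have tI i : t i * I i = t i.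
  by rewrite /t; case: (eqVneq i ord0) => i0; rewrite ?mul0r// I1// mulr1.
have xdE : xd = fun i => rd i * (rho i * xh i) - t i * (rho i * yh i).
  apply/funext => i; rewrite -[rho i * xh i]/((fun i => rho i * xh i) i) -xE.
  rewrite -[rho i * yh i]/((fun i => rho i * yh i) i) -yE /rd /t.
  case: (eqVneq i ord0) => [->|i0]; first by rewrite xd0 !mul0r subr0.
  have si : s i != 0 by rewrite gt_eqF// s_gt0.
  by rewrite /s in si *; field.
have ydE : yd = fun i => rd i * (rho i * yh i) + t i * (rho i * xh i).
  apply/funext => i; rewrite -[rho i * xh i]/((fun i => rho i * xh i) i) -xE.
  rewrite -[rho i * yh i]/((fun i => rho i * yh i) i) -yE /rd /t.
  case: (eqVneq i ord0) => [->|i0]; first by rewrite yd0 !mul0r addr0.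
  have si : s i != 0 by rewrite gt_eqF// s_gt0.
  by rewrite /s in si *; field.
have := trace_step_variation UU VV UV UI erefl xy1 yI dC dN de rd tI
  (rho := rho) (C := Cco b lam mu) (N := Nco b lam mu) (e := eco b lam mu) (lam := lam) (S := corner).
rewrite /step_variation -xdE -ydE -xE -yE => /(_ corner_step_orth corner_step_intertwine).
rewrite -/corner_step => ->.
(* The border involves the basis vector col 0 V, which [torus t] annihilates because t_0 = 0. *)
have border : \tr ((col ord0 V *m corner_col^T - corner_col *m (col ord0 V)^T) *m torus U V t) = 0.
  have Vt : (col ord0 V)^T *m torus U V t = 0.
    rewrite colE trmx_mul /torus mulmxBr -!mulmxA !(mulmxA V^T) VV.
    rewrite (_ : V^T *m U = 0) ?mul0mx ?mulmx0 ?subr0 ?mul1mx; last first.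
      by rewrite -[U]trmxK -trmx_mul UV trmx0.
    rewrite mulmxA (_ : _ *m dg t = 0) ?mul0mx//.
    apply/matrixP => i k; rewrite mul_mx_diag !mxE.
    by case: (eqVneq k ord0) => [->|]; rewrite ?mul0r// /t eqxx mulr0.
  rewrite mulmxBl -!mulmxA Vt !mulmx0 subr0 -mxtrace_tr !trmx_mul tr_torus trmxK.
  by rewrite mxtrace_mulC mulNmx mulmxN mulmxA Vt mul0mx oppr0 mxtrace0.
rewrite /corner mulmxDl linearD /= border addr0 !trace_torus -mulrBr -sumrB.
rewrite (bigD1 ord0)//= [t ord0](_ : _ = 0) ?mulr0 ?mul0r; last by rewrite /t eqxx.
rewrite subrr add0r -mulrA mulNr -mulrN -sumrN [in RHS]mulr_sumr; congr (2 * _).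
apply: eq_bigr => i i0; rewrite -!mulrA tI opprB -mulrBl lam_mu// /t (negPf i0).
by rewrite -mulrA; congr (pi * _); rewrite mulrC divfK// gt_eqF// s_gt0.
Qed.

End CornerStep.

(** * One step on the whole ball *)

Section DeriveStep.
Context {R : realType} {Z : normedModType R} {m n : nat}.
Variables (U W : 'M[R]_(m, n)).
Variables (C N : Z -> 'M[R]_n) (e x y : Z -> 'I_n -> R) (z v : Z).
Hypothesis dC : derivable C z v.
Hypothesis dN : derivable N z v.
Hypothesis de : forall i, derivable (e^~ i) z v.
Hypothesis dx : forall i, derivable (x^~ i) z v.
Hypothesis dy : forall i, derivable (y^~ i) z v.

Let is_derive_mx p q (f : Z -> 'M[R]_(p, q)) (df : 'M[R]_(p, q)) :
  (forall i j, is_derive z v (fun z => f z i j) (df i j)) -> is_derive z v f df.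
Proof.
move=> H; have d : derivable f z v by apply/derivable_mxP => i j; case: (H i j).
split=> //; apply/matrixP => i j; rewrite -derive_entry//; exact: derive_val.
Qed.

Let is_derive_mulmx p q r (f : Z -> 'M[R]_(p, q)) (g : Z -> 'M[R]_(q, r)) df dg :
  is_derive z v f df -> is_derive z v g dg ->
  is_derive z v (fun z => f z *m g z) (df *m g z + f z *m dg).
Proof.
case=> df1 <- [dg1 <-]; split; first exact: derivable_mulmx.
exact: derive_mulmx.
Qed.

Let is_derive_trmx p q (f : Z -> 'M[R]_(p, q)) df :
  is_derive z v f df -> is_derive z v (fun z => (f z)^T) df^T.
Proof. by case=> df1 <-; split; [exact: derivable_trmx|exact: derive_trmx]. Qed.

Let is_derive_rotU : is_derive z v (fun z => rotU U W (x z) (y z))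
  (rotU U W (fun i => 'D_v (x^~ i) z) (fun i => 'D_v (y^~ i) z)).
Proof.
apply: is_derive_mx => b i; rewrite mxE.
have -> : (fun z => rotU U W (x z) (y z) b i) = (U b i *: x^~ i + W b i *: y^~ i).
  by apply/funext => t; rewrite mxE.
apply: is_deriveD; apply: is_deriveZ; exact/derivableP.
Qed.

Let is_derive_rotV : is_derive z v (fun z => rotV U W (x z) (y z))
  (rotV U W (fun i => 'D_v (x^~ i) z) (fun i => 'D_v (y^~ i) z)).
Proof.
apply: is_derive_mx => b i; rewrite mxE.
have -> : (fun z => rotV U W (x z) (y z) b i) = (W b i *: x^~ i - U b i *: y^~ i).
  by apply/funext => t; rewrite mxE.
apply: is_deriveB; apply: is_deriveZ; exact/derivableP.
Qed.

Let is_derive_dg : is_derive z v (fun z => dg (e z)) (dg (fun i => 'D_v (e^~ i) z)).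
Proof.
apply: is_derive_mx => b i; rewrite dgE -scaler_nat.
have -> : (fun z => dg (e z) b i) = ((b == i)%:R : R) *: e^~ b.
  by apply/funext => t; rewrite dgE -scaler_nat.
apply: is_deriveZ; exact/derivableP.
Qed.

Lemma derive_stepmx : 'D_v (fun z => stepmx U W (C z) (N z) (e z) (x z) (y z)) z =
  let u := rotU U W (x z) (y z) in let w := rotV U W (x z) (y z) in
  let du := rotU U W (fun i => 'D_v (x^~ i) z) (fun i => 'D_v (y^~ i) z) in
  let dw := rotV U W (fun i => 'D_v (x^~ i) z) (fun i => 'D_v (y^~ i) z) in
  du *m C z *m u^T + u *m 'D_v C z *m u^T + u *m C z *m du^T +
  (dw *m N z *m w^T + w *m 'D_v N z *m w^T + w *m N z *m dw^T) +
  (U *m dg (fun i => 'D_v (e^~ i) z) *m U^T + W *m dg (fun i => 'D_v (e^~ i) z) *m W^T).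
Proof.
have hU : is_derive z v (fun=> U) 0 by exact: is_derive_cst.
have hW : is_derive z v (fun=> W) 0 by exact: is_derive_cst.
have hUT : is_derive z v (fun=> U^T) 0 by exact: is_derive_cst.
have hWT : is_derive z v (fun=> W^T) 0 by exact: is_derive_cst.
have hC : is_derive z v C ('D_v C z) by exact/derivableP.
have hN : is_derive z v N ('D_v N z) by exact/derivableP.
have h1 := is_derive_mulmx (is_derive_mulmx is_derive_rotU hC) (is_derive_trmx is_derive_rotU).
have h2 := is_derive_mulmx (is_derive_mulmx is_derive_rotV hN) (is_derive_trmx is_derive_rotV).
have h3 := is_derive_mulmx (is_derive_mulmx hU is_derive_dg) hUT.
have h4 := is_derive_mulmx (is_derive_mulmx hW is_derive_dg) hWT.
have h5 : is_derive z v (fun=> 1%:M - U *m U^T - W *m W^T) 0 by exact: is_derive_cst.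
have := is_deriveD (is_deriveD (is_deriveD h1 h2) (is_deriveD h3 h4)) h5.
case=> _ /= E; apply: etrans E _.
by rewrite !mul0mx !mulmx0 !add0r !addr0 !mulmxDl.
Qed.

End DeriveStep.

Section Pattern.
Context {R : realType} (m : nat) (l : nat -> R).
Notation Z := (@param R m).
Implicit Types (z v : Z).

Definition hstep j z : 'M[R]_m :=
  corner_step (UF m j) (VF m j) (odd j) (lamf l z) (muf l z) (xf z) (yf z).

Definition Tk k z : 'M[R]_m := tmx m k (fun i => mu l k i z).

Definition Sk j z : 'M[R]_m :=
  corner (UF m j) (VF m j) (odd j) (lamf l z) (muf l z) (xf z) (yf z).

Lemma torus_lamf j z : (j < m)%N -> torus (UF m j) (VF m j) (lamf l z) = Tk j.+1 z.
Proof.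
move=> jm; apply: torus_upper => //; first by rewrite /lamf /= => ->.
Qed.

Lemma torus_muf j z : (j < m)%N -> torus (UF m j) (VF m j) (muf l z) = Tk j z.
Proof. by move=> jm; apply: torus_lower. Qed.

Lemma Ck_on_lamf k (A : set Z) j i : open A -> Ck_on k A (fun z => @lamf R m l j z i).
Proof.
move=> oA; rewrite /lamf; case: i => -[|i] ij /=; last exact: Ck_on_mu.
by case: (odd j); [exact: Ck_on_mu|exact: Ck_on_const].
Qed.

Lemma Ck_on_muf k (A : set Z) j i : open A -> Ck_on k A (fun z => @muf R m l j z i).
Proof.
move=> oA; rewrite /muf; case: i => -[|i] ij /=; last exact: Ck_on_mu.
exact: Ck_on_const.
Qed.

Lemma Ck_on_xf k (A : set Z) j i : Ck_on k A (fun z => @xf R m j z i).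
Proof.
rewrite /xf; case: i => -[|i] ij /=; [exact: Ck_on_const|exact: Ck_on_cx].
Qed.

Lemma Ck_on_yf k (A : set Z) j i : Ck_on k A (fun z => @yf R m j z i).
Proof.
rewrite /yf; case: i => -[|i] ij /=; [exact: Ck_on_const|exact: Ck_on_cy].
Qed.

Variable a : R.
Hypothesis a0 : 0 < a.
Hypothesis l_diff : forall i i', (i < i')%N -> (i' < m./2)%N -> a <= l i - l i'.
Hypothesis l_sum : forall i i', (i < i')%N -> (i' < m./2)%N -> a <= l i + l i'.
Hypothesis l_last : odd m -> forall i, (i < m./2)%N -> a <= 2 * l i.
Let B : set Z := @std_ball R (off m) a.

Let oB : open B. Proof. exact: open_std_ball. Qed.

Section FixedStep.
Variable j : nat.
Hypothesis jm : (j < m)%N.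

Let IL z : B z -> interlacing (odd j) (@lamf R m l j z) (muf l z).
Proof. by move=> Bz; apply: (interlacing_step l_diff l_sum l_last a0 Bz jm). Qed.

Lemma Ck_on_hstep k : Ck_on k B (hstep j).
Proof.
apply: Ck_on_stepmx => //.
- by move=> i; apply: Ck_on_lamf.
- by move=> i; apply: Ck_on_muf.
- by move=> i; apply: Ck_on_xf.
- by move=> i; apply: Ck_on_yf.
Qed.

Lemma Ck_on_Tk k i : Ck_on k B (Tk i).
Proof.
apply: Ck_on_mx => // c d.
have C : Ck_on k B (fun z => \sum_(0 <= p < i./2) mu l i p z *
    (((c == p.*2.+1 :> nat) && (d == p.*2 :> nat))%:R -
     ((c == p.*2 :> nat) && (d == p.*2.+1 :> nat))%:R)).
  apply: Ck_on_sum => // p _; apply: Ck_onM => //; first exact: Ck_on_mu.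
  exact: Ck_on_const.
by apply: Ck_on_eq C => // z _; rewrite mxE.
Qed.

Lemma Ck_on_Sk k : Ck_on k B (Sk j).
Proof.
have C : Ck_on k B (fun z => corner_col (UF m j) (VF m j) (odd j) (lamf l z) (muf l z) (xf z) (yf z)).
  apply: Ck_on_mulmx => //.
    by apply: Ck_on_rotU => // i; [exact: Ck_on_xf|exact: Ck_on_yf].
  apply: Ck_on_mx => // c d.
  have P : Ck_on k B (fun z => pco (odd j) (lamf l z) (muf l z) c).
    by apply: Ck_on_pco => // i; [exact: Ck_on_lamf|exact: Ck_on_muf].
  by apply: Ck_on_eq P => // z _; rewrite mxE.
apply: Ck_onD => //.
  by apply: Ck_on_eq (Ck_on_Tk k j) => // z _; rewrite -torus_muf.
have V0 : Ck_on k B (fun=> col ord0 (VF m j)) by exact: Ck_on_cst.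
have V0T : Ck_on k B (fun=> (col ord0 (VF m j))^T) by exact: Ck_on_cst.
apply: (@Ck_on_eq _ _ _ _ _ (fun z => col ord0 (VF m j) *m (corner_col (UF m j) (VF m j)
    (odd j) (lamf l z) (muf l z) (xf z) (yf z))^T +
    corner_col (UF m j) (VF m j) (odd j) (lamf l z) (muf l z) (xf z) (yf z) *m
    - (col ord0 (VF m j))^T)) => //; first by move=> z _; rewrite mulmxN.
apply: Ck_onD => //; apply: Ck_on_mulmx => //; first exact: Ck_on_trmx.
exact: Ck_on_cst.
Qed.

Let I0 : @IF R j ord0 = (odd j)%:R. Proof. by []. Qed.
Let I1 i : i != ord0 -> @IF R j i = 1.
Proof. by case: i => -[|i] ij. Qed.
Let x0 z : @xf R m j z ord0 = 1. Proof. by []. Qed.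
Let y0 z : @yf R m j z ord0 = 0. Proof. by []. Qed.

Let s_gt0 z : generic l j z ->
  forall i, i != ord0 -> 0 < @xf R m j z i ^+ 2 + @yf R m j z i ^+ 2.
Proof. by move=> g; case=> -[|i] // ij _; case: (g i). Qed.

Let lam_mu z : forall i, i != ord0 ->
  @lamf R m l j z i - muf l z i = pi * (@xf R m j z i ^+ 2 + @yf R m j z i ^+ 2).
Proof. by case=> -[|i] // ij _; rewrite /lamf /muf /= mu_step. Qed.

Let mu_neq0 z : generic l j z -> forall i, i != ord0 -> @muf R m l j z i != 0.
Proof. by move=> g; case=> -[|i] // ij _; case: (g i). Qed.

Let UU := @UF_orth R _ _ jm.
Let VV := @VF_orth R _ _ jm.
Let UV := @UF_VF R _ _ jm.
Let UI := @UF_IF R m j.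

Let dense (W : normedModType R) (f g : Z -> W) : Ck_on 0 B f -> Ck_on 0 B g ->
  (forall y, B y -> generic l j y -> f y = g y) -> forall z, B z -> f z = g z.
Proof.
move=> Cf Cg fg z Bz.
exact: (@generic_dense R m l j W B f g z jm oB Bz (Cf z Bz) (Cg z Bz) fg).
Qed.

Let Chh k : Ck_on k B (fun z => (hstep j z)^T *m hstep j z).
Proof.
by apply: Ck_on_mulmx => //; [apply: Ck_on_trmx => //|]; exact: Ck_on_hstep.
Qed.

Let ChT k : Ck_on k B (fun z => hstep j z *m Tk j.+1 z).
Proof. by apply: Ck_on_mulmx => //; [exact: Ck_on_hstep|exact: Ck_on_Tk]. Qed.

Let CSh k : Ck_on k B (fun z => Sk j z *m hstep j z).
Proof. by apply: Ck_on_mulmx => //; [exact: Ck_on_Sk|exact: Ck_on_hstep]. Qed.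

Lemma hstep_orth z : B z -> (hstep j z)^T *m hstep j z = 1%:M.
Proof.
move: z; apply: (@dense _ (fun z => (hstep j z)^T *m hstep j z) (fun=> 1%:M)).
- exact: Chh.
- exact: Ck_on_cst.
- move=> y By gy; rewrite /=.
  exact: (corner_step_orth I0 I1 UU VV UV UI (x0 y) (y0 y) (IL By) (s_gt0 gy) (lam_mu y) (mu_neq0 gy)).
Qed.

Lemma hstep_intertwine z : B z -> hstep j z *m Tk j.+1 z = Sk j z *m hstep j z.
Proof.
move: z; apply: (@dense _ (fun z => hstep j z *m Tk j.+1 z)
  (fun z => Sk j z *m hstep j z)).
- exact: ChT.
- exact: CSh.
- move=> y By gy; rewrite -torus_lamf//.
  exact: (corner_step_intertwine I0 I1 UU VV UV UI (x0 y) (y0 y) (IL By) (s_gt0 gy) (lam_mu y) (mu_neq0 gy)).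
Qed.

Let CC k : Ck_on k B (fun z => Cco (odd j) (@lamf R m l j z) (muf l z)).
Proof. by apply: Ck_on_Cco => // i; [exact: Ck_on_lamf|exact: Ck_on_muf]. Qed.
Let CN k : Ck_on k B (fun z => Nco (odd j) (@lamf R m l j z) (muf l z)).
Proof. by apply: Ck_on_Nco => // i; [exact: Ck_on_lamf|exact: Ck_on_muf]. Qed.
Let Ce k i : Ck_on k B (fun z => eco (odd j) (@lamf R m l j z) (muf l z) i).
Proof. by apply: Ck_on_eco => // d; [exact: Ck_on_lamf|exact: Ck_on_muf]. Qed.

Let derive_xf z v i : 'D_v (fun z => @xf R m j z i) z = if (i : nat) is i'.+1 then cx j i' v else 0.
Proof.
rewrite /xf; case: i => -[|i] ij /=; last exact: derive_cx.
exact: derive_cst.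
Qed.

Let derive_yf z v i : 'D_v (fun z => @yf R m j z i) z = if (i : nat) is i'.+1 then cy j i' v else 0.
Proof.
rewrite /yf; case: i => -[|i] ij /=; last exact: derive_cy.
exact: derive_cst.
Qed.

Let Ctr k v : Ck_on k B (fun z => \tr (Tk j.+1 z *m (hstep j z)^T *m 'D_v (hstep j) z)).
Proof.
have C : Ck_on k B (fun z => Tk j.+1 z *m (hstep j z)^T *m 'D_v (hstep j) z).
  apply: Ck_on_mulmx => //; last exact: (Ck_on_hstep k.+1).2.
  by apply: Ck_on_mulmx => //; [exact: Ck_on_Tk|apply: Ck_on_trmx => //; exact: Ck_on_hstep].
by apply: Ck_on_sum => // i _; exact: Ck_on_entry.
Qed.

Let Cform k v : Ck_on k B (fun z =>
  2 * pi * \sum_(0 <= i < j./2) (cx j i z * cy j i v - cy j i z * cx j i v)).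
Proof.
apply: Ck_onM => //; first exact: Ck_on_const.
apply: Ck_on_sum => // i _; apply: Ck_onD => //.
  by apply: Ck_onM => //; [exact: Ck_on_cx|exact: Ck_on_const].
by apply: Ck_onN => //; apply: Ck_onM => //; [exact: Ck_on_cy|exact: Ck_on_const].
Qed.

Lemma hstep_trace z v : B z ->
  \tr (Tk j.+1 z *m (hstep j z)^T *m 'D_v (hstep j) z) =
  2 * pi * \sum_(0 <= i < j./2) (cx j i z * cy j i v - cy j i z * cx j i v).
Proof.
move: z; apply: (@dense _ (fun z => \tr (Tk j.+1 z *m (hstep j z)^T *m 'D_v (hstep j) z) : R)
  (fun z => 2 * pi * \sum_(0 <= i < j./2) (cx j i z * cy j i v - cy j i z * cx j i v) : R)).
- exact: Ctr.
- exact: Cform.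
- move=> y By gy; rewrite /=.
  have D : 'D_v (hstep j) y = corner_variation (UF m j) (VF m j) (odd j) (lamf l y) (muf l y) (xf y) (yf y)
      (fun i => if (i : nat) is i'.+1 then cx j i' v else 0)
      (fun i => if (i : nat) is i'.+1 then cy j i' v else 0)
      (fun i => 'D_v (fun z => eco (odd j) (@lamf R m l j z) (muf l z) i) y)
      ('D_v (fun z => Cco (odd j) (@lamf R m l j z) (muf l z)) y)
      ('D_v (fun z => Nco (odd j) (@lamf R m l j z) (muf l z)) y).
    apply: etrans (derive_stepmx _ _ _ _ _ _ _) _.
    + exact: Ck_on_derivable (CC 1) By.
    + exact: Ck_on_derivable (CN 1) By.
    + by move=> i; exact: Ck_on_derivable (Ce 1 i) By.
    + by move=> i; exact: Ck_on_derivable (@Ck_on_xf 1 B j i) By.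
    + by move=> i; exact: Ck_on_derivable (@Ck_on_yf 1 B j i) By.
    rewrite /corner_variation.
    rewrite (funext (derive_xf y v)) (funext (derive_yf y v)).
    by [].
  rewrite D -torus_lamf//.
  rewrite (trace_corner_variation I0 I1 UU VV UV UI (x0 y) (y0 y) (IL By) (s_gt0 gy) (lam_mu y) (mu_neq0 gy))//.
  congr (_ * _); rewrite big_mkcond big_ord_recl/= add0r big_mkord.
  by apply: eq_bigr => i _; rewrite ?add0n.
Qed.

(** Both frames live in the first j + 1 coordinates, so h_j is the identity beyond. Consequently g_j
    fixes the basis vector of index j, and each step changes F only by a border. *)
Lemma hstep_fix b z (bm : (b < m)%N) : (j < b)%N ->
  hstep j z *m delta_mx (Ordinal bm) 0 = (delta_mx (Ordinal bm) 0 : 'cV_m).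
Proof.
move=> jb.
have U0 : (UF m j)^T *m delta_mx (Ordinal bm) 0 = (0 : 'cV[R]_(j./2).+1).
  by apply/matrixP => i c; rewrite -colE [LHS]mxE [LHS]mxE UF_row0// mxE.
have V0 : (VF m j)^T *m delta_mx (Ordinal bm) 0 = (0 : 'cV[R]_(j./2).+1).
  by apply/matrixP => i c; rewrite -colE [LHS]mxE [LHS]mxE VF_row0// mxE.
have rU x y : (rotU (UF m j) (VF m j) x y)^T *m delta_mx (Ordinal bm) 0 = (0 : 'cV[R]_(j./2).+1).
  apply/matrixP => i c; rewrite -colE [LHS]mxE [LHS]mxE [LHS]mxE UF_row0// VF_row0// !mul0r addr0.
  by rewrite mxE.
have rV x y : (rotV (UF m j) (VF m j) x y)^T *m delta_mx (Ordinal bm) 0 = (0 : 'cV[R]_(j./2).+1).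
  apply/matrixP => i c; rewrite -colE [LHS]mxE [LHS]mxE [LHS]mxE UF_row0// VF_row0// !mul0r subr0.
  by rewrite mxE.
rewrite /hstep /corner_step /stepmx !mulmxDl !mulNmx -!mulmxA rU rV U0 V0 !mulmx0 mul1mx.
by rewrite oppr0 !addr0 !add0r.
Qed.

Lemma hstep_zero : hstep j 0 = 1%:M.
Proof.
have cz (i : nat) : @cx R m j i (0 : Z) = 0 /\ @cy R m j i (0 : Z) = 0.
  by split; rewrite /cx /cy /getv big1// => q _; rewrite mxE mul0rn.
have B0 : B (0 : Z).
  rewrite /B /std_ball /= big1 ?mulr0// => i _.
  by rewrite !mxE expr0n addr0.
have ml i : i != ord0 -> @muf R m l j (0 : Z) i = lamf l (0 : Z) i.
  move=> i0; apply/esym/subr0_eq; apply: etrans (lam_mu 0 i0) _.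
  case: i i0 => -[|i] // ij _; rewrite /xf /yf /=.
  have [E1 E2] := cz i.
  by rewrite E1 E2 expr0n addr0 mulr0.
have oU : ~~ odd j -> forall a, UF m j a ord0 = 0 :> R by exact: UF_col0.
have Ex : @xf R m j (0 : Z) = fun i => if i == ord0 then 1 else 0.
  by apply/funext => -[[|i] ij] //; exact: (cz i).1.
have Ey : @yf R m j (0 : Z) = fun=> 0.
  by apply/funext => -[[|i] ij] //; exact: (cz i).2.
rewrite /hstep /corner_step Ex Ey.
exact: (stepmx_zero (VF m j) (IL B0) ml oU).
Qed.

End FixedStep.
End Pattern.

(** * Composition of the steps *)

Lemma derive_mxtrace {R : realType} {Z : normedModType R} n (f : Z -> 'M[R]_n) z v :
  derivable f z v -> 'D_v (fun z => \tr (f z)) z = \tr ('D_v f z).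
Proof.
move=> df; rewrite /mxtrace.
have -> : (fun z => \sum_i f z i i) = \sum_i (fun z => f z i i).
  by apply/funext => y; rewrite fct_sumE.
rewrite derive_sum => [|i].
  by apply: eq_bigr => i _; exact: derive_entry.
by move/derivable_mxP: df.
Qed.

Section GelfandTsetlin.
Context {R : realType} (m : nat) (l : nat -> R).
Notation Z := (@param R m).
Implicit Types (z v : Z).

Fixpoint gs (k : nat) z : 'M[R]_m :=
  if k is j.+1 then gs j z *m hstep l j z else 1%:M.

Definition Fs k z : 'M[R]_m := gs k z *m Tk l k z *m (gs k z)^T.

Variable a : R.
Hypothesis a0 : 0 < a.
Hypothesis l_diff : forall i i', (i < i')%N -> (i' < m./2)%N -> a <= l i - l i'.
Hypothesis l_sum : forall i i', (i < i')%N -> (i' < m./2)%N -> a <= l i + l i'.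
Hypothesis l_last : odd m -> forall i, (i < m./2)%N -> a <= 2 * l i.
Let B : set Z := @std_ball R (off m) a.

Let oB : open B. Proof. exact: open_std_ball. Qed.

Lemma Ck_on_gs n k : (k <= m)%N -> Ck_on n B (gs k).
Proof.
elim: k => [|k IH] km /=; first exact: Ck_on_cst.
apply: Ck_on_mulmx => //; first exact/IH/ltnW.
exact: (Ck_on_hstep a0 l_diff l_sum l_last).
Qed.

Lemma Ck_on_Fs n k : (k <= m)%N -> Ck_on n B (Fs k).
Proof.
move=> km; apply: Ck_on_mulmx => //; last by apply: Ck_on_trmx => //; exact: Ck_on_gs.
by apply: Ck_on_mulmx => //; [exact: Ck_on_gs|exact: Ck_on_Tk].
Qed.

Lemma gs_orth k z : (k <= m)%N -> B z -> (gs k z)^T *m gs k z = 1%:M.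
Proof.
move=> km Bz; elim: k km => [|k IH] km /=; first by rewrite trmx1 mulmx1.
rewrite trmx_mul mulmxA -(mulmxA _ (gs k z)^T) IH ?(ltnW km)// mulmx1.
exact: (hstep_orth a0 l_diff l_sum l_last).
Qed.

Lemma gs_orthr k z : (k <= m)%N -> B z -> gs k z *m (gs k z)^T = 1%:M.
Proof. by move=> km Bz; apply: mulmx1C; exact: gs_orth. Qed.

Lemma gs_fix k b z (bm : (b < m)%N) : (k <= b)%N ->
  gs k z *m delta_mx (Ordinal bm) 0 = (delta_mx (Ordinal bm) 0 : 'cV_m).
Proof.
elim: k => [|k IH] kb /=; first by rewrite mul1mx.
by rewrite -mulmxA hstep_fix ?IH// ?(ltnW kb)// (leq_trans kb (ltnW bm)).
Qed.

Lemma gs_fix_tr k b z (bm : (b < m)%N) : (k <= b)%N -> B z ->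
  (delta_mx (Ordinal bm) 0 : 'cV[R]_m)^T *m gs k z = (delta_mx (Ordinal bm) 0)^T.
Proof.
move=> kb Bz; apply: trmx_inj; rewrite trmx_mul trmxK -{1}(gs_fix z bm kb).
by rewrite mulmxA gs_orth ?mul1mx//; exact: leq_trans kb (ltnW bm).
Qed.

Definition border j z : 'cV[R]_m := gs j z *m
  corner_col (UF m j) (VF m j) (odd j) (lamf l z) (muf l z) (xf z) (yf z).

Let V0 j (jm : (j < m)%N) : col ord0 (VF m j) = delta_mx (Ordinal jm) 0 :> 'cV[R]_m.
Proof. by apply/matrixP => c d; rewrite !mxE /= ord1 eqxx andbT -val_eqE. Qed.

Let SkE j z : (j < m)%N -> Sk l j z = Tk l j z + (col ord0 (VF m j) *m
  (corner_col (UF m j) (VF m j) (odd j) (lamf l z) (muf l z) (xf z) (yf z))^T -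
  corner_col (UF m j) (VF m j) (odd j) (lamf l z) (muf l z) (xf z) (yf z) *m
  (col ord0 (VF m j))^T).
Proof. by move=> jm; rewrite /Sk /corner torus_muf. Qed.

Let SkC j z : (j < m)%N -> B z ->
  Sk l j z = hstep l j z *m Tk l j.+1 z *m (hstep l j z)^T.
Proof.
move=> jm Bz; rewrite (hstep_intertwine a0 l_diff l_sum l_last jm Bz) -mulmxA.
by rewrite (mulmx1C (hstep_orth a0 l_diff l_sum l_last jm Bz)) mulmx1.
Qed.

(** F_(j+1) = g_j S_j g_j^T by the intertwining relation, and g_j fixes the new basis vector, so
    conjugation only transforms the border vector of S_j. *)
Lemma Fs_step j z (jm : (j < m)%N) : B z -> Fs j.+1 z = Fs j z +
  (delta_mx (Ordinal jm) 0 *m (border j z)^T - border j z *m (delta_mx (Ordinal jm) 0)^T).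
Proof.
move=> Bz; rewrite /Fs /= trmx_mul !mulmxA -(mulmxA (gs j z)) -(mulmxA (gs j z)).
rewrite -SkC// SkE// V0 mulmxDr mulmxDl /border; move: (corner_col _ _ _ _ _ _ _) => w.
congr (_ + _); rewrite mulmxBr mulmxBl !mulmxA gs_fix// trmx_mul !mulmxA.
congr (_ - _).
by rewrite -!mulmxA -[in LHS]trmx_mul gs_fix.
Qed.

Let derivable_gs k z v : (k <= m)%N -> B z -> derivable (gs k) z v.
Proof. by move=> km Bz; apply: Ck_on_derivable Bz; exact: (@Ck_on_gs 1 k km). Qed.

Let derive_gs_fix j z v (jm : (j < m)%N) : B z ->
  'D_v (gs j) z *m delta_mx (Ordinal jm) 0 = (0 : 'cV[R]_m).
Proof.
move=> Bz; have dg := @derivable_gs j z v (ltnW jm) Bz.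
have dc : derivable (fun=> delta_mx (Ordinal jm) 0 : 'cV[R]_m) z v by exact: derivable_cst.
have := derive_mulmx dg dc.
rewrite derive_cst mulmx0 addr0 => <-.
rewrite (_ : (fun z => _) = fun=> delta_mx (Ordinal jm) 0) ?derive_cst//.
by apply/funext => y; rewrite gs_fix.
Qed.

Let derive_gs_skew k z v : (k <= m)%N -> B z ->
  ((gs k z)^T *m 'D_v (gs k) z)^T = - ((gs k z)^T *m 'D_v (gs k) z).
Proof.
move=> km Bz; have dg := @derivable_gs k z v km Bz.
have := derive_mulmx (derivable_trmx dg) dg.
rewrite derive_trmx// [LHS](_ : _ = 0) => [E|]; last first.
  rewrite -(derive_cst (1%:M : 'M[R]_m) z v); apply: near_eq_derive.
  by apply: filterS (open_nbhs_nbhs (conj oB Bz)) => y By; rewrite gs_orth.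
by apply/eqP; rewrite -addr_eq0 trmx_mul trmxK -E.
Qed.

(** In the derivative of g_j h_j the term with dh_j is the trace of one step. The other term is tr
    (S_j A) with A = g_j^T dg_j; as g_j fixes the basis vector of index j, A kills it on both sides,
    the border drops out, and T_j remains for the induction. *)
Lemma gs_trace k z v : (k <= m)%N -> B z ->
  \tr (Tk l k z *m (gs k z)^T *m 'D_v (gs k) z) =
  2 * pi * \sum_(0 <= j < k) \sum_(0 <= i < j./2) (cx j i z * cy j i v - cy j i z * cx j i v).
Proof.
move=> km Bz; elim: k km => [|j IH] jm.
  by rewrite big_geq// mulr0 derive_cst mulmx0 mxtrace0.
have dg := @derivable_gs j z v (ltnW jm) Bz.
have dh : derivable (hstep l j) z v.
  by apply: Ck_on_derivable Bz; exact: (Ck_on_hstep a0 l_diff l_sum l_last jm 1).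
rewrite big_nat_recr//= mulrDr -(IH (ltnW jm)) -(hstep_trace a0 l_diff l_sum l_last jm v Bz).
rewrite (derive_mulmx dg dh) trmx_mul mulmxDr mxtraceD; congr (_ + _); last first.
  by rewrite !mulmxA -(mulmxA _ (gs j z)^T) gs_orth ?(ltnW jm)// mulmx1.
set A := (gs j z)^T *m 'D_v (gs j) z.
have -> : \tr (Tk l j.+1 z *m ((hstep l j z)^T *m (gs j z)^T) *m ('D_v (gs j) z *m hstep l j z)) =
    \tr (Sk l j z *m A).
  by rewrite SkC// !mulmxA mxtrace_mulC !mulmxA.
have Af : A *m (delta_mx (Ordinal jm) 0 : 'cV[R]_m) = 0
  by rewrite /A -mulmxA derive_gs_fix// mulmx0.
have fA : (delta_mx (Ordinal jm) 0 : 'cV[R]_m)^T *m A = 0.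
  by apply: trmx_inj; rewrite trmx_mul trmxK derive_gs_skew ?(ltnW jm)// mulNmx Af oppr0 trmx0.
rewrite SkE// V0; move: (corner_col _ _ _ _ _ _ _) => w.
rewrite mulmxDl mxtraceD mulmxBl -!mulmxA fA !mulmx0 subr0.
by rewrite [X in _ + X]mxtrace_mulC -mulmxA Af mulmx0 mxtrace0 addr0 !mulmxA.
Qed.

Lemma gs_zero k : (k <= m)%N -> gs k 0 = 1%:M.
Proof.
elim: k => [|k IH] km //=; rewrite IH ?(ltnW km)// mul1mx.
exact: (hstep_zero a0 l_diff l_sum l_last).
Qed.

Lemma std_ball0 : B 0.
Proof.
rewrite /B /std_ball /= big1 ?mulr0// => i _.
by rewrite !mxE expr0n addr0.
Qed.

Lemma std_ball_scale z (t : R) : B z -> 0 <= t <= 1 -> B (t *: z).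
Proof.
rewrite /B /std_ball /= => Bz /andP[t0 t1]; apply: le_lt_trans Bz.
rewrite ler_pM2l ?pi_gt0//; apply: ler_sum => i _; rewrite !mxE !exprMn -mulrDr.
rewrite ler_piMl ?addr_ge0 ?sqr_ge0//; exact: exprn_ile1.
Qed.

Lemma Ck_on_det n (f : Z -> 'M[R]_m) : Ck_on n B f -> Ck_on n B (fun z => \det (f z)).
Proof.
move=> Cf; apply: Ck_on_sum => // s _; apply: Ck_onM => //; first exact: Ck_on_const.
by apply: Ck_on_prod => // i _; exact: Ck_on_entry.
Qed.

(** The determinant is 1 or -1, and it is continuous along the ray from the centre, where it is 1; a
    sign change would force a zero. *)
Lemma gs_det z : B z -> \det (gs m z) = 1.
Proof.
move=> Bz; have det2 y : B y -> \det (gs m y) ^+ 2 = 1.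
  by move=> By; have := congr1 determinant (gs_orth (leqnn m) By); rewrite det_mulmx det_tr det1 -expr2.
have neq0 y : B y -> \det (gs m y) != 0.
  by move=> By; apply/eqP => d0; have /eqP := det2 y By; rewrite d0 expr0n/= eq_sym oner_eq0.
pose f t := \det (gs m (t *: z)).
have cf : {within `[0, 1], continuous f}.
  apply: continuous_in_subspaceT => t; rewrite inE /= in_itv /= => t01.
  apply: (@continuous_comp _ _ _ (fun t : R => t *: z) (fun z => \det (gs m z))).
    by apply: cvgZr_tmp; exact: cvg_id.
  have C : Ck_on 0 B (fun z => \det (gs m z)) by exact/Ck_on_det/Ck_on_gs.
  by apply: C; exact: std_ball_scale.
have f0 : f 0 = 1 by rewrite /f scale0r gs_zero// det1.
have [//|f1] : \det (gs m z) = 1 \/ \det (gs m z) = -1.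
  by have /eqP := det2 z Bz; rewrite -subr_eq0 subr_sqr_1 mulf_eq0 subr_eq0 addr_eq0 => /orP[]/eqP; [left|right].
have [||c] := @IVT R f 0 1 0 _ cf; first exact: ler01.
  by rewrite f0 /f scale1r f1 ge_min le_max ler01 lerN10 orbT.
by rewrite in_itv /= => c01 /eqP; rewrite (negPf (neq0 _ (std_ball_scale Bz c01))).
Qed.

End GelfandTsetlin.

(** * The pulled back symplectic form *)

(** Skewness of P G^T rewrites G^T P G^T as - P^T, which turns the bracket into the
    antisymmetrisation of tr (T P^T Q). *)
Lemma pairing_velocities {R : realType} n (G T P Q : 'M[R]_n) : G^T *m G = 1%:M ->
  P *m G^T \in so -> Q *m G^T \in so ->
  pairing (G *m T *m G^T) (lie (P *m G^T) (Q *m G^T)) =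
  2^-1 * (\tr (T *m P^T *m Q) - \tr (T *m Q^T *m P)).
Proof.
move=> GG; rewrite !soE => /eqP Ps /eqP Qs.
have tr2 (X Y : 'M[R]_n) : (X *m G^T)^T = - (X *m G^T) ->
    \tr (G *m T *m G^T *m (X *m G^T *m (Y *m G^T))) = - \tr (T *m X^T *m Y).
  move=> Xs; have XE : X^T = - (G^T *m X *m G^T).
    by rewrite -mulmxA -mulmxN -Xs trmx_mul trmxK mulmxA GG mul1mx.
  rewrite -!mulmxA mxtrace_mulC -!mulmxA GG mulmx1 XE -linearN /=; congr (\tr _).
  by rewrite mulNmx mulmxN opprK !mulmxA.
rewrite /pairing /lie mulmxBr raddfB /= !tr2//; ring.
Qed.

Section SymplecticForm.
Context {R : realType} (m : nat) (l : nat -> R).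
Notation Z := (@param R m).
Implicit Types (z v : Z).

Variable a : R.
Hypothesis a0 : 0 < a.
Hypothesis l_diff : forall i i', (i < i')%N -> (i' < m./2)%N -> a <= l i - l i'.
Hypothesis l_sum : forall i i', (i < i')%N -> (i' < m./2)%N -> a <= l i + l i'.
Hypothesis l_last : odd m -> forall i, (i < m./2)%N -> a <= 2 * l i.
Let B : set Z := @std_ball R (off m) a.

Let oB : open B. Proof. exact: open_std_ball. Qed.

Let T : 'M[R]_m := tmx m m l.

Lemma Tk_top z : Tk l m z = tmx m m l.
Proof. by rewrite /Tk; congr tmx; apply/funext => i; rewrite mu_top. Qed.

Let G := @gs R m l m.
Let CG n : Ck_on n B G := Ck_on_gs a0 l_diff l_sum l_last n (leqnn m).
Let dG z v : B z -> derivable G z v.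
Proof. by move=> Bz; exact: Ck_on_derivable (CG 1) Bz. Qed.
Let dDG z u v : B z -> derivable ('D_v G) z u.
Proof. by move=> Bz; exact: (@Ck_on_derivable _ _ _ 0 B _ _ _ ((CG 2).2 v)). Qed.
Let GG z (Bz : B z) : (G z)^T *m G z = 1%:M := gs_orth a0 l_diff l_sum l_last (leqnn m) Bz.
Let GGr z (Bz : B z) : G z *m (G z)^T = 1%:M := gs_orthr a0 l_diff l_sum l_last (leqnn m) Bz.

(** The functional is sum (x dy - y dx) evaluated on v; its half is the standard primitive of the
    symplectic form of the ball. *)
Lemma trace_std z v : B z -> \tr (T *m (G z)^T *m 'D_v G z) =
  2 * pi * functional v.2 (- v.1) z.
Proof.
move=> Bz; rewrite /T -(Tk_top z) (gs_trace a0 l_diff l_sum l_last v (leqnn m) Bz).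
congr (_ * _).
rewrite -(sum_off (fun p => getv z.1 p * getv v.2 p - getv z.2 p * getv v.1 p)) big_mkord.
by apply: eq_bigr => q _; rewrite !getvE !mxE mulrN.
Qed.

Lemma trace_std_derive z u v : B z ->
  \tr (T *m ('D_u G z)^T *m 'D_v G z) + \tr (T *m (G z)^T *m 'D_u ('D_v G) z) =
  2 * pi * functional v.2 (- v.1) u.
Proof.
move=> Bz; pose A z := T *m (G z)^T.
have dT : derivable (fun=> T) z u by exact: derivable_cst.
have dGT := derivable_trmx (@dG z u Bz).
have dA : derivable A z u := derivable_mulmx dT dGT.
have DA : 'D_u A z = T *m ('D_u G z)^T.
  apply: etrans (derive_mulmx dT dGT) _.
  have c0 : 'D_u (fun=> T) z = 0 by exact: derive_cst.
  by rewrite c0 mul0mx add0r (derive_trmx (@dG z u Bz)).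
have <- : 'D_u (fun z => \tr (A z *m 'D_v G z)) z =
    \tr (T *m ('D_u G z)^T *m 'D_v G z) + \tr (T *m (G z)^T *m 'D_u ('D_v G) z).
  have dd := @dDG z u v Bz.
  rewrite derive_mxtrace; last exact: derivable_mulmx.
  by rewrite (derive_mulmx dA dd) mxtraceD DA.
have -> : 'D_u (fun z => \tr (A z *m 'D_v G z)) z = 'D_u ((2 * pi) *: functional v.2 (- v.1)) z.
  apply: near_eq_derive; apply: filterS (open_nbhs_nbhs (conj oB Bz)) => y By.
  exact: trace_std.
have df : derivable (functional v.2 (- v.1)) z u.
  exact: (@Ck_on_derivable _ _ _ 0 setT _ _ _ (Ck_on_functional _ _ 1 setT)).
by rewrite deriveZ// derive_functional.
Qed.

Lemma velocity_so z v : B z -> 'D_v G z *m (G z)^T \in so.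
Proof.
move=> Bz; rewrite soE; apply/eqP; rewrite trmx_mul trmxK.
have dg := @dG z v Bz; have dgT := derivable_trmx dg.
have := derive_mulmx dg dgT.
rewrite derive_trmx// [LHS](_ : _ = 0) => [E|]; last first.
  rewrite -(derive_cst (1%:M : 'M[R]_m) z v); apply: near_eq_derive.
  by apply: filterS (open_nbhs_nbhs (conj oB Bz)) => y By; rewrite GGr.
by apply/eqP; rewrite -addr_eq0 addrC -E.
Qed.

Lemma derive_Fs z v : B z -> 'D_v (Fs l m) z =
  lie ('D_v G z *m (G z)^T) (Fs l m z).
Proof.
move=> Bz; have dg := @dG z v Bz.
have dT : derivable (Tk l m) z v.
  by rewrite (_ : Tk l m = fun=> T); [exact: derivable_cst|apply/funext => y; exact: Tk_top].
have DT : 'D_v (Tk l m) z = 0.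
  by rewrite (_ : Tk l m = fun=> T); [exact: derive_cst|apply/funext => y; exact: Tk_top].
have dgT := derivable_trmx dg.
have dgt := derivable_mulmx dg dT.
apply: etrans (derive_mulmx dgt dgT) _.
rewrite (derive_mulmx dg dT) DT mulmx0 addr0 derive_trmx//.
have sk : G z *m ('D_v G z)^T = - ('D_v G z *m (G z)^T).
  by have := velocity_so v Bz; rewrite soE trmx_mul trmxK => /eqP.
rewrite /lie /Fs -/G; congr (_ + _).
  by rewrite !mulmxA -(mulmxA _ (G z)^T) GG// mulmx1.
by rewrite -mulmxN -sk !mulmxA -(mulmxA _ (G z)^T) GG// mulmx1.
Qed.

(** Antisymmetrising the derivative of tr (T G^T dG) cancels the second derivatives of G by Schwarz
    and leaves the expression of [pairing_velocities]. The factor 2 pi cancels the normalisation of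
    [kk_form], and the remaining 2 cancels that of the pairing. *)
Lemma Fs_symplectic z u v : B z ->
  kk_form (Fs l m z) ('d (Fs l m) z u) ('d (Fs l m) z v) = std_form u v.
Proof.
move=> Bz.
have dF : differentiable (Fs l m) z by exact: (Ck_on_Fs a0 l_diff l_sum l_last 1 (leqnn m)).1.
rewrite -!deriveE// !derive_Fs// kk_formE ?velocity_so//.
rewrite {1}/Fs -/G Tk_top pairing_velocities ?velocity_so ?GG//.
have E1 := trace_std_derive u v Bz.
have E2 := trace_std_derive v u Bz.
have S := Schwarz_mx u v oB Bz (CG 2).
rewrite S in E1.
have E : functional v.2 (- v.1) u - functional u.2 (- u.1) v = 2 * std_form u v.
  rewrite /functional /std_form -sumrB mulr_sumr; apply: eq_bigr => q _.
  rewrite !mxE; ring.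
have D : \tr (T *m ('D_u G z)^T *m 'D_v G z) - \tr (T *m ('D_v G z)^T *m 'D_u G z) =
    2 * pi * (2 * std_form u v).
  have alg (p q r x y w c : R) : p + r = c * x -> q + r = c * y -> x - y = w ->
      p - q = c * w.
    by move=> h1 h2 <-; rewrite mulrBr -h1 -h2; ring.
  exact: alg E1 E2 E.
apply: etrans (congr1 (fun t => (2 * pi)^-1 * (2^-1 * t)) D) _.
have pi0 : (pi : R) != 0 by exact: lt0r_neq0 (pi_gt0 R).
have two0 : (2 : R) != 0 by rewrite pnatr_eq0.
by rewrite mulrCA mulKf ?mulKf ?mulf_neq0.
Qed.

End SymplecticForm.

(** * Corners and their spectra *)

Lemma char_poly_orth_conj {R : comNzRingType} n (g A : 'M[R]_n) :
  g *m g^T = 1%:M -> char_poly (g *m A *m g^T) = char_poly A.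
Proof.
move=> gg; rewrite /char_poly.
have -> : char_poly_mx (g *m A *m g^T) =
    map_mx polyC g *m char_poly_mx A *m (map_mx polyC g)^T.
  rewrite /char_poly_mx mulmxBr mulmxBl map_trmx -!map_mxM; congr (_ - _).
  by rewrite scalar_mxC -mulmxA -map_mxM gg map_scalar_mx mulmx1.
rewrite !det_mulmx mulrAC -det_mulmx map_trmx -map_mxM gg map_scalar_mx.
by rewrite rmorph1 det1 mul1r.
Qed.

(** Equal characteristic polynomials give the same multiset of diagonal entries, and both lists are
    nondecreasing. *)
Lemma diag_eq_of_conj {R : realFieldType} n (g g' : 'M[R]_n) (d d' : 'I_n -> R) :
  g *m g^T = 1%:M -> g' *m g'^T = 1%:M ->
  g *m dg d *m g^T = g' *m dg d' *m g'^T ->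
  {homo d : i j / (i <= j)%N >-> i <= j} -> {homo d' : i j / (i <= j)%N >-> i <= j} ->
  d =1 d'.
Proof.
move=> gg gg' E hd hd' i.
have cp (e : 'I_n -> R) : char_poly (dg e) = \prod_(x <- [seq e i | i <- enum 'I_n]) ('X - x%:P).
  rewrite char_poly_trig; last exact/is_diag_mx_is_trig/diag_mx_is_diag.
  by rewrite big_map enumT; apply: eq_bigr => k _; rewrite dgE eqxx.
have srt (e : 'I_n -> R) : {homo e : i j / (i <= j)%N >-> i <= j} ->
    sorted <=%R [seq e i | i <- enum 'I_n].
  move=> he; apply: (homo_sorted (e := fun i j : 'I_n => (i <= j)%N)) => //.
  have : sorted leq [seq val i | i <- enum 'I_n] by rewrite val_enum_ord iota_sorted.
  by rewrite sorted_map.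
have /prod_XsubC_eq P : \prod_(x <- [seq d i | i <- enum 'I_n]) ('X - x%:P) =
    \prod_(x <- [seq d' i | i <- enum 'I_n]) ('X - x%:P).
  by rewrite -!cp -(char_poly_orth_conj (dg d) gg) -(char_poly_orth_conj (dg d') gg') E.
have := sorted_eq le_trans le_anti (srt d hd) (srt d' hd') P.
by move=> /eq_in_map/(_ i); apply; rewrite mem_enum.
Qed.

Section TorusSquare.
Context {R : realType} (m : nat).

Lemma tmx_col0 k (c : nat -> R) b (bm : (b < m)%N) : (k <= b)%N ->
  tmx m k c *m delta_mx (Ordinal bm) 0 = (0 : 'cV[R]_m).
Proof.
move=> kb; apply/matrixP => i j; rewrite -colE !mxE big_nat big1// => p /andP[_ pk].
have -> : (Ordinal bm == p.*2 :> nat) = false by apply/negP => /eqP /=; lia.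
have -> : (Ordinal bm == p.*2.+1 :> nat) = false by apply/negP => /eqP /=; lia.
by rewrite !andbF subrr mulr0.
Qed.

(** The square of the skew torus element is real diagonal, so spectra can be compared over R; the
    price is that only the squares of the entries are recovered. *)
Lemma tmx_sqr k (c : nat -> R) : (k <= m)%N ->
  tmx m k c *m tmx m k c =
  dg (fun a : 'I_m => if (a./2 < k./2)%N then - c a./2 ^+ 2 else 0).
Proof.
move=> km.
pose U : 'M[R]_(m, k./2) := \matrix_(a, i) (a == i.*2 :> nat)%:R.
pose V : 'M[R]_(m, k./2) := \matrix_(a, i) (a == i.*2.+1 :> nat)%:R.
pose C (i : 'I_k./2) := c i.
have TE : tmx m k c = torus U V C.
  apply/matrixP => a b; rewrite /torus mx_subE !sandwichE -sumrB mxE big_mkord.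
  by apply: eq_bigr => i _; rewrite !mxE /C; do 4![case: eqP => ? /=]; ring.
have delta (p q : nat) : (p < m)%N ->
    \sum_(a < m) (a == p :> nat)%:R * (a == q :> nat)%:R = (p == q)%:R :> R.
  move=> pm; rewrite (bigD1 (Ordinal pm))//= eqxx mul1r big1 ?addr0// => a.
  by rewrite -val_eqE /= => /negPf ->; rewrite mul0r.
have UU : U^T *m U = 1%:M.
  apply/matrixP => i j; rewrite !mxE; under eq_bigr do rewrite !mxE.
  rewrite delta; last by have := ltn_ord i; lia.
  by congr (_%:R); rewrite -val_eqE /=; congr nat_of_bool; lia.
have VV : V^T *m V = 1%:M.
  apply/matrixP => i j; rewrite !mxE; under eq_bigr do rewrite !mxE.
  rewrite delta; last by have := ltn_ord i; lia.
  by congr (_%:R); rewrite -val_eqE /=; congr nat_of_bool; lia.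
have UV : U^T *m V = 0.
  apply/matrixP => i j; rewrite !mxE; under eq_bigr do rewrite !mxE.
  rewrite delta; last by have := ltn_ord i; lia.
  by rewrite (_ : (_ == _) = false)//; lia.
have VU : V^T *m U = 0 by rewrite -[U]trmxK -trmx_mul UV trmx0.
have z1 (P Q A D : 'M[R]_(m, k./2)) : P^T *m Q = 0 ->
    A *m dg C *m P^T *m (Q *m dg C *m D^T) = 0.
  by move=> PQ; rewrite -!mulmxA (mulmxA P^T) PQ !(mul0mx, mulmx0).
have z2 (P A : 'M[R]_(m, k./2)) : P^T *m P = 1%:M ->
    A *m dg C *m P^T *m (P *m dg C *m A^T) = A *m dg (fun i => C i * C i) *m A^T.
  by move=> PP; rewrite -!mulmxA (mulmxA P^T) PP mul1mx (mulmxA (dg C)) dgM.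
rewrite TE /torus mulmxBl !mulmxBr (z1 U V V U UV) (z1 V U U V VU) sub0r subr0 z2// z2//.
apply/matrixP => a b; rewrite mx_subE mxE !sandwichE dgE -sumrN -sumrB.
have [->|ab] := eqVneq a b; last first.
  rewrite big1// => i _; rewrite !mxE.
  have nab : (a : nat) <> b by move=> /val_inj/eqP; rewrite (negPf ab).
  by do 4![case: eqP => ? /=]; rewrite ?(mul0r, mulr0, oppr0, subrr, addr0)//; lia.
rewrite mulr1n; case: ifP => ak.
  rewrite (bigD1 (Ordinal ak))//= big1 => [|i ib]; last first.
    have nib : (i : nat) <> b./2 by move=> ib'; case/eqP: ib; exact: val_inj.
    rewrite !mxE; do 2![case: eqP => ? /=]; rewrite ?(mul0r, mulr0, oppr0, subrr, addr0)//; lia.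
  rewrite addr0 !mxE /C /=; do 2![case: eqP => ? /=]; rewrite ?(mulr1, mul1r, mul0r, mulr0, oppr0, subr0, sub0r) -?expr2//; lia.
rewrite big1// => i _; have := ltn_ord i; move/negbT: ak => ak ik.
rewrite !mxE; do 2![case: eqP => ? /=]; rewrite ?(mul0r, mulr0, oppr0, subrr, addr0)//; lia.
Qed.

End TorusSquare.

Section Injectivity.
Context {R : realType} (m : nat) (l : nat -> R).
Notation Z := (@param R m).
Implicit Types (z v : Z).

Variable a : R.
Hypothesis a0 : 0 < a.
Hypothesis l_diff : forall i i', (i < i')%N -> (i' < m./2)%N -> a <= l i - l i'.
Hypothesis l_sum : forall i i', (i < i')%N -> (i' < m./2)%N -> a <= l i + l i'.
Hypothesis l_last : odd m -> forall i, (i < m./2)%N -> a <= 2 * l i.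
Let B : set Z := @std_ball R (off m) a.

Lemma Fs_col0 k z b (bm : (b < m)%N) : (k <= b)%N -> B z ->
  Fs l k z *m delta_mx (Ordinal bm) 0 = (0 : 'cV[R]_m).
Proof.
move=> kb Bz; rewrite /Fs -mulmxA -[delta_mx _ _]trmxK -trmx_mul.
rewrite (gs_fix_tr a0 l_diff l_sum l_last bm kb Bz) trmxK -mulmxA.
by rewrite /Tk tmx_col0// mulmx0.
Qed.

Lemma Fs_skew k z : (Fs l k z)^T = - Fs l k z.
Proof.
have TT : (Tk l k z)^T = - Tk l k z.
  apply/matrixP => b c; rewrite !mxE -sumrN; apply: eq_bigr => i _.
  by rewrite -mulrN opprB; congr (_ * (_%:R - _%:R)); rewrite andbC.
by rewrite /Fs !trmx_mul trmxK TT mulNmx mulmxN mulmxA.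
Qed.

Lemma Fs_corner k z (b c : 'I_m) : (k < m)%N -> B z ->
  Fs l k z b c = if (b < k)%N && (c < k)%N then Fs l k.+1 z b c else 0.
Proof.
move=> km Bz.
have col0 (b' c' : 'I_m) : (k <= c')%N -> Fs l k z b' c' = 0.
  case: c' => c' cm /= kc; have := Fs_col0 cm kc Bz.
  by move=> /(congr1 (fun M : 'cV[R]_m => M b' 0)); rewrite -colE !mxE.
case: ifP => [/andP[bk ck]|].
  have e0 (x : 'I_m) : (x < k)%N -> (delta_mx (Ordinal km) 0 : 'cV[R]_m) x ord0 = 0.
    by move=> xk; rewrite mxE -val_eqE /= (_ : (_ == _) = false)//; lia.
  rewrite (Fs_step a0 l_diff l_sum l_last km Bz); move: (border _ _ _) => w.
  rewrite mx_addE mx_subE [X in _ + (X - _)]mxE [X in _ + (_ - X)]mxE !big_ord1.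
  have e0T (x : 'I_m) : (x < k)%N -> (delta_mx (Ordinal km) 0 : 'cV[R]_m)^T ord0 x = 0.
    by move=> xk; rewrite mxE e0.
  by rewrite e0// e0T// mul0r mulr0 subrr addr0.
move=> /negbT; rewrite negb_and -!leqNgt => /orP[kb|kc]; last exact: col0.
have := congr1 (fun M : 'M[R]_m => M c b) (Fs_skew k z).
by rewrite mxE => ->; rewrite mxE col0// oppr0.
Qed.

Lemma Fs_lower z z' k : B z -> B z' -> (k <= m)%N -> Fs l m z = Fs l m z' ->
  Fs l k z = Fs l k z'.
Proof.
move=> Bz Bz' km E; rewrite -(subKn km); elim: (m - k)%N (leq_subr k m) => [|d IH] dm.
  by rewrite subn0.
have dE : (m - d)%N = (m - d.+1).+1 by rewrite subnSK.
have dm' : (m - d.+1 < m)%N by lia.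
move: (IH (ltnW dm)); rewrite dE => IH'.
by apply/matrixP => b c; rewrite (Fs_corner b c dm' Bz) (Fs_corner b c dm' Bz') IH'.
Qed.

Let corner_col_row0 z j (jm : (j < m)%N) :
  (delta_mx (Ordinal jm) 0 : 'cV[R]_m)^T *m
  corner_col (UF m j) (VF m j) (odd j) (lamf l z) (muf l z) (xf z) (yf z) = 0.
Proof.
rewrite /corner_col mulmxA; apply/matrixP => b c.
rewrite [LHS]mxE [RHS]mxE big1// => i _; rewrite trmx_delta -rowE [X in X * _]mxE [X in X * _]mxE.
have F p : (p < j)%N -> (j == p) = false by move=> pj; apply/negbTE; lia.
case: i => -[|i] ij; rewrite !mxE /= /xf /yf /=; case: ifP => oj; rewrite ?mulr0 ?mulr1 ?mul0r ?addr0.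
- by rewrite (_ : (_ == _) = false) ?mul0r//; apply/negbTE; lia.
- by [].
- by rewrite !F ?(mul0r, addr0)//; lia.
- by rewrite !F ?(mul0r, addr0, oppr0)//; lia.
Qed.

(** The border vector has no component along the new basis vector, so it can be read off from column
    j. *)
Lemma border_Fs j z (jm : (j < m)%N) : B z ->
  border l j z = (Fs l j z - Fs l j.+1 z) *m delta_mx (Ordinal jm) 0.
Proof.
move=> Bz; rewrite (Fs_step a0 l_diff l_sum l_last jm Bz) opprD addrA subrr add0r opprB.
have w0 : (border l j z)^T *m (delta_mx (Ordinal jm) 0 : 'cV[R]_m) = 0 :> 'M[R]_1.
  apply: trmx_inj; rewrite trmx_mul trmxK trmx0 /border mulmxA.
  by rewrite (gs_fix_tr a0 l_diff l_sum l_last jm (leqnn j) Bz) corner_col_row0.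
rewrite mulmxBl -!mulmxA w0 mulmx0 subr0 trmx_delta mul_delta_mx.
by rewrite [delta_mx 0 0](_ : _ = 1%:M) ?mulmx1//; apply/matrixP => b c; rewrite !mxE !ord1.
Qed.

(** F_k^2 is orthogonally conjugate to a diagonal matrix with entries - mu^2, already sorted because
    |mu_(k,i)| decreases in i; the sorted spectrum determines them. *)
Lemma mu_sqr_eq z z' k i : B z -> B z' -> (k <= m)%N -> (i < k./2)%N ->
  Fs l k z = Fs l k z' -> mu l k i z ^+ 2 = mu l k i z' ^+ 2.
Proof.
move=> Bz Bz' km ik E.
(* The value 0 past the pattern is consistent with the sorting, the earlier values being at most
   0. *)
pose d (y : Z) (b : 'I_m) : R := if (b./2 < k./2)%N then - mu l k b./2 y ^+ 2 else 0.
have sq y : B y -> Fs l k y *m Fs l k y = gs l k y *m dg (d y) *m (gs l k y)^T.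
  move=> By; rewrite /Fs !mulmxA -(mulmxA _ (gs l k y)^T).
  rewrite (gs_orth a0 l_diff l_sum l_last km By) mulmx1 -(mulmxA (gs l k y)).
  by rewrite /Tk tmx_sqr.
have mono y : B y -> {homo d y : b c / (b <= c)%N >-> b <= c}.
  move=> By b c bc; rewrite /d; case: ifP => bk; case: ifP => ck //; first last.
  - by have : (b./2 <= c./2)%N := half_leq bc; lia.
  - by rewrite oppr_le0 sqr_ge0.
  have [/eqP ->//|bc'] := boolP (b./2 == c./2).
  have lt : (b./2 < c./2)%N by rewrite ltn_neqAle bc' half_leq.
  have cm : (c./2 < m./2)%N by apply: leq_trans ck (half_leq km).
  have := mu_lt l_diff l_sum k k By lt cm => mlt.
  rewrite lerN2 -[leLHS]real_normK ?num_real// ler_sqr ?nnegrE ?normr_ge0 ?(ltW mlt)//.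
  exact: le_trans (normr_ge0 _) (ltW mlt).
have im : (i.*2 < m)%N by lia.
have := @diag_eq_of_conj R m (gs l k z) (gs l k z') (d z) (d z')
  (gs_orthr a0 l_diff l_sum l_last km Bz) (gs_orthr a0 l_diff l_sum l_last km Bz') _
  (mono z Bz) (mono z' Bz').
rewrite -!sq// E => /(_ erefl) /(_ (Ordinal im)).
by rewrite /d /= doubleK ik => /oppr_inj.
Qed.

End Injectivity.

(** * Injectivity *)

Lemma off_decomp k q : (q < off k)%N ->
  exists j i, [/\ (j < k)%N, (i < j./2)%N & q = (off j + i)%N].
Proof.
elim: k => [|k IH]; first by rewrite /off big_geq.
rewrite offS => qk; have [/IH[j [i [jk ij ->]]]|kq] := ltnP q (off k).
  by exists j, i; split=> //; exact: ltnW.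
by exists k, (q - off k)%N; split=> //; lia.
Qed.

Section Injectivity.
Context {R : realType} (m : nat) (l : nat -> R).
Notation Z := (@param R m).
Implicit Types (z v : Z).

Lemma param_eq z z' :
  (forall j i, (j < m)%N -> (i < j./2)%N -> cx j i z = cx j i z' /\ cy j i z = cy j i z') ->
  z = z'.
Proof.
move=> H; case: z z' H => z1 z2 [z1' z2'] H.
have E (q : 'I_(off m)) : z1 0 q = z1' 0 q /\ z2 0 q = z2' 0 q.
  have [j [i [jm ij qE]]] := off_decomp (ltn_ord q).
  by have := H j i jm ij; rewrite /cx /cy /= -qE !getvE.
by congr (_, _); apply/rowP => q; case: (E q).
Qed.

Variable a : R.
Hypothesis a0 : 0 < a.
Hypothesis l_diff : forall i i', (i < i')%N -> (i' < m./2)%N -> a <= l i - l i'.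
Hypothesis l_sum : forall i i', (i < i')%N -> (i' < m./2)%N -> a <= l i + l i'.
Hypothesis l_last : odd m -> forall i, (i < m./2)%N -> a <= 2 * l i.
Let B : set Z := @std_ball R (off m) a.

Section Step.
Variables (j : nat) (z z' : Z).
Hypothesis jm : (j < m)%N.
Hypothesis Bz : B z.
Hypothesis Bz' : B z'.
Hypothesis gE : gs l j z = gs l j z'.
Hypothesis muE : forall i, (i < j./2)%N -> mu l j i z = mu l j i z'.
Hypothesis mu2E : forall i, (i < j.+1./2)%N -> mu l j.+1 i z ^+ 2 = mu l j.+1 i z' ^+ 2.
Hypothesis bE : border l j z = border l j z'.

Let p y (i : 'I_(j./2).+1) := pco (odd j) (@lamf R m l j y) (muf l y) i.

Let coord_col y : (UF m j)^T *m
    corner_col (UF m j) (VF m j) (odd j) (@lamf R m l j y) (muf l y) (xf y) (yf y) =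
    (\col_i (IF i * xf y i * p y i)) /\
  (VF m j)^T *m
    corner_col (UF m j) (VF m j) (odd j) (@lamf R m l j y) (muf l y) (xf y) (yf y) =
    (\col_i (yf y i * p y i)).
Proof.
have VU : (VF m j)^T *m UF m j = 0 :> 'M[R]_((j./2).+1).
  by rewrite -[UF m j]trmxK -trmx_mul UF_VF ?trmx0.
rewrite /corner_col rotUE; split.
  rewrite mulmxA mulmxDr !mulmxA UF_orth// UF_VF// mul0mx addr0 dgM.
  by apply/matrixP => i c; rewrite mul_diag_mx !mxE.
rewrite mulmxA mulmxDr !mulmxA VF_orth// VU mul0mx add0r mul1mx.
by apply/matrixP => i c; rewrite mul_diag_mx !mxE.
Qed.

Let colE : corner_col (UF m j) (VF m j) (odd j) (@lamf R m l j z) (muf l z) (xf z) (yf z) =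
  corner_col (UF m j) (VF m j) (odd j) (@lamf R m l j z') (muf l z') (xf z') (yf z').
Proof.
have gg y : B y -> (gs l j y)^T *m gs l j y = 1%:M.
  by move=> By; exact: (gs_orth a0 l_diff l_sum l_last (ltnW jm) By).
have := congr1 (mulmx (gs l j z)^T) bE.
by rewrite /border {3}gE !mulmxA !gg// !mul1mx.
Qed.

Let xpE i : IF i * xf z i * p z i = IF i * xf z' i * p z' i.
Proof.
have := congr1 (mulmx (UF m j)^T) colE; rewrite !(coord_col _).1.
by move=> /matrixP/(_ i 0); rewrite !mxE.
Qed.

Let ypE i : yf z i * p z i = yf z' i * p z' i.
Proof.
have := congr1 (mulmx (VF m j)^T) colE; rewrite !(coord_col _).2.
by move=> /matrixP/(_ i 0); rewrite !mxE.
Qed.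

Let IL y (By : B y) : interlacing (odd j) (@lamf R m l j y) (muf l y) :=
  interlacing_step l_diff l_sum l_last a0 By jm.

Let mufE : @muf R m l j z = muf l z'.
Proof. by apply/funext => -[[|i] ij] //; exact: muE. Qed.

Let lamE i : i != ord0 -> @lamf R m l j z i = lamf l z' i.
Proof.
move=> i0; have pz := il_pos (IL Bz) i0; have pz' := il_pos (IL Bz') i0.
apply/eqP; rewrite -(@eqrXn2 _ 2)// ?ltW//; apply/eqP.
case: i i0 pz pz' => -[|i] // ij _ _ _; apply: mu2E.
by rewrite ltnS in ij; apply: leq_trans ij _; exact: half_leq.
Qed.

(** The square of this entry loses its sign, since it is the one that may be negative. The border
    recovers it: at index 0 the component is lam_0 Plam / Pmu with w_0 = 1, and the quotient is
    already known and nonzero. *)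
Let lam0E : @lamf R m l j z ord0 = @lamf R m l j z' ord0.
Proof.
have [oj|oj] := boolP (odd j); last first.
  by rewrite (il_lam0 (IL Bz) oj) (il_lam0 (IL Bz') oj).
have := xpE ord0; rewrite /IF /xf /p /= oj !mul1r /pco eqxx.
have -> : \prod_(k | k != ord0) @lamf R m l j z k = \prod_(k | k != ord0) @lamf R m l j z' k.
  by apply: eq_bigr => k; exact: lamE.
rewrite mufE; apply: mulIf; rewrite mulf_neq0// ?invr_eq0.
  by apply/prodf_neq0 => k k0; rewrite gt_eqF// (il_pos (IL Bz') k0).
by apply/prodf_neq0 => k k0; rewrite gt_eqF// (il_mu_gt0 (IL Bz') oj k0).
Qed.

Let lamfE : @lamf R m l j z = lamf l z'.
Proof.
by apply/funext => i; have [->|] := eqVneq i ord0; [exact: lam0E|exact: lamE].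
Qed.

Let pE i : p z i = p z' i. Proof. by rewrite /p lamfE mufE. Qed.

Let p_neq0 i : i != ord0 -> p z i != 0.
Proof. by move=> i0; rewrite gt_eqF// (pco_gt0 (IL Bz) i0). Qed.

Lemma step_coord i : (i < j./2)%N -> cx j i z = cx j i z' /\ cy j i z = cy j i z'.
Proof.
move=> ij; have ij' : (i.+1 < (j./2).+1)%N by [].
have k0 : Ordinal ij' != ord0 by [].
split; apply: (mulIf (p_neq0 k0)).
  by have := xpE (Ordinal ij'); rewrite -pE /IF /xf /= !mul1r.
by have := ypE (Ordinal ij'); rewrite -pE.
Qed.

Lemma step_mu i : (i < j.+1./2)%N -> mu l j.+1 i z = mu l j.+1 i z'.
Proof.
move=> ij; have [ij'|ij'] := ltnP i j./2.
  by have := lamE (_ : Ordinal (_ : (i.+1 < (j./2).+1)%N) != ord0); apply.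
have oj : odd j by lia.
have -> : i = j./2 by lia.
by have := lam0E; rewrite /lamf /= oj.
Qed.

Lemma step_gs : gs l j.+1 z = gs l j.+1 z'.
Proof.
have xE : @xf R m j z = xf z'.
  by apply/funext => -[[|i] ij] //; case: (@step_coord i ij).
have yE : @yf R m j z = yf z'.
  by apply/funext => -[[|i] ij] //; case: (@step_coord i ij).
by rewrite /= gE /hstep lamfE mufE xE yE.
Qed.

End Step.

Lemma Fs_inj z z' : B z -> B z' -> Fs l m z = Fs l m z' -> z = z'.
Proof.
move=> Bz Bz' E.
have low k : (k <= m)%N -> Fs l k z = Fs l k z'.
  by move=> km; exact: (Fs_lower a0 l_diff l_sum l_last Bz Bz' km E).
have bE j : (j < m)%N -> border l j z = border l j z'.
  move=> jm; rewrite (border_Fs a0 l_diff l_sum l_last jm Bz).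
  by rewrite (border_Fs a0 l_diff l_sum l_last jm Bz') !low// ltnW.
have mu2 k i : (k <= m)%N -> (i < k./2)%N -> mu l k i z ^+ 2 = mu l k i z' ^+ 2.
  by move=> km ik; exact: (mu_sqr_eq a0 l_diff l_sum l_last Bz Bz' km ik (low k km)).
have st j : (j <= m)%N -> gs l j z = gs l j z' /\
    forall i, (i < j./2)%N -> mu l j i z = mu l j i z'.
  elim: j => [_|j IH jm]; first by split=> [|i]; [reflexivity|rewrite ltn0].
  have [gE mE] := IH (ltnW jm).
  have mu2' i : (i < j.+1./2)%N -> mu l j.+1 i z ^+ 2 = mu l j.+1 i z' ^+ 2 by exact: mu2.
  split; first exact: (step_gs jm Bz Bz' gE mE mu2' (bE j jm)).
  by move=> i ij; exact: (step_mu jm Bz Bz' gE mE mu2' (bE j jm)).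
apply: param_eq => j i jm ij; have [gE mE] := st j (ltnW jm).
have mu2' i' : (i' < j.+1./2)%N -> mu l j.+1 i' z ^+ 2 = mu l j.+1 i' z' ^+ 2 by exact: mu2.
exact: (step_coord jm Bz Bz' gE mE mu2' (bE j jm)).
Qed.

End Injectivity.

(** * The embedding of the ball *)

Lemma Ck_on_sub {R : realType} {V W : normedModType R} k (A D : set V) (f : V -> W) :
  A `<=` D -> Ck_on k D f -> Ck_on k A f.
Proof.
move=> AD; elim: k f => [|k IH] f /=; first by move=> Cf z Az; apply/Cf/AD.
by move=> [df Df]; split=> [z Az|v]; [apply/df/AD|exact/IH/Df].
Qed.

Lemma compact_inverse_continuous {T U : topologicalType} (K : set T) (f : T -> U) (g : U -> T) :
  hausdorff_space U -> compact K -> {within K, continuous f} ->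
  (forall z, K z -> g (f z) = z) -> {within f @` K, continuous g}.
Proof.
move=> hU cK cf gf; apply/subspace_continuousP => y [z Kz <-] O.
rewrite /from_subspace gf// => /nbhs_interior; set O' := O° => nO.
have oO : open O' by exact: open_interior.
(* The points of K outside O' have compact, hence closed, image. The complement of that image is the
   neighbourhood sought. *)
have cKO : compact (K `&` ~` O') by apply: compact_closedI => //; exact: open_closedC.
have cfK : closed (f @` (K `&` ~` O')).
  apply: compact_closed => //; apply: continuous_compact => //.
  by apply: continuous_subspaceW cf => ? [].
have : nbhs (f z) (~` (f @` (K `&` ~` O'))).
  apply: open_nbhs_nbhs; split; first exact: closed_openC.
  move=> [z' [Kz' nOz'] /(congr1 g)]; rewrite !gf// => zz'; apply: nOz'.
  by rewrite zz'; exact: nbhs_singleton.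
rewrite /within /= nbhs_simpl /=.
apply: filterS => w nw [z' Kz' fz']; change (O (g w)); rewrite -fz' gf//.
apply: interior_subset; apply: contrapT => nO'; apply: nw; exists z' => //.
Qed.

Section Embedding.
Context {R : realType} (m : nat) (l : nat -> R).
Notation Z := (@param R m).
Implicit Types (z v : Z).

Lemma closed_std_ball_compact (a : R) :
  compact [set z : Z | pi * (\sum_(i < off m) (z.1 0 i ^+ 2 + z.2 0 i ^+ 2)) <= a].
Proof.
pose q z := pi * (\sum_(0 <= j < m) \sum_(0 <= i < j./2) ss j i z).
have qE z : pi * (\sum_(i < off m) (z.1 0 i ^+ 2 + z.2 0 i ^+ 2)) = q z.
  by rewrite (sum_getv (fun x y => x ^+ 2 + y ^+ 2)).
pose I : set R := [set` `[- (1 + a), 1 + a]].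
pose box : set 'rV[R]_(off m) := [set v | forall i, I (v ord0 i)].
have cbox : compact box by apply: (@rV_compact R (off m) (fun=> I)) => _; exact: segment_compact.
apply: (@subclosed_compact _ _ (box `*` box)).
- have -> : [set z : Z | pi * (\sum_(i < off m) (z.1 0 i ^+ 2 + z.2 0 i ^+ 2)) <= a] =
      q @^-1` [set x | x <= a].
    by apply/seteqP; split=> z /=; rewrite qE.
  apply: closed_comp; last exact: closed_le.
  move=> z _; have oT : open (@setT Z) by exact: openT.
  have : Ck_on 0 setT q.
    apply: Ck_onM => //; first exact: Ck_on_const.
    by apply: Ck_on_sum => // j _; apply: Ck_on_sum => // i _; exact: Ck_on_ss.
  by apply.
- exact: compact_setX.
(* Since pi >= 1, every coordinate has square at most a, and x ^+ 2 <= a forces |x| <= 1 + a. *)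
- have bound (x y : R) i z : (x = z.1 0 i /\ y = z.2 0 i) ->
      pi * (\sum_(i < off m) (z.1 0 i ^+ 2 + z.2 0 i ^+ 2)) <= a -> I x /\ I y.
    move=> [-> ->] za.
    have le : z.1 0 i ^+ 2 + z.2 0 i ^+ 2 <= a.
      apply: le_trans za; rewrite (bigD1 i)//= mulrDr.
      apply: (@le_trans _ _ (pi * (z.1 0 i ^+ 2 + z.2 0 i ^+ 2))).
        by rewrite ler_peMl ?addr_ge0 ?sqr_ge0//; apply: le_trans (pi_ge2 R); rewrite ler1n.
      rewrite lerDl mulr_ge0 ?pi_ge0// sumr_ge0// => k _; exact: addr_ge0 (sqr_ge0 _) (sqr_ge0 _).
    have x0 := sqr_ge0 (z.1 0 i); have y0 := sqr_ge0 (z.2 0 i).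
    by split; rewrite /I /= in_itv /=; apply/andP; split; nra.
  move=> z /= za; split=> i; first by case: (bound _ _ i z (conj erefl erefl) za).
  by case: (bound _ _ i z (conj erefl erefl) za).
Qed.

Variables a a1 : R.
Hypothesis a0 : 0 < a.
Hypothesis aa1 : a < a1.
Hypothesis l_diff : forall i i', (i < i')%N -> (i' < m./2)%N -> a1 <= l i - l i'.
Hypothesis l_sum : forall i i', (i < i')%N -> (i' < m./2)%N -> a1 <= l i + l i'.
Hypothesis l_last : odd m -> forall i, (i < m./2)%N -> a1 <= 2 * l i.

Lemma Fs_coadjoint_orbit z : std_ball a1 z -> coadjoint_orbit (tmx m m l) (Fs l m z).
Proof.
move=> Bz; have a10 : 0 < a1 := lt_trans a0 aa1.
have gg := gs_orthr a10 l_diff l_sum l_last (leqnn m) Bz.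
exists (gs l m z).
  by split=> //; exact: (gs_det a10 l_diff l_sum l_last Bz).
rewrite /Fs Tk_top; congr (_ *m _).
have [_ gU] := mulmx1_unit gg; have gu : gs l m z \in unitmx by case: (mulmx1_unit gg).
by rewrite -[LHS]mulmx1 -gg mulmxA mulVmx// mul1mx.
Qed.

Lemma Fs_embedding :
  symplectic_ball_embedding (coadjoint_orbit (tmx m m l)) kk_form a (Fs l m).
Proof.
have a10 : 0 < a1 := lt_trans a0 aa1.
have sub : @std_ball R (off m) a `<=` std_ball a1 by move=> z /lt_trans; apply.
pose K := [set z : Z | pi * (\sum_(i < off m) (z.1 0 i ^+ 2 + z.2 0 i ^+ 2)) <= a].
have subK : @std_ball R (off m) a `<=` K by move=> z /ltW.
have KB : K `<=` std_ball a1 by move=> z za; exact: le_lt_trans za aa1.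
pose g y := xget (0 : Z) [set z | K z /\ Fs l m z = y].
have gf z : K z -> g (Fs l m z) = z.
  move=> Kz; rewrite /g; case: xgetP => [z' _ [Kz' E]|/(_ z)[]//].
  exact: (Fs_inj a10 l_diff l_sum l_last (KB _ Kz') (KB _ Kz) E).
split.
- move=> k; apply: Ck_on_sub sub _; exact: (Ck_on_Fs a10 l_diff l_sum l_last k (leqnn m)).
- by move=> _ [z Bz <-]; apply: Fs_coadjoint_orbit; exact: sub.
- exists g; split; last by move=> z /subK; exact: gf.
  have : {within (Fs l m) @` K, continuous g}.
    apply: compact_inverse_continuous gf; first exact: norm_hausdorff.
      exact: closed_std_ball_compact.
    apply: continuous_in_subspaceT => z; rewrite inE => /KB.
    exact: (Ck_on_Fs a10 l_diff l_sum l_last 0 (leqnn m)).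
  apply: continuous_subspaceW => _ [z Bz <-]; exists z => //; exact: subK.
- move=> z Bz u v; exact: (Fs_symplectic a10 l_diff l_sum l_last u v (sub _ Bz)).
Qed.

End Embedding.

(** * The dimension of the orbit *)

Section OrbitDimension.
Context {R : realType} (m : nat) (l : nat -> R).
Notation Z := (@param R m).

Let T : 'M[R]_m := tmx m m l.

Let so_diag (X : 'M[R]_m) : X \in so -> forall b, X b b = 0.
Proof.
rewrite soE => /eqP XT b; have := congr1 (fun M : 'M[R]_m => M b b) XT.
rewrite !mxE; lra.
Qed.

Let T_skew : T^T = - T.
Proof.
apply/matrixP => b c; rewrite !mxE -sumrN; apply: eq_bigr => i _.
by rewrite -mulrN opprB; congr (_ * (_%:R - _%:R)); rewrite andbC.
Qed.

Let lie_skew (X : 'M[R]_m) : X \in so -> (lie X T)^T = - lie X T.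
Proof.
rewrite soE => /eqP XT.
by rewrite /lie linearB /= !trmx_mul XT T_skew !mulNmx !mulmxN !opprK opprB.
Qed.

Let T_col (b c e : 'I_m) : odd c -> (b.+1 = c)%N -> e != b -> T e c = 0.
Proof.
move=> oc bc eb; have neb : (e : nat) <> b by move=> /val_inj/eqP; rewrite (negPf eb).
rewrite !mxE big1// => i _.
have -> : (c == i.*2 :> nat) = false by apply/negbTE; lia.
have -> : (e == i.*2 :> nat) && (c == i.*2.+1 :> nat) = false by apply/negbTE; lia.
by rewrite andbF subrr mulr0.
Qed.

Let T_row (b c e : 'I_m) : odd c -> (b.+1 = c)%N -> e != c -> T b e = 0.
Proof.
move=> oc bc ec; have nec : (e : nat) <> c by move=> /val_inj/eqP; rewrite (negPf ec).
rewrite !mxE big1// => i _.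
have -> : (b == i.*2.+1 :> nat) = false by apply/negbTE; lia.
have -> : (b == i.*2 :> nat) && (e == i.*2.+1 :> nat) = false by apply/negbTE; lia.
by rewrite subrr mulr0.
Qed.

Let lie_block (X : 'M[R]_m) (b c : 'I_m) : X \in so -> odd c -> (b.+1 = c)%N ->
  lie X T b c = 0.
Proof.
move=> Xso oc bc; rewrite /lie mx_subE !mxE.
rewrite (bigD1 b)//= so_diag// mul0r add0r big1 => [|e eb]; last by rewrite (T_col oc bc eb) mulr0.
rewrite (bigD1 c)//= so_diag// mulr0 add0r big1 => [|e ec]; last by rewrite (T_row oc bc ec) mul0r.
by rewrite addr0 oppr0.
Qed.

(* A tangent vector [X, T] is skew with vanishing (2i, 2i+1) entries, so that it
   is determined by its entries at the positions p with P p. *)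
Let P (p : 'I_m * 'I_m) := (p.2 < (p.1)./2.*2)%N.
Let D (p : 'I_m * 'I_m) : 'M[R]_m := delta_mx p.1 p.2 - delta_mx p.2 p.1.

(** Row b contributes b./2.*2 positions, twice the number of coordinates of step b. *)
Let card_P : #|P| = (off m).*2.
Proof.
rewrite -sum1_card big_mkcond /= (eq_bigr (fun p : 'I_m * 'I_m => nat_of_bool (P p))); last first.
  move=> p _; have -> : (p \in P) = P p by [].
  by case: (P p).
rewrite -(pair_bigA _ (fun b c => nat_of_bool (P (b, c)))) /=.
rewrite /off big_mkord -mul2n big_distrr /=; apply: eq_bigr => b _.
rewrite mul2n /P /=.
have bm : (b./2.*2 <= m)%N by have := ltn_ord b; lia.
rewrite -(big_mkord xpredT (fun c => nat_of_bool (c < b./2.*2)%N)).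
rewrite (@big_cat_nat _ _ _ b./2.*2)//= big_nat [X in (_ + X)%N]big_nat.
rewrite (eq_bigr (fun=> 1%N)) => [|c /andP[_ ->]//].
rewrite -big_nat sum_nat_const_nat subn0 muln1 big1 ?addn0// => c /andP[cb _].
by rewrite ltnNge cb.
Qed.

Let decomp (Y : 'M[R]_m) : Y^T = - Y ->
  (forall b c : 'I_m, odd c -> (b.+1 = c)%N -> Y b c = 0) ->
  Y = \sum_(p | P p) Y p.1 p.2 *: D p.
Proof.
move=> YT Y0; have sk b c : Y c b = - Y b c.
  by have := congr1 (fun M : 'M[R]_m => M b c) YT; rewrite !mxE.
have d0 b : Y b b = 0 by have := sk b b; lra.
apply/matrixP => b c; rewrite summxE.
have E (f : 'I_m * 'I_m -> R) (b0 c0 : 'I_m) :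
    \sum_(p | P p) f p * (delta_mx p.1 p.2 : 'M[R]_m) b0 c0 = if P (b0, c0) then f (b0, c0) else 0.
  rewrite big_mkcond (bigD1 (b0, c0))//= big1 => [|[p q] pq]; last first.
    case: ifP => // _; rewrite mxE /=.
    case: eqP => [e1|]; case: eqP => [e2|] /=; rewrite ?mulr0//.
    by case/eqP: pq; rewrite e1 e2.
  by rewrite addr0 !mxE !eqxx mulr1.
rewrite (eq_bigr (fun p => Y p.1 p.2 * (delta_mx p.1 p.2 : 'M[R]_m) b c -
    Y p.1 p.2 * (delta_mx p.1 p.2 : 'M[R]_m) c b)); last first.
  by move=> [p q] _; rewrite /D !mxE /= mulrBr; congr (_ - _ * _%:R); rewrite andbC.
rewrite sumrB !E /P /=.
have [h1|h1] := boolP (c < b./2.*2)%N; have [h2|h2] := boolP (b < c./2.*2)%N; try (exfalso; lia).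
- by rewrite subr0.
- by rewrite sk sub0r.
rewrite subrr; have [->|bc] := eqVneq b c; first exact: d0.
have nbc : (b : nat) <> c by move=> /val_inj/eqP; rewrite (negPf bc).
have [h|h] : (b.+1 = c)%N /\ odd c \/ (c.+1 = b)%N /\ odd b by lia.
  by case: h => h oc; exact: Y0.
by case: h => h ob; rewrite sk Y0// oppr0.
Qed.

Lemma orbit_dim_le : (orbit_dim T <= (off m).*2)%N.
Proof.
rewrite /orbit_dim.
have sub : (orbit_tangent T <= <<[seq D p | p <- enum P]>>)%VS.
  apply/subvP => v /orbit_tangentP[X Xso ->].
  rewrite (decomp (lie_skew Xso) (fun b c => @lie_block X b c Xso)).
  by apply: memv_suml => p Pp; apply/memvZ/memv_span/map_f; rewrite mem_enum.
apply: leq_trans (dimvS sub) _; apply: leq_trans (dim_span _) _.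
by rewrite size_map -cardE card_P.
Qed.

Variable a : R.
Hypothesis a0 : 0 < a.
Hypothesis l_diff : forall i i', (i < i')%N -> (i' < m./2)%N -> a <= l i - l i'.
Hypothesis l_sum : forall i i', (i < i')%N -> (i' < m./2)%N -> a <= l i + l i'.
Hypothesis l_last : odd m -> forall i, (i < m./2)%N -> a <= 2 * l i.

(** The symplectic map itself provides the bound: its differential at 0 lands in the tangent space
    of the orbit and is injective, because it pulls the form back to a nondegenerate one. *)
Lemma orbit_dim_ge : ((off m).*2 <= orbit_dim T)%N.
Proof.
have B0 : std_ball a (0 : Z) by exact: std_ball0.
have F0 : Fs l m (0 : Z) = T.
  by rewrite /Fs (gs_zero a0 l_diff l_sum l_last (leqnn m)) Tk_top mul1mx trmx1 mulmx1.
pose L := linfun ('d (Fs l m) (0 : Z)).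
have LE v : L v = 'd (Fs l m) (0 : Z) v by rewrite lfunE.
have ker0 : lker L == 0%VS.
  apply/lker0P => u v; rewrite !LE => E.
  apply/eqP; rewrite -subr_eq0; apply/eqP; set w := u - v.
  have dw : 'd (Fs l m) (0 : Z) w = 0 by rewrite linearB /= E subrr.
  (* w and 0 have the same image under the differential, hence the same pairing with every y. *)
  have std0 y : std_form w y = 0.
    have := Fs_symplectic a0 l_diff l_sum l_last w y B0.
    have := Fs_symplectic a0 l_diff l_sum l_last (0 : Z) y B0.
    rewrite dw linear0 => -> <-; rewrite /std_form big1// => q _.
    by rewrite !mxE !mul0r mulr0 subrr.
  have c2 q : w.2 0 q = 0.
    have := std0 (delta_mx 0 q, 0); rewrite /std_form (bigD1 q)//= big1 => [|i iq].
      by rewrite !mxE !eqxx mulr0 mul1r addr0 sub0r => /eqP; rewrite oppr_eq0 => /eqP.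
    by rewrite !mxE (negPf iq) andbF mulr0 mul0r subrr.
  have c1 q : w.1 0 q = 0.
    have := std0 (0, delta_mx 0 q); rewrite /std_form (bigD1 q)//= big1 => [|i iq].
      by rewrite !mxE !eqxx mulr1 mul0r subr0 addr0.
    by rewrite !mxE (negPf iq) andbF mulr0 mul0r subrr.
  by rewrite (surjective_pairing w); congr (_, _); apply/rowP => q; rewrite ?c1 ?c2 mxE.
have img : (limg L <= orbit_tangent T)%VS.
  apply/subvP => _ /memv_imgP[v _ ->]; rewrite LE.
  have dF : differentiable (Fs l m) (0 : Z).
    exact: (Ck_on_Fs a0 l_diff l_sum l_last 1 (leqnn m)).1.
  rewrite -deriveE// (derive_Fs a0 l_diff l_sum l_last v B0) F0.
  apply/orbit_tangentP; eexists; last reflexivity.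
  exact: (velocity_so a0 l_diff l_sum l_last).
apply: leq_trans (dimvS img).
have := limg_ker_dim L fullv; rewrite capfv (eqP ker0) dimv0 add0n dimvf => ->.
have -> : dim ('rV[R]_(off m) * 'rV[R]_(off m))%type = (1 * off m + 1 * off m)%N by [].
by rewrite !mul1n addnn.
Qed.

Lemma half_orbit_dim : (orbit_dim T)./2 = off m.
Proof.
have -> : orbit_dim T = (off m).*2 by apply/eqP; rewrite eqn_leq orbit_dim_le orbit_dim_ge.
exact: doubleK.
Qed.

End OrbitDimension.

(** * Coroots and chambers *)

Section Coroots.
Context {R : realType} {n : nat}.
Implicit Types (u v l : 'rV[R]_n) (i k : 'I_n).

Lemma dotDl u v l : dot (u + v) l = dot u l + dot v l.
Proof. by rewrite /dot -big_split; apply: eq_bigr => i _; rewrite mxE mulrDl. Qed.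

Lemma dotZl (c : R) u l : dot (c *: u) l = c * dot u l.
Proof. by rewrite /dot mulr_sumr; apply: eq_bigr => i _; rewrite mxE mulrA. Qed.

Lemma dotNl u l : dot (- u) l = - dot u l.
Proof. by rewrite -scaleN1r dotZl mulN1r. Qed.

Lemma dot_delta i l : dot (delta_mx 0 i) l = l 0 i.
Proof.
rewrite /dot (bigD1 i)//= big1 => [|k ki]; first by rewrite mxE !eqxx mul1r addr0.
by rewrite mxE (negPf ki) andbF mul0r.
Qed.

Lemma coroot_opp u l : `|dot (coroot (- u)) l| = `|dot (coroot u) l|.
Proof.
have -> : coroot (- u) = - coroot u.
  rewrite /coroot scalerN; congr (- (2 / _ *: _)).
  by apply: eq_bigr => i _; rewrite mxE mulrNN.
by rewrite dotNl normrN.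
Qed.

Lemma coroot_short i l : dot (coroot (delta_mx 0 i)) l = 2 * l 0 i.
Proof. by rewrite /coroot dotZl !dot_delta mxE !eqxx divr1. Qed.

Lemma coroot_sum i k l : i != k ->
  dot (coroot (delta_mx 0 i + delta_mx 0 k)) l = l 0 i + l 0 k.
Proof.
move=> ik; rewrite /coroot dotZl !dotDl !dot_delta !mxE !eqxx /= ![k == i]eq_sym !(negPf ik).
by rewrite addr0 add0r divff ?mul1r// pnatr_eq0.
Qed.

Lemma coroot_diff i k l : i != k ->
  dot (coroot (delta_mx 0 i - delta_mx 0 k)) l = l 0 i - l 0 k.
Proof.
move=> ik; rewrite /coroot dotZl !dotDl !dotNl !dot_delta !mxE !eqxx /= ![k == i]eq_sym !(negPf ik).
by rewrite subr0 sub0r opprK divff ?mul1r// pnatr_eq0.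
Qed.

Lemma mem_short i : delta_mx 0 i \in @short_pos R n.
Proof. by apply/mapP; exists i; rewrite ?mem_enum. Qed.

Lemma mem_sum i k : i != k -> delta_mx 0 i + delta_mx 0 k \in @long_pos R n.
Proof.
move=> ik; rewrite mem_cat; apply/orP; left; apply/mapP; exists (i, k) => //.
by rewrite mem_filter /= ik mem_enum.
Qed.

Lemma mem_diff i k : i != k -> delta_mx 0 i - delta_mx 0 k \in @long_pos R n.
Proof.
move=> ik; rewrite mem_cat; apply/orP; right; apply/mapP; exists (i, k) => //.
by rewrite mem_filter /= ik mem_enum.
Qed.

Lemma with_oppP (s : seq 'rV[R]_n) (Q : 'rV[R]_n -> Prop) :
  (forall u, u \in s -> Q u) -> (forall u, Q u -> Q (- u)) ->
  forall u, u \in with_opp s -> Q u.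
Proof.
move=> Qs QN u; rewrite mem_cat => /orP[/Qs//|/mapP[v /Qs Qv ->]]; exact: QN.
Qed.

Lemma long_posP (Q : 'rV[R]_n -> Prop) :
  (forall i k, i != k -> Q (delta_mx 0 i + delta_mx 0 k) /\ Q (delta_mx 0 i - delta_mx 0 k)) ->
  forall u, u \in @long_pos R n -> Q u.
Proof.
move=> QQ u; rewrite mem_cat => /orP[]/mapP[[i k]]; rewrite mem_filter /= => /andP[ik _] ->.
  exact: (QQ i k ik).1.
exact: (QQ i k ik).2.
Qed.

Lemma min_coroot_le (s : seq 'rV[R]_n) l u : u \in s ->
  (min_coroot s l <= `|dot (coroot u) l|%:E)%E.
Proof.
rewrite /min_coroot; elim: s => // v s IH; rewrite inE big_cons ge_min.
by case/orP => [/eqP ->|/IH ->]; rewrite ?lexx ?orbT.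
Qed.

Lemma min_coroot_gt0 (s : seq 'rV[R]_n) l :
  (forall u, u \in s -> 0 < `|dot (coroot u) l|) -> (0 < min_coroot s l)%E.
Proof.
rewrite /min_coroot; elim: s => [|v s IH] H; first by rewrite big_nil ltry.
rewrite big_cons lt_min lte_fin H ?inE ?eqxx//= IH// => u us.
by apply: H; rewrite inE us orbT.
Qed.

(** Turns interior points into strict inequalities: a defining inequality that survives a small push
    against it was strict. *)
Lemma interior_perturb (A : set 'rV[R]_n) l d : A° l ->
  exists2 t : R, 0 < t & A (l + t *: d).
Proof.
move=> Al.
have c : (fun t : R => l + t *: d) t @[t --> 0] --> l.
  rewrite -[l in _ --> l]addr0 -(scale0r d).
  by apply: cvgD; [exact: cvg_cst|apply: cvgZr_tmp; exact: cvg_id].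
have /nbhs_ballP[e /= e0 H] : \forall t \near (0 : R), A (l + t *: d) by exact: c.
exists (e / 2); first by rewrite divr_gt0.
apply: H; rewrite /ball /= sub0r normrN gtr0_norm ?divr_gt0//.
by rewrite ltr_pdivrMr// ltr_pMr// ltr1n.
Qed.

Definition ext_row l (i : nat) : R := if insub i is Some k then l 0 k else 0.

Lemma ext_rowE l k : ext_row l k = l 0 k.
Proof. by rewrite /ext_row valK. Qed.

End Coroots.

(** * From the gaps of l to the Gromov width *)

Section Width.
Context {R : realType}.

Lemma torus_mxE n m (l : 'rV[R]_n) : m./2 = n -> torus_mx m l = tmx m m (ext_row l).
Proof.
move=> mn; apply/matrixP => b c; rewrite !mxE mn big_mkord.
by apply: eq_bigr => k _; rewrite ext_rowE.
Qed.

Lemma width_ge m (l : nat -> R) (a a1 : R) : 0 < a -> a < a1 ->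
  (forall i i', (i < i')%N -> (i' < m./2)%N -> a1 <= l i - l i') ->
  (forall i i', (i < i')%N -> (i' < m./2)%N -> a1 <= l i + l i') ->
  (odd m -> forall i, (i < m./2)%N -> a1 <= 2 * l i) ->
  (a%:E <= orbit_gromov_width (tmx m m l))%E.
Proof.
move=> a0 aa1 l_diff l_sum l_last; have a10 : 0 < a1 := lt_trans a0 aa1.
rewrite /orbit_gromov_width (half_orbit_dim a10 l_diff l_sum l_last).
apply: ereal_sup_ubound; exists a => //; split=> //; exists (Fs l m).
exact: (Fs_embedding a0 aa1 l_diff l_sum l_last).
Qed.

(** Every capacity a below the minimum c is realised, with c as the radius a1 of the larger ball;
    letting a tend to c gives the bound, which need not be attained. *)
Lemma min_coroot_width n m (l : 'rV[R]_n) (s : seq 'rV[R]_n) : m./2 = n ->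
  (exists u, u \in s) ->
  (forall u, u \in s -> 0 < `|dot (coroot u) l|) ->
  (forall c, (forall u, u \in s -> c <= `|dot (coroot u) l|) ->
    [/\ forall i k : 'I_n, (i < k)%N -> c <= l 0 i - l 0 k,
        forall i k : 'I_n, (i < k)%N -> c <= l 0 i + l 0 k &
        odd m -> forall i, c <= 2 * l 0 i]) ->
  (min_coroot s l <= orbit_gromov_width (torus_mx m l))%E.
Proof.
move=> mn [u0 u0s] pos gaps.
have w0 := min_coroot_gt0 pos; have wle := @min_coroot_le R n s l.
(* The default +oo is excluded by the root u0, and -oo by positivity. *)
case E : (min_coroot s l) w0 wle => [c| |] // c0 wle; last first.
  by have := wle _ u0s; rewrite leye_eq.
rewrite lte_fin in c0.
have [g1 g2 g3] := gaps c (fun u us => wle u us).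
rewrite torus_mxE//; set G := orbit_gromov_width _.
have lower a : 0 < a -> a < c -> (a%:E <= G)%E.
  move=> a0 ac; apply: (@width_ge m (ext_row l) a c) => //.
  - move=> i i' ii' i'm; rewrite mn in i'm.
    have := g1 (Ordinal (ltn_trans ii' i'm)) (Ordinal i'm) ii'.
    by rewrite -!ext_rowE.
  - move=> i i' ii' i'm; rewrite mn in i'm.
    have := g2 (Ordinal (ltn_trans ii' i'm)) (Ordinal i'm) ii'.
    by rewrite -!ext_rowE.
  - move=> om i im; rewrite mn in im; have := g3 om (Ordinal im).
    by rewrite -!ext_rowE.
apply/lee_subgt0Pr => e e0; have [ec|ce] := ltP e c.
  by apply: lower; lra.
apply: le_trans (lower (c / 2) _ _); last 2 first.
- lra.
- lra.
by rewrite -EFinB lee_fin; lra.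
Qed.

End Width.

Section Chambers.
Context {R : realType} {n : nat}.
Implicit Types (l : 'rV[R]_n) (i k : 'I_n).

Lemma chain_lt l (N : nat) :
  (forall i k, k = i.+1 :> nat -> (k < N)%N -> l 0 k < l 0 i) ->
  forall i k, (i < k)%N -> (k < N)%N -> l 0 k < l 0 i.
Proof.
move=> st i k; elim: (k : nat) {-2}k (erefl (k : nat)) => [|p IH] q qE.
  by rewrite qE ltn0.
rewrite qE ltnS leq_eqVlt => /orP[/eqP ip|ip] qN.
  by apply: st; rewrite ?qE ?ip.
have pn : (p < n)%N by have := ltn_ord q; lia.
apply: lt_trans (st (Ordinal pn) q _ _) (IH (Ordinal pn) erefl ip _); rewrite /= ?qE//.
by lia.
Qed.

Lemma interior_chamberB l : (chamberB R n)° l ->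
  (forall i k, (i < k)%N -> l 0 k < l 0 i) /\ (forall i, 0 < l 0 i).
Proof.
move=> lC.
have st i k : k = i.+1 :> nat -> l 0 k < l 0 i.
  move=> ki; have [t t0 [H _]] := interior_perturb (delta_mx 0 k) lC.
  have ik : (i == k) = false by apply/negbTE/eqP => e; have := congr1 val e; rewrite /=; lia.
  by have := H i k ki; rewrite !mxE !eqxx ik /= mulr1 mulr0; lra.
have dec i k : (i < k)%N -> l 0 k < l 0 i.
  by move=> ik; apply: (@chain_lt l n) => // ? ? ? _; exact: st.
have lst i : i.+1 = n -> 0 < l 0 i.
  move=> iN; have [t t0 [_ H]] := interior_perturb (- delta_mx 0 i) lC.
  by have := H i iN; rewrite !mxE !eqxx /=; lra.
split=> // i; have nn : (n.-1 < n)%N by have := ltn_ord i; lia.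
have last0 : 0 < l 0 (Ordinal nn) by apply: lst => /=; lia.
have [->//|ni] := eqVneq i (Ordinal nn).
apply: lt_trans last0 (dec _ _ _) => /=.
have : (i : nat) <> n.-1 by move=> e; case/eqP: ni; exact: val_inj.
by have := ltn_ord i; lia.
Qed.

(** At the last pair the chamber bounds |l_k|, so l_k is pushed both up and down to make the two
    bounds strict. Earlier entries then exceed |l_n| and are positive. *)
Lemma interior_chamberD l : (chamberD R n)° l ->
  forall i k, (i < k)%N -> `|l 0 k| < l 0 i.
Proof.
move=> lC.
have st i k : k = i.+1 :> nat -> (k.+1 < n)%N -> l 0 k < l 0 i.
  move=> ki kn; have [t t0 [H _]] := interior_perturb (delta_mx 0 k) lC.
  have ik : (i == k) = false by apply/negbTE/eqP => e; have := congr1 val e; rewrite /=; lia.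
  by have := H i k ki kn; rewrite !mxE !eqxx ik /= mulr1 mulr0; lra.
have lst i k : k = i.+1 :> nat -> k.+1 = n -> `|l 0 k| < l 0 i.
  move=> ki kn.
  have ik : (i == k) = false by apply/negbTE/eqP => e; have := congr1 val e; rewrite /=; lia.
  have [t t0 [_ H]] := interior_perturb (delta_mx 0 k) lC.
  have [t' t0' [_ H']] := interior_perturb (- delta_mx 0 k) lC.
  have := H i k ki kn; have := H' i k ki kn; rewrite !mxE !eqxx ik /= !(mulr1, mulr0, oppr0, mulrN) !addr0.
  rewrite !ler_norml ltr_norml => /andP[? ?] /andP[? ?]; apply/andP; split; lra.
have dec i k : (i < k)%N -> (k < n.-1)%N -> l 0 k < l 0 i.
  by move=> ik kn; apply: (@chain_lt l n.-1) => // i' k' e kn'; apply: st => //; lia.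
move=> i k ik.
have kn := ltn_ord k.
have n1 : (n.-2 < n)%N by lia.
have n2 : (n.-1 < n)%N by lia.
have L := lst (Ordinal n1) (Ordinal n2) _ _.
have {}L : `|l 0 (Ordinal n2)| < l 0 (Ordinal n1) by apply: L => /=; lia.
have pos (p : 'I_n) : (p < n.-1)%N -> l 0 (Ordinal n1) <= l 0 p.
  move=> pn; have [->//|ni] := eqVneq p (Ordinal n1).
  apply/ltW/dec => /=; last by lia.
  have : (p : nat) <> n.-2 by move=> e; case/eqP: ni; exact: val_inj.
  by lia.
have [kE|kE] := eqVneq k (Ordinal n2).
  by rewrite kE; apply: lt_le_trans L (pos _ _); rewrite kE /= in ik.
have knE : (k : nat) <> n.-1 by move=> e; case/eqP: kE; exact: val_inj.
have kn' : (k < n.-1)%N by lia.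
rewrite gtr0_norm; first exact: dec.
exact: lt_le_trans (le_lt_trans (normr_ge0 _) L) (pos _ kn').
Qed.

End Chambers.

Theorem theorem1p1 (R : realType) :
  (forall (n : nat) (l : 'rV[R]_n), (1 <= n)%N ->
     (chamberB R n)° l ->
     (min_coroot (rootsB n) l
        <= orbit_gromov_width (torus_mx n.*2.+1 l))%E)
  /\
  (forall (n : nat) (l : 'rV[R]_n), (2 <= n)%N ->
     (chamberD R n)° l ->
     (min_coroot (rootsD n) l
        <= orbit_gromov_width (torus_mx n.*2 l))%E).
Proof.
have ltE n (i k : 'I_n) : i != k -> (i < k)%N \/ (k < i)%N.
  by move=> ik; apply/orP; rewrite -neq_ltn.
have neq n (i k : 'I_n) : (i < k)%N -> i != k by move=> ik; rewrite neq_ltn ik.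
split=> n l n1 lC.
  have [dec pos] := interior_chamberB lC.
  have inS (u : 'rV[R]_n) : u \in short_pos n ++ long_pos n -> u \in rootsB n.
    by move=> us; rewrite /rootsB /with_opp mem_cat us.
  have inL (u : 'rV[R]_n) : u \in long_pos n -> u \in short_pos n ++ long_pos n.
    by move=> us; rewrite mem_cat us orbT.
  have inSh i : delta_mx 0 i \in (short_pos n ++ long_pos n : seq 'rV[R]_n).
    by rewrite mem_cat mem_short.
  apply: min_coroot_width.
  - by rewrite /= uphalf_double.
  - exists (delta_mx 0 (Ordinal n1)); exact: inS.
  - apply: with_oppP => [u|u]; last by rewrite coroot_opp.
    rewrite mem_cat => /orP[/mapP[i _ ->]|].
      by rewrite coroot_short normr_gt0 mulf_neq0 ?pnatr_eq0// gt_eqF// pos.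
    move: u; apply: long_posP => i k ik.
    rewrite coroot_sum// coroot_diff// !normr_gt0 gt_eqF ?addr_gt0//; split=> //.
    rewrite subr_eq0; case: (ltE _ _ _ ik) => /dec h; first by rewrite gt_eqF.
    by rewrite lt_eqF.
  - move=> c cle; split=> [i k ik|i k ik|_ i].
    + have := cle _ (inS _ (inL _ (mem_diff (neq _ _ _ ik)))).
      by rewrite coroot_diff ?neq// gtr0_norm ?subr_gt0 ?dec.
    + have := cle _ (inS _ (inL _ (mem_sum (neq _ _ _ ik)))).
      by rewrite coroot_sum ?neq// gtr0_norm ?addr_gt0.
    + have := cle _ (inS _ (inSh i)).
      by rewrite coroot_short gtr0_norm ?mulr_gt0.
have dec := interior_chamberD lC.
have inS (u : 'rV[R]_n) : u \in long_pos n -> u \in rootsD n.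
  by move=> us; rewrite /rootsD /with_opp mem_cat us.
have sum0 (i k : 'I_n) : (i < k)%N -> 0 < l 0 i + l 0 k.
  by move=> /dec; rewrite ltr_norml => /andP[? ?]; lra.
have diff0 (i k : 'I_n) : (i < k)%N -> 0 < l 0 i - l 0 k.
  by move=> /dec; rewrite ltr_norml => /andP[? ?]; lra.
apply: min_coroot_width.
- exact: doubleK.
- exists (delta_mx 0 (Ordinal (ltnW n1)) + delta_mx 0 (Ordinal n1) : 'rV[R]_n).
  by apply: inS; apply: mem_sum.
- apply: with_oppP => [|u]; last by rewrite coroot_opp.
  apply: long_posP => i k ik; rewrite coroot_sum// coroot_diff// !normr_gt0.
  case: (ltE _ _ _ ik) => h; first by rewrite !gt_eqF ?sum0 ?diff0.
  by rewrite addrC gt_eqF ?sum0// -oppr_eq0 opprB gt_eqF ?diff0.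
- move=> c cle; split=> [i k ik|i k ik|]; last by rewrite odd_double.
  + have := cle _ (inS _ (mem_diff (neq _ _ _ ik))).
    by rewrite coroot_diff ?neq// gtr0_norm ?diff0.
  + have := cle _ (inS _ (mem_sum (neq _ _ _ ik))).
    by rewrite coroot_sum ?neq// gtr0_norm ?sum0.
Qed.
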